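(* Let $x_1,x_2,y,z$ be four distinct vertices of degree 2 in a 2-connected graph $G$. If $d(v)=3$ for all $v\in V(G)\setminus\{x_1,x_2,y,z\}$, the vertices $x_1,x_2$ are not adjacent, and $x_1,x_2$ are not opposite vertices of a 4-cycle in $G$, then there are two $x_1-x_2$ paths $P_1,P_2$ in $G$ with $|E(P_1)|-|E(P_2)|\in\{1,2\}$.
   Context: All graphs are finite and simple; $d(v)$ denotes the degree of $v$. *)

(* Defs.v *)
From mathcomp Require Import all_boot.

Set Implicit Arguments.
Unset Strict Implicit.
Unset Printing Implicit Defensive.

(* A finite simple graph is a symmetric irreflexive relation [e] (adjacency)
   on a finite vertex type [V]. *)
Definition simple_graph (V : finType) (e : rel V) : Prop :=
  symmetric e /\ irreflexive e.

Definition degree (V : finType) (e : rel V) (v : V) : nat :=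
  #|[set w | e v w]|.

(* Adjacency in G - S; the vertices of S remain in the type, isolated. *)
Definition del_vertices (V : finType) (e : rel V) (S : {set V}) : rel V :=
  [rel u v | [&& u \notin S, v \notin S & e u v]].

Definition connected_off (V : finType) (e : rel V) (S : {set V}) : Prop :=
  forall u v : V, u \notin S -> v \notin S -> connect (del_vertices e S) u v.

Definition k_connected (V : finType) (e : rel V) (k : nat) : Prop :=
  k < #|V| /\ forall S : {set V}, #|S| < k -> connected_off e S.

(* The vertex sequence of the path is [x :: p], so it has [size p] edges. *)
Definition path_between (V : finType) (e : rel V) (x y : V) (p : seq V) : Prop :=
  [/\ path e x p, last x p = y & uniq (x :: p)].

Definition opposite_in_4cycle (V : finType) (e : rel V) (x y : V) : Prop :=
  exists a b : V, ucycle e [:: x; a; y; b].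

(* Main.v *)
(* Suppose no two x1-x2 paths have lengths differing by 1 or 2. Let C be a
   cycle avoiding x1 and x2 such that the rest of the graph is covered by
   disjoint connected sets D1 containing x1 and D2 containing x2. A vertex of
   degree 3 on C has a single neighbour off C; colour it 1 or 2 according to
   the side of that neighbour. Both colours occur, and two vertices of C at
   distances k and |C| - k with difference 1 or 2 cannot be coloured
   differently, as the two arcs between them would yield two good paths. If at
   most one vertex of C is uncoloured, this forces |C| = 2 mod 4 and colours
   alternating along C. Contracting C to a vertex t and applying induction to
   D2 + t then gives two paths from x2 to C with close lengths, which can be
   completed to x1-x2 paths with close lengths. With one exceptional vertex
   besides the roots (whose degrees are arbitrary) this proves the theorem.

   With two exceptional vertices y and z the argument applies to any cycle
   that does not separate y or z from {x1, x2}. If there is no such cycle, then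
   y and z are adjacent or have the same two neighbours; removing y and z, in
   the second case together with these neighbours, leaves a graph with two new
   exceptional vertices, to which induction applies. Graphs with at most 8
   vertices, which need not contain a suitable cycle, are searched. *)
Require Import Defs.
From mathcomp Require Import all_boot zify.
From Stdlib Require Import Classical.

Set Implicit Arguments.
Unset Strict Implicit.
Unset Printing Implicit Defensive.

(** * Paths and components *)

(** The inductions leave the class of 2-connected graphs. They run over relations on one fixed
    vertex type with support in a set [W], and the connectivity carried along is that of the graph
    with the edge [x1 x2] added ([linked]): this is what survives contracting a cycle to a root and,
    in a counterexample, the deletions.

    Two extremal choices make a cycle usable. The part linked to the roots is taken maximal, which
    forces the third edges of the cycle into it; and [D2] is taken minimal, so that one vertex [a]
    screens the rest of [D2] from [D1]. Contracting the cycle then changes degrees only at the new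
    roots, [a] and the cycle itself.

    Nonadjacency of the roots and the absence of the 4-cycle concern edges at the roots; they pass
    to subgraphs but say nothing about the roots of a contracted graph. So the statement applied
    after a contraction is free of them and leaves the degrees of the roots open.

    Deletion breaks down when the third neighbour of a common neighbour of [y] and [z] is a root,
    since that root would lose an edge. This case needs its own argument, in which a forbidden cycle
    is found directly. *)

Section Paths.
Variables (V : finType) (e : rel V).
Hypothesis e_sym : symmetric e.
Implicit Types (D S U : {set V}) (x y v w : V) (p c : seq V).

Definition haslen (x y : V) (l : nat) : Prop :=
  exists2 p, path_between e x y p & size p = l.

Definition good (x y : V) : Prop :=
  exists l, haslen x y l /\ (haslen x y l.+1 \/ haslen x y l.+2).

Lemma rev_path_sym x p : path e (last x p) (rev (belast x p)) = path e x p.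
Proof. by rewrite rev_path; apply: eq_path => u v /=; rewrite e_sym. Qed.

Lemma haslen_sym x y l : haslen x y l -> haslen y x l.
Proof.
case=> p [pp lp up] sp; exists (rev (belast x p)); last by rewrite size_rev size_belast.
split.
- by rewrite -lp rev_path_sym.
- by case: p lp {pp up sp} => [|a p] //= <-; rewrite rev_cons last_rcons.
- by rewrite -lp -rev_rcons -lastI rev_uniq.
Qed.

Lemma good_sym x y : good x y -> good y x.
Proof.
case=> l [h1 h2]; exists l; split; first exact: haslen_sym.
by case: h2 => h; [left|right]; apply: haslen_sym.
Qed.

Lemma good_near x y l l' : haslen x y l -> haslen x y l' ->
  l < l' -> l' <= l.+2 -> good x y.
Proof.
move=> h h' l1 l2; exists l; split=> //.
have [E|E] : l' = l.+1 \/ l' = l.+2 by lia.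
- by left; rewrite -E.
- by right; rewrite -E.
Qed.

Lemma connect_cross (r : rel V) (S : {set V}) x v :
  connect r x v -> x \notin S -> v \in S ->
  exists a b, [/\ connect r x a, a \notin S, b \in S & r a b].
Proof.
case/connectP=> p; elim/last_ind: p v => [|p b IH] v /=.
  by move=> _ -> h1 h2; rewrite h2 in h1.
rewrite rcons_path last_rcons => /andP[pp eb] -> xS bS.
have [aS|aS] := boolP (last x p \in S); first exact: (IH _ pp erefl).
by exists (last x p), b; split=> //; apply/connectP; exists p.
Qed.

Definition within (D : {set V}) : rel V := [rel a b | [&& a \in D, b \in D & e a b]].

Definition component (D : {set V}) (x : V) : {set V} := [set v | connect (within D) x v].

(** Connectedness of the subgraph induced by [D], put in terms of cuts. Set differences such as
    [X :\: D'] inherit this form directly from cut hypotheses; [rooted_connect] gives the paths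
    back. *)
Definition rooted (D : {set V}) (x : V) : Prop :=
  x \in D /\ forall S : {set V}, S \subset D -> S != set0 -> x \notin S ->
    exists u v, [/\ u \in S, v \in D, v \notin S & e u v].

Lemma component_refl D x : x \in component D x.
Proof. by rewrite inE connect0. Qed.

Lemma component_sub D x : x \in D -> component D x \subset D.
Proof.
move=> xD; apply/subsetP=> v; rewrite inE => h; apply: contraT => vD.
have [||a [b [_ _ bD /and3P[_ b2 _]]]] := connect_cross (S := ~: D) h.
- by rewrite inE negbK.
- by rewrite inE.
- by rewrite inE b2 in bD.
Qed.

Lemma component_closed D x u v : x \in D -> u \in component D x -> v \in D -> e u v -> v \in component D x.
Proof.
move=> xD uC vD uv; have uD := subsetP (component_sub xD) _ uC.
rewrite inE in uC; rewrite inE; apply: connect_trans uC (connect1 _).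
by rewrite /within /= uD vD.
Qed.

Lemma component_rooted D x : x \in D -> rooted (component D x) x.
Proof.
move=> xD; split; first exact: component_refl.
move=> S sS /set0Pn[v vS] xS.
have := subsetP sS _ vS; rewrite inE => h.
have [a [b [ca aS bS /and3P[_ _ ab]]]] := connect_cross h xS vS.
by exists b, a; split=> //; [rewrite inE | rewrite e_sym].
Qed.

Lemma rooted_connect D x v : rooted D x -> v \in D -> connect (within D) x v.
Proof.
case=> xD rD vD; apply: contraT => nc.
have [||| u [w [uS wD wS uw]]] := rD [set v in D | ~~ connect (within D) x v].
- by apply/subsetP=> u; rewrite inE => /andP[].
- by apply/set0Pn; exists v; rewrite inE vD.
- by rewrite inE connect0 andbF.
move: uS wS; rewrite !inE => /andP[uD /negP nu]; rewrite wD /= negbK => cw.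
by case: nu; apply: connect_trans cw (connect1 _); rewrite /within /= wD uD e_sym.
Qed.

Lemma connect_path D x v : x \in D -> connect (within D) x v ->
  exists p, [/\ path e x p, last x p = v, uniq (x :: p) & {subset x :: p <= D}].
Proof.
move=> xD /connectP[p pp ->]; case/shortenP: pp => q pq uq _.
exists q; split=> //; first by apply: sub_path pq => a b /and3P[].
move=> a; rewrite inE => /orP[/eqP->//|].
move: {uq} pq; elim: q x {xD} => //= b q IH x /andP[/and3P[_ bD _] pq].
by rewrite inE => /orP[/eqP->//|]; exact: IH pq.
Qed.

Lemma rooted_path D x v : rooted D x -> v \in D ->
  exists p, [/\ path e x p, last x p = v, uniq (x :: p) & {subset x :: p <= D}].
Proof. by move=> rD vD; apply: connect_path; [case: rD | apply: rooted_connect]. Qed.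

Lemma component_path D x v : x \in D -> v \in component D x ->
  exists p, [/\ path e x p, last x p = v, uniq (x :: p) & {subset x :: p <= D}].
Proof. by rewrite inE; apply: connect_path. Qed.

Lemma path_component D x p : path e x p -> {subset x :: p <= D} -> {subset x :: p <= component D x}.
Proof.
elim/last_ind: p => [|p b IH] pp sD a.
  by rewrite inE => /eqP->; rewrite component_refl.
rewrite -rcons_cons mem_rcons inE => /orP[/eqP->|].
  move: pp; rewrite rcons_path => /andP[pp eb].
  have xD : x \in D by apply: sD; rewrite mem_head.
  apply: (component_closed (u := last x p)) eb => //.
  - apply: (IH pp); last exact: mem_last.
    by move=> c cp; apply: sD; rewrite -rcons_cons mem_rcons inE cp orbT.
  - by apply: sD; rewrite -rcons_cons mem_rcons mem_head.
apply: IH => [|c cp]; first by move: pp; rewrite rcons_path => /andP[].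
by apply: sD; rewrite -rcons_cons mem_rcons inE cp orbT.
Qed.

Lemma component_sym D x y : x \in D -> y \in component D x -> x \in component D y.
Proof.
move=> xD; rewrite !inE => h; rewrite (_ : connect _ y x = connect (within D) x y) //.
by apply: sym_connect_sym => a b; rewrite /within /= e_sym; case: (a \in D); case: (b \in D).
Qed.

Lemma component_trans D x y z : y \in component D x -> z \in component D y -> z \in component D x.
Proof. by rewrite !inE; apply: connect_trans. Qed.

Lemma rooted_sub_component (D D' : {set V}) x y : rooted D x -> D \subset D' -> y \in D ->
  D \subset component D' y.
Proof.
move=> rD sD yD.
have xD : x \in D by case: rD.
have h v : v \in D -> v \in component D' x.
  move=> vD; have [p [pp lp up sp]] := rooted_path rD vD.
  have := path_component (D := D') pp; rewrite -lp; apply; last exact: mem_last.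
  by move=> a /sp; apply: (subsetP sD).
apply/subsetP=> v vD; apply: component_trans (h _ vD); apply: component_sym (h _ yD).
exact: (subsetP sD).
Qed.

Definition iscyc (c : seq V) : bool := [&& 2 < size c, cycle e c & uniq c].

Lemma iscyc_rot i c : iscyc (rot i c) = iscyc c.
Proof. by rewrite /iscyc size_rot rot_cycle rot_uniq. Qed.

(* The end of a longest path started at [z] is joined back to that path. *)
Lemma cycle_of_degrees U z u0 :
  irreflexive e -> u0 \in U -> u0 != z ->
  (forall v, v \in U -> v != z -> exists a b, [/\ a \in U, b \in U, a != b, e v a & e v b]) ->
  exists2 c, iscyc c & {subset c <= U}.
Proof.
move=> e_irr u0U u0z degU.
(* The path grows at its head [x]. By the last hypothesis [z] is either without neighbours in [U] or
   already behind the head, so it never becomes a head, where two neighbours would be required. *)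
have grow n x p : #|U| <= size p + n -> path e x p -> uniq (x :: p) -> {subset x :: p <= U} ->
    x != z -> (forall v, v \in U -> v != z -> z \in U -> e v z -> z \in p) ->
    exists2 c, iscyc c & {subset c <= U}.
  elim: n x p => [|n IH] x p hn pp up sU xz zp.
    have /(uniq_leq_size up) : {subset x :: p <= enum U} by move=> a /sU; rewrite mem_enum.
    by rewrite -cardE /=; move: hn; rewrite addn0; clear; lia.
  have xU : x \in U by apply: sU; rewrite mem_head.
  have [a [b [aU bU ab va vb]]] := degU x xU xz.
  (* [w] does not turn back: [head w (behead (w :: p))] is the vertex following [x] on the path, if
     there is one. *)
  have [w [wU vw wp]] : exists w, [/\ w \in U, e x w & w != head w (behead (w :: p)) \/ p = [::]].
    case: p {hn pp up sU zp} => [|q p]; first by exists a; split=> //; right.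
    have [E|E] := eqVneq a q.
      by exists b; split=> //; left; rewrite /= -E eq_sym.
    by exists a; split=> //; left.
  have wx : w != x by apply: contraTneq vw => ->; rewrite e_irr.
  have [win|win] := boolP (w \in p); last first.
    apply: (IH w (x :: p)) => //=.
    - by rewrite addSnnS.
    - by rewrite e_sym vw.
    - by rewrite inE negb_or wx win.
    - by move=> c; rewrite inE => /orP[/eqP->//|/sU].
    - apply/eqP=> wz; move: win; rewrite wz (zp x) //; by rewrite -wz.
    - by move=> v vU vz zU vze; rewrite inE (zp v) ?orbT.
  case: wp => [wp|p0]; last by rewrite p0 in win.
  case/splitPr: p / win pp up sU wp {hn zp} => p1 p2 pp up sU wp.
  exists (x :: rcons p1 w).
    case: p1 pp up wp {sU} => [|q p1] /=; first by rewrite eqxx.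
    move=> /andP[xq]; rewrite cat_path /= => /and3P[pq qw _] up _.
    apply/and3P; split=> //=.
    + by rewrite size_rcons.
    + by rewrite !rcons_path last_rcons xq pq qw e_sym.
    + have : uniq ([:: x, q & rcons p1 w] ++ p2) by rewrite /= cat_rcons.
      by rewrite cat_uniq => /andP[].
  by move=> c cin; apply: sU; rewrite -cat_rcons -cat_cons mem_cat cin.
have [/existsP[u /and3P[uU uz /andP[zU uze]]]|/existsPn nz] :=
    boolP [exists u, [&& u \in U, u != z, z \in U & e u z]].
  apply: (grow #|U| u [:: z]) => //=.
  - by rewrite uze.
  - by rewrite inE uz.
  - by move=> c; rewrite !inE => /orP[] /eqP->.
  - by move=> *; rewrite mem_head.
apply: (grow #|U| u0 [::]) => //=.
- by move=> c; rewrite inE => /eqP->.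
- by move=> v vU vz zU vze; move: (nz v); rewrite vU vz zU vze.
Qed.

End Paths.

(** * Enlarging the part of the graph linked to the roots *)

Section Cycles.
Variables (V : finType) (e : rel V).
Hypothesis e_sym : symmetric e.
Hypothesis e_irr : irreflexive e.
Implicit Types (D S U : {set V}) (x y v w : V) (p c r : seq V).

Lemma degree_uniq v s : uniq s -> all (e v) s -> size s <= degree e v.
Proof.
move=> us /allP es; rewrite /degree cardE; apply: (uniq_leq_size us) => a /es ea.
by rewrite mem_enum inE.
Qed.

Lemma cyc_next c v : iscyc e c -> v \in c -> e v (next c v).
Proof. by case/and3P=> _ cc _; apply: next_cycle. Qed.

Lemma cyc_prev c v : iscyc e c -> v \in c -> e v (prev c v).
Proof. by case/and3P=> _ cc _ vc; rewrite e_sym; apply: prev_cycle. Qed.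

Lemma next_cons v a s : next (v :: a :: s) v = a.
Proof. by rewrite /= eqxx. Qed.

Lemma prev_cons v s : uniq (v :: s) -> prev (v :: s) v = last v s.
Proof.
move=> us; have := cycle_next us; rewrite /= rcons_path => /andP[_ /eqP E].
by have := prev_next us (last v s); rewrite E.
Qed.

Lemma next_neq_prev c v : iscyc e c -> v \in c -> next c v != prev c v.
Proof.
case/and3P=> sc _ uc vc; case: (rot_to vc) => i s E.
rewrite -(next_rot i uc) -(prev_rot i uc) E.
have: size (v :: s) = size c by rewrite -E size_rot.
have us: uniq (v :: s) by rewrite -E rot_uniq.
case: s {E} us => [|a [|b s]] us; try by move=> E; move: sc; rewrite -E.
rewrite next_cons // prev_cons //= => _.
by move: us => /and3P[_ asb _]; apply: contraNneq asb => ->; apply: mem_last.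
Qed.

(** What remains linked to a root once [c] is removed. Its size measures progress whenever a cycle
    is exchanged for a better one. *)
Definition reach c x1 x2 : {set V} :=
  component e (~: [set v in c]) x1 :|: component e (~: [set v in c]) x2.

Lemma inCc c v : (v \in ~: [set u in c]) = (v \notin c).
Proof. by rewrite !inE. Qed.

Section Reach.
Variables x1 x2 : V.

Definition avoids c := (x1 \notin c) && (x2 \notin c).

Lemma reach1 c : x1 \in reach c x1 x2.
Proof. by rewrite inE component_refl. Qed.

Lemma reach2 c : x2 \in reach c x1 x2.
Proof. by rewrite inE orbC component_refl. Qed.

Lemma reach_notin c v : avoids c -> v \in reach c x1 x2 -> v \notin c.
Proof.
case/andP=> n1 n2; rewrite -inCc inE => /orP[]; apply/subsetP/component_sub; by rewrite inCc.
Qed.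

Lemma reach_closed c u v : avoids c -> u \in reach c x1 x2 -> v \notin c -> e u v ->
  v \in reach c x1 x2.
Proof.
case/andP=> n1 n2 uR vc uv; move: uR; rewrite !in_setU => /orP[] h; apply/orP; [left|right].
  by apply: component_closed h _ uv; rewrite inCc.
by apply: component_closed h _ uv; rewrite inCc.
Qed.

Lemma reach_closed_path c u p : avoids c -> u \in reach c x1 x2 -> path e u p ->
  {in p, forall v, v \notin c} -> last u p \in reach c x1 x2.
Proof.
move=> ac; elim: p u => //= a p IH u uR /andP[ua pp] pc.
apply: IH => //; last by move=> v vp; apply: pc; rewrite inE vp orbT.
by apply: reach_closed ua => //; apply: pc; rewrite mem_head.
Qed.

Lemma reach_cut c S : avoids c -> S \subset reach c x1 x2 -> S != set0 ->
  x1 \notin S -> x2 \notin S ->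
  exists u v, [/\ u \in S, v \in reach c x1 x2, v \notin S & e u v].
Proof.
move=> /andP[n1 n2] sS /set0Pn[v vS] s1 s2.
have aux x : x \notin c -> component e (~: [set v in c]) x \subset reach c x1 x2 -> x \notin S ->
    v \in component e (~: [set v in c]) x ->
    exists u v, [/\ u \in S, v \in reach c x1 x2, v \notin S & e u v].
  move=> xc sR xS vx.
  have [||||u [w [+ wC + uw]]] := (component_rooted e_sym (_ : x \in ~: [set v in c])).2
     (S :&: component e (~: [set v in c]) x).
  - by rewrite inCc.
  - exact: subsetIr.
  - by apply/set0Pn; exists v; rewrite inE vS.
  - by rewrite inE negb_and xS.
  rewrite !in_setI wC andbT => /andP[uS _] wS.
  by exists u, w; split=> //; apply: (subsetP sR).
have := subsetP sS _ vS; rewrite inE => /orP[]; apply: aux => //.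
- exact: subsetUl.
- exact: subsetUr.
Qed.

Lemma reach_mono c c' : avoids c -> avoids c' ->
  (forall v, v \in reach c x1 x2 -> v \notin c') -> reach c x1 x2 \subset reach c' x1 x2.
Proof.
move=> ac ac' h; rewrite -setD_eq0; apply: contraT => ne.
have [||||u [w [+ wR + uw]]] := @reach_cut c (reach c x1 x2 :\: reach c' x1 x2) ac.
- exact: subsetDl.
- exact: ne.
- by rewrite inE reach1.
- by rewrite inE reach2.
rewrite !in_setD wR andbT negbK => /andP[uR' uR] wR'.
by rewrite (reach_closed ac' wR' (h _ uR)) 1?e_sym in uR'.
Qed.

Variable W : {set V}.
Hypothesis supp : forall u v, e u v -> u \in W.

(* A cut form of "2-connected after adding the edge [x1 x2]": no nonempty
   set of other vertices is separated from the rest by a single vertex. *)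
Definition linked := forall S w, S \subset W -> S != set0 -> x1 \notin S -> x2 \notin S ->
  w \notin S -> exists u v, [/\ u \in S, v \notin S, v != w & e u v].

Hypothesis lnk : linked.

Lemma supp_r u v : e u v -> v \in W.
Proof. by rewrite e_sym; apply: supp. Qed.

Lemma reach_attach c : avoids c -> iscyc e c ->
  exists w u, [/\ w \in c, u \in reach c x1 x2 & e w u].
Proof.
move=> ac cc.
have [|||||u [v [+ + _ uv]]] := lnk (S := W :\: reach c x1 x2) (w := x1).
- exact: subsetDl.
- case/and3P: (cc); case: c cc ac => // a c cc ac _ _ _.
  apply/set0Pn; exists a; rewrite inE (supp (cyc_next cc (mem_head _ _))) andbT.
  apply/negP=> /(reach_notin ac); by rewrite mem_head.
- by rewrite inE reach1.
- by rewrite inE reach2.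
- by rewrite inE reach1.
rewrite !in_setD (supp_r uv) andbT negbK => /andP[uR uW] vR.
exists u, v; split=> //; apply: contraNT uR => uc.
by apply: reach_closed vR uc _ => //; rewrite e_sym.
Qed.

(** The ear [r] takes the place of the arc [s2]. The size condition excludes a closed walk along a
    single edge. *)
Lemma ear_seq a s1 b s2 r : iscyc e (a :: s1 ++ b :: s2) -> path e a (rcons r b) -> uniq r ->
  {in r, forall v, v \notin a :: s1 ++ b :: s2} -> 0 < size r + size s1 ->
  iscyc e (a :: s1 ++ b :: rev r).
Proof.
case/and3P=> _ /= cc uc pr ur dr sr; apply/and3P; split.
- by rewrite /= size_cat /= size_rev; move: sr; clear; lia.
- move: cc; rewrite /= !rcons_cat !cat_path /= !rcons_path => /and4P[-> -> _ _] /=.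
  have := rev_path_sym e_sym a (rcons r b).
  by rewrite pr last_rcons belast_rcons rev_cons rcons_path => ->.
- have : uniq ((a :: rcons s1 b) ++ s2) by rewrite /= cat_rcons.
  rewrite cat_uniq => /andP[U1 _].
  rewrite -cat_rcons -cat_cons cat_uniq U1 rev_uniq ur andbT /=.
  apply/hasPn=> v; rewrite mem_rev => /dr; apply: contra.
  by rewrite -cat_rcons -cat_cons mem_cat => ->.
Qed.

(** The two cycle neighbours and [h] use up the three edges at [a]. *)
Lemma no_reach_at_ear c a h u : avoids c -> iscyc e c -> a \in c -> degree e a <= 3 ->
  e a h -> h != next c a -> h != prev c a -> h \notin reach c x1 x2 ->
  u \in reach c x1 x2 -> ~~ e a u.
Proof.
move=> ac cc ain da ah hn hp hR uR; apply/negP=> au.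
have : size [:: u; h; next c a; prev c a] <= degree e a.
  apply: degree_uniq; last by rewrite /= au ah cyc_next // cyc_prev.
  have uc := reach_notin ac uR.
  rewrite /= !inE !negb_or hn hp next_neq_prev //= !andbT; apply/and3P; split.
  - by apply: contraNneq hR => <-.
  - by apply: contraNneq uc => ->; rewrite mem_next.
  - by apply: contraNneq uc => ->; rewrite mem_prev.
by rewrite leqNgt ltnS da.
Qed.

(* A path [r] leaving [c] and coming back closes a cycle with either arc of
   [c]; the arc dropped is one that is adjacent to [reach c]. *)
Lemma ear_step c a b r : avoids c -> iscyc e c -> {in c, forall v, degree e v <= 3} ->
  a \in c -> b \in c -> a != b -> path e a (rcons r b) -> uniq r ->
  {in r, forall v, v \notin c} -> {in r, forall v, v \notin reach c x1 x2} ->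
  (r == [::] -> b != next c a /\ b != prev c a) ->
  exists c', [/\ iscyc e c', avoids c', {subset c' <= c ++ r},
    reach c x1 x2 \subset reach c' x1 x2 & #|reach c x1 x2| < #|reach c' x1 x2|].
Proof.
move=> ac cc dc ain bin ab pr ur rc rR r0.
have [w [u [win uR wu]]] := reach_attach ac cc.
have bR : b \notin reach c x1 x2 by apply: contraL bin; apply: reach_notin.
have aR : a \notin reach c x1 x2 by apply: contraL ain; apply: reach_notin.
have wa : w != a.
  apply: contraTneq wu => ->.
  have [r00|r1] := eqVneq r [::].
    have [bn bp] := r0 (introT eqP r00).
    by apply: (@no_reach_at_ear c a b) => //; [apply: dc | move: pr; rewrite r00 /= andbT].
  case: r r1 pr rc rR {ur r0} => // h r _ /= /andP[ah _] rc rR.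
  have hc := rc _ (mem_head _ _).
  apply: (@no_reach_at_ear c a h) => //; first exact: dc.
  - by apply: contraNneq hc => ->; rewrite mem_next.
  - by apply: contraNneq hc => ->; rewrite mem_prev.
  - exact: rR (mem_head _ _).
have wb : w != b.
  apply: contraTneq wu => ->.
  have [r00|r1] := eqVneq r [::].
    have [bn bp] := r0 (introT eqP r00).
    have uc : uniq c by case/and3P: cc.
    apply: (@no_reach_at_ear c b a) => //; first exact: dc.
    - by move: pr; rewrite r00 /= andbT e_sym.
    - by apply: contraNneq bp => ->; rewrite prev_next.
    - by apply: contraNneq bn => ->; rewrite next_prev.
  case/lastP: r r1 pr rc rR {ur r0} => // r h _.
  rewrite -cats1 -cats1 -catA cat_path /= => /and4P[_ _ hb _] rc rR.
  have hin : h \in r ++ [:: h] by rewrite mem_cat mem_head orbT.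
  have hc := rc _ hin.
  apply: (@no_reach_at_ear c b h) => //; first exact: dc.
  - by rewrite e_sym.
  - by apply: contraNneq hc => ->; rewrite mem_next.
  - by apply: contraNneq hc => ->; rewrite mem_prev.
  - exact: rR hin.
have [i s E] := rot_to ain.
have bs : b \in s.
  by have := bin; rewrite -(mem_rot i) E inE eq_sym (negPf ab).
case/splitPr: s / bs E => s1 s2 E.
have cc' : iscyc e (a :: s1 ++ b :: s2) by rewrite -E iscyc_rot.
have mem v : (v \in c) = (v \in a :: s1 ++ b :: s2) by rewrite -E mem_rot.
have uc : uniq c by case/and3P: cc.
have us : uniq (a :: s1 ++ b :: s2) by case/and3P: cc'.
(* Dropping [w] is all that is needed: the new cycle still misses [reach c], and [w] joins the
   reachable part through [u]. *)
have fin c' : iscyc e c' -> {subset c' <= c ++ r} -> w \notin c' ->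
    exists c', [/\ iscyc e c', avoids c', {subset c' <= c ++ r},
      reach c x1 x2 \subset reach c' x1 x2 & #|reach c x1 x2| < #|reach c' x1 x2|].
  move=> ic' sc' wc'.
  have dis v : v \in reach c x1 x2 -> v \notin c'.
    move=> vR; apply/negP=> /sc'; rewrite mem_cat => /orP[|/rR].
      by apply/negP; apply: reach_notin vR.
    by rewrite vR.
  have ac' : avoids c' by rewrite /avoids !dis ?reach1 ?reach2.
  have sub := reach_mono ac ac' dis.
  exists c'; split=> //; apply/proper_card/properP; split=> //.
  exists w; last by apply: contraL win; apply: reach_notin.
  by apply: reach_closed (subsetP sub _ uR) wc' _ => //; rewrite e_sym.
have := win; rewrite mem inE (negPf wa) /= mem_cat inE (negPf wb) /= => /orP[ws|ws].
  (* Here the ear is run from [b] to [a], that is as [rev r], and [ear_seq] reverses it once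
     more. *)
  apply: (fin (b :: s2 ++ a :: rev (rev r))).
  - apply: (@ear_seq _ _ _ s1).
    + by rewrite -(iscyc_rot e (size (a :: s1))) -cat_cons rot_size_cat in cc'.
    + have := rev_path_sym e_sym a (rcons r b).
      by rewrite pr last_rcons belast_rcons rev_cons.
    + by rewrite rev_uniq.
    + move=> v; rewrite mem_rev => /rc; apply: contra; rewrite mem -!cat_cons !mem_cat.
      by rewrite orbC.
    + rewrite size_rev; case: (posnP (size r)) => [/size0nil r00|]; last by move=> h; rewrite addn_gt0 h.
      rewrite r00 /=; case: s2 E us {cc' mem ws} => // E us.
      have [_ bp] := r0 (introT eqP r00); case/eqP: bp.
      by rewrite -(prev_rot i uc) E prev_cons // last_cat.
  - move=> v; rewrite revK mem_cat mem !inE !mem_cat !inE.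
    by case: (v == a); case: (v == b); case: (v \in s1); case: (v \in s2); case: (v \in r).
  - have uw : uniq (s1 ++ s2) by move: us => /= /andP[_]; rewrite !cat_uniq /=; case/and3P=> -> /norP[_ ->] /andP[].
    have ws2 : w \notin s2.
      by move: uw; rewrite cat_uniq => /and3P[_ /hasPn h _]; apply: contraL ws; apply: h.
    rewrite revK inE (negPf wb) mem_cat (negPf ws2) inE (negPf wa) /=.
    by apply: contraL win; apply: rc.
apply: (fin (a :: s1 ++ b :: rev r)).
- apply: (ear_seq cc') => //.
    by move=> v /rc; rewrite mem.
  case: (posnP (size r)) => [/size0nil r00|]; last by move=> h; rewrite addn_gt0 h.
  rewrite r00 /=; case: s1 E us {cc' mem} => // E us.
  have [bn _] := r0 (introT eqP r00); case/eqP: bn.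
  by rewrite -(next_rot i uc) E /= eqxx.
- move=> v; rewrite mem_cat mem !inE !mem_cat !inE mem_rev.
  by case: (v == a); case: (v == b); case: (v \in s1); case: (v \in s2); case: (v \in r).
- have uw : uniq (s1 ++ s2) by move: us => /= /andP[_]; rewrite !cat_uniq /=; case/and3P=> -> /norP[_ ->] /andP[].
  have ws2 : w \notin s1.
    by move: uw; rewrite cat_uniq => /and3P[_ /hasPn h _]; apply: h.
  rewrite inE (negPf wa) mem_cat (negPf ws2) inE (negPf wb) /= mem_rev.
  by apply: contraL win; apply: rc.
Qed.

Lemma component_supp D u : u \in W -> component e D u \subset W.
Proof.
move=> uW; apply/subsetP=> v; rewrite inE => /connectP[p]; case/lastP: p => [_ ->//|p b].
rewrite rcons_path last_rcons => /andP[_ /and3P[_ _ h]] ->; exact: supp_r h.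
Qed.

Definition offc c S : {set V} := ~: ([set v in c] :|: S).

Lemma in_offc c S v : (v \in offc c S) = (v \notin c) && (v \notin S).
Proof. by rewrite !inE negb_or. Qed.

Lemma component_notreach c S u v : avoids c -> u \in offc c S -> u \notin reach c x1 x2 ->
  v \in component e (offc c S) u -> v \notin reach c x1 x2.
Proof.
move=> ac uD uR vK; apply: contra uR => vR.
have [q' [pq' <- _ sq']] :=
  component_path (subsetP (component_sub e uD) _ vK) (component_sym e_sym uD vK).
apply: reach_closed_path => // w wq.
by have := sq' w; rewrite inE wq orbT in_offc => /(_ isT)/andP[].
Qed.

(** [S] is to stay off the new cycle: it is empty in [settle], and [{y}] where cycles missing [y]
    are compared. *)
Definition growable S c := exists c', [/\ iscyc e c', avoids c', {in S, forall v, v \notin c'},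
    reach c x1 x2 \subset reach c' x1 x2 & #|reach c x1 x2| < #|reach c' x1 x2|].

Lemma growable_chord S c v b : avoids c -> iscyc e c -> {in c, forall v, degree e v <= 3} ->
  {in S, forall v, v \notin c} ->
  v \in c -> b \in c -> e v b -> b != next c v -> b != prev c v -> growable S c.
Proof.
move=> ac cc dc Sc vin bin vb bn bp.
have [||||||c' [h1 h2 h3 h4 h5]] := @ear_step c v b [::] ac cc dc vin bin => //.
- by apply: contraTneq vb => ->; rewrite e_irr.
- by rewrite /= vb.
exists c'; split=> // s sS; apply: contra (Sc _ sS) => /h3; by rewrite cats0.
Qed.

(** A path through the component of [u] off [c] and [S] is an ear from [v] to [b]. The component
    cannot meet [reach c], because [u] does not. *)
Lemma growable_ear S c v u k b : avoids c -> iscyc e c -> {in c, forall v, degree e v <= 3} ->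
  {in S, forall v, v \notin c} -> v \in c -> e v u -> u \in offc c S ->
  u \notin reach c x1 x2 -> k \in component e (offc c S) u -> b \in c -> b != v -> e k b ->
  growable S c.
Proof.
move=> ac cc dc Sc vin vu uD uR kK bin bv kb.
have [p [pp lp up sp]] := component_path uD kK.
have sK := path_component pp sp.
have [||||||c' [h1 h2 h3 h4 h5]] := @ear_step c v b (u :: p) ac cc dc vin bin => //.
- by rewrite eq_sym.
- by rewrite /= vu rcons_path pp lp kb.
- by move=> w /sp; rewrite in_offc => /andP[].
- by move=> w /sK; apply: component_notreach.
exists c'; split=> // s sS; apply/negP=> /h3; rewrite mem_cat (negPf (Sc _ sS)) /= => /sp.
by rewrite in_offc sS andbF.
Qed.

Definition settled c := {in c, forall v u, e v u -> u != next c v -> u != prev c v ->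
  u \in reach c x1 x2}.

(** Take the reachable part maximal. A chord of [c] is an ear. A neighbour [u] of [v] outside [c]
    and [reach c] has a component off [c] with an exit other than [v], by [linked]; that exit lies
    on [c], which again gives an ear. So in the end every third edge leads into the reachable part,
    and the vertex has a colour. *)
Lemma settle c : avoids c -> iscyc e c ->
  (forall v, v \in W -> v != x1 -> v != x2 -> degree e v <= 3) ->
  exists c', [/\ iscyc e c', avoids c', reach c x1 x2 \subset reach c' x1 x2 & settled c'].
Proof.
move=> + + dW; have [n] := ubnP (#|V| - #|reach c x1 x2|).
elim: n c => // n IH c hn ac cc.
have dc : {in c, forall v, degree e v <= 3}.
  move=> v vc; apply: dW; first exact: supp (cyc_next cc vc).
  - by apply: contraTneq vc => ->; case/andP: ac.
  - by apply: contraTneq vc => ->; case/andP: ac.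
have step : growable set0 c -> exists c',
    [/\ iscyc e c', avoids c', reach c x1 x2 \subset reach c' x1 x2 & settled c'].
  case=> c1 [i1 a1 _ s1 l1].
  have [|//|//|c' [i2 a2 s2 st]] := IH c1.
    have : #|reach c1 x1 x2| <= #|V| := max_card _.
    by move: hn l1; clear; lia.
  by exists c'; split=> //; apply: subset_trans s2.
pose bad := [exists v, exists u, [&& v \in c, e v u, u != next c v, u != prev c v &
  u \notin reach c x1 x2]].
have [|] := boolP bad; last first.
  move/existsPn=> nb; exists c; split=> // v vc u vu un up; apply: contraT => uR.
  by move: (nb v) => /existsPn/(_ u); rewrite vc vu un up uR.
case/existsP=> v /existsP[u /and5P[vc vu un up uR]].
have S0 : {in (set0 : {set V}), forall v, v \notin c} by move=> ?; rewrite inE.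
have [uc|uc] := boolP (u \in c).
  by apply/step/(growable_chord ac cc dc S0 vc uc vu).
have uD : u \in offc c set0 by rewrite in_offc uc inE.
have nR := component_notreach ac uD uR.
have [|||||k [b [kK bK bv kb]]] := lnk (S := component e (offc c set0) u) (w := v).
- exact/component_supp/(supp_r vu).
- by apply/set0Pn; exists u; apply: component_refl.
- by apply/negP=> /nR; rewrite reach1.
- by apply/negP=> /nR; rewrite reach2.
- apply/negP=> /(subsetP (component_sub e uD)); by rewrite in_offc vc.
have bc : b \in c.
  apply: contraNT bK => bc; apply: (component_closed uD kK _ kb).
  by rewrite in_offc bc inE.
exact/step/(growable_ear ac cc dc S0 vc vu uD uR kK bc bv kb).
Qed.

End Reach.

End Cycles.

(** * Splitting the graph off a cycle into two sides *)

Section Split.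
Variables (V : finType) (e : rel V).
Hypothesis e_sym : symmetric e.
Implicit Types (D S U : {set V}) (x y v w : V) (p c r : seq V).
Variables (x1 x2 : V) (W : {set V}).
Hypothesis supp : forall u v, e u v -> u \in W.
Hypothesis lnk : linked e x1 x2 W.
Variable c : seq V.
Hypotheses (ac : avoids x1 x2 c) (cc : iscyc e c).

Definition touches D := [exists u in D, has (e u) c].

Lemma touchesP D : reflect (exists u w, [/\ u \in D, w \in c & e u w]) (touches D).
Proof.
apply: (iffP exists_inP) => [[u uD /hasP[w wc uw]]|[u [w [uD wc uw]]]].
  by exists u, w.
by exists u => //; apply/hasP; exists w.
Qed.

Record halves D1 D2 : Prop := Split {
  split1 : rooted e D1 x1;
  split2 : rooted e D2 x2;
  splitI : forall v, v \in D1 -> v \notin D2;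
  splitU : D1 :|: D2 = reach e c x1 x2 }.

Lemma cyc_in_W v : v \in c -> v \in W.
Proof. by move=> vc; exact: supp (cyc_next cc vc). Qed.

Lemma cyc_nonempty : exists v, v \in c.
Proof. by case/and3P: cc; case: c => // a s _ _ _; exists a; apply: mem_head. Qed.

Lemma exit_reach u v : v \in reach e c x1 x2 -> u \notin reach e c x1 x2 -> e u v -> u \in c.
Proof. by move=> vR uR uv; apply: contraNT uR => uc; apply: reach_closed vR uc _; rewrite // e_sym. Qed.

Lemma setDU_sub D (X : {set V}) : D \subset X -> X :\: D :|: D = X.
Proof.
move=> /subsetP s; apply/setP=> v; rewrite in_setU in_setD.
by case: (boolP (v \in D)) => [/s->|]; rewrite ?orbF.
Qed.

(** [D2] is what [x2] reaches inside [X] without using [x1]. If [c] did not touch it, [x1] alone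
    would cut off everything outside [D2]. *)
Lemma split_init : x1 != x2 -> exists D1 D2, halves D1 D2 /\ touches D2.
Proof.
move=> x12; set X := reach e c x1 x2; pose D2 := component e (X :\ x1) x2.
have x2X : x2 \in X :\ x1 by rewrite in_setD1 eq_sym x12 reach2.
have sD2 := component_sub e x2X; rewrite -/D2 in sD2.
have x1D2 : x1 \notin D2 by apply/negP=> /(subsetP sD2); rewrite in_setD1 eqxx.
have cD2 u v : v \in D2 -> u \in X -> u != x1 -> e u v -> u \in D2.
  move=> vD uX ux uv; apply: (component_closed x2X vD); last by rewrite e_sym.
  by rewrite in_setD1 ux.
exists (X :\: D2), D2; split; first split.
- split; first by rewrite in_setD x1D2 reach1.
  move=> S sS S0 x1S.
  have sX : S \subset X := subset_trans sS (subsetDl _ _).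
  have [|u [v [uS vX vS uv]]] := reach_cut e_sym ac sX S0 x1S.
    by apply/negP=> /(subsetP sS); rewrite in_setD component_refl.
  exists u, v; split=> //; rewrite in_setD vX andbT.
  have := subsetP sS _ uS; rewrite in_setD => /andP[+ uX]; apply: contra => vD.
  by apply: cD2 vD uX _ uv; apply: contraNneq x1S => <-.
- exact: component_rooted.
- by move=> v; rewrite in_setD => /andP[].
- exact: setDU_sub (subset_trans sD2 (subsetDl _ _)).
- have [|||||u [v [+ + vx uv]]] := lnk (S := W :\: (x1 |: D2)) (w := x1).
  + exact: subsetDl.
  + have [v vc] := cyc_nonempty; apply/set0Pn; exists v.
    rewrite in_setD in_setU in_set1 negb_or (cyc_in_W vc) andbT; apply/andP; split.
      by apply: contraTneq vc => ->; case/andP: ac.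
    apply: contraL vc => /(subsetP sD2); rewrite in_setD1 => /andP[_].
    exact: reach_notin.
  + by rewrite in_setD in_setU set11.
  + by rewrite in_setD in_setU component_refl orbT.
  + by rewrite in_setD in_setU set11.
  rewrite !in_setD !in_setU !in_set1 (negPf vx) (supp_r e_sym supp uv) andbT negbK /=.
  rewrite negb_or => /andP[/andP[ux uD] _] vD; apply/touchesP; exists v, u.
  split=> //; last by rewrite e_sym.
  apply: (exit_reach (v := v)) => //.
    by have := subsetP sD2 _ vD; rewrite in_setD1 => /andP[].
  by apply: contra uD => uX; apply: cD2 vD uX ux uv.
Qed.

(** Minimality of [D2] among the sides that touch [c], in the local form that is used: no single
    vertex in contact with [D1] can be handed over to [D1]. *)
Definition minimal2 D1 D2 := forall a b, a \in D2 -> a != x2 -> b \in D1 -> e a b ->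
  ~~ touches (component e (D2 :\ a) x2).

(** A vertex [a] violating minimality goes over to [D1], with all that it separates from [x2] inside
    [D2]. The new first side is connected, since these pieces hang on [a] and [a] is adjacent to [b]
    in [D1]. The second side has lost [a]. *)
Lemma split_shrink D1 D2 : halves D1 D2 -> touches D2 ->
  exists D1' D2', [/\ halves D1' D2', touches D2', D2' \subset D2 & minimal2 D1' D2'].
Proof.
have [n] := ubnP #|D2|; elim: n D1 D2 => // n IH D1 D2 hn sp t2.
pose bad := [exists a, exists b, [&& a \in D2, a != x2, b \in D1, e a b &
  touches (component e (D2 :\ a) x2)]].
have [|] := boolP bad; last first.
  move/existsPn=> nb; exists D1, D2; split=> // a b aD ax bD ab; apply/negP=> t.
  by move: (nb a) => /existsPn/(_ b); rewrite aD ax bD ab t.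
case/existsP=> a /existsP[b /and5P[aD ax bD ab t]].
have [r1 r2 dis U] := sp.
set D' := component e (D2 :\ a) x2 in t.
have x2D : x2 \in D2 :\ a by rewrite in_setD1 eq_sym ax; case: r2.
have sD' : D' \subset D2 :\ a := component_sub e x2D.
have aD' : a \notin D' by apply/negP=> /(subsetP sD'); rewrite in_setD1 eqxx.
have D'D2 : D' \subset D2 := subset_trans sD' (subsetDl _ _).
have D2X : D2 \subset reach e c x1 x2 by rewrite -U subsetUr.
have D1X : D1 \subset reach e c x1 x2 by rewrite -U subsetUl.
have D'X := subset_trans D'D2 D2X.
have [||E1 [E2 [s' t' l' m']]] := IH (reach e c x1 x2 :\: D') D' _ _ t.
- apply: (leq_trans _ (hn : #|D2| <= n)); apply: proper_card; apply/properP; split=> //; by exists a.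
- split.
  + split.
      rewrite in_setD reach1 andbT; apply: contraL (proj1 r1) => /(subsetP D'D2) h.
      by apply/negP=> /dis; rewrite h.
    move=> S sS /set0Pn[s0 s0S] x1S.
    have SX : S \subset reach e c x1 x2 := subset_trans sS (subsetDl _ _).
    have [E|/set0Pn[v vS]] := eqVneq (S :&: D1) set0.
      have SD2 v : v \in S -> v \in D2.
        move=> vS; have := subsetP SX _ vS; rewrite -U in_setU => /orP[vD|//].
        by have := in_set0 v; rewrite -E in_setI vS vD.
      have [aS|aS] := boolP (a \in S).
        exists a, b; split=> //.
          rewrite in_setD (subsetP D1X _ bD) andbT; apply: contraL bD => /(subsetP D'D2) h.
          by apply/negP=> /dis; rewrite h.
        by apply: contraTN bD => bS; have := in_set0 b; rewrite -E in_setI bS => /= ->.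
      have [|||u [v [uS vD vS uv]]] := r2.2 S.
      * by apply/subsetP.
      * by apply/set0Pn; exists s0.
      * by apply/negP=> /(subsetP sS); rewrite in_setD component_refl.
      exists u, v; split=> //; rewrite in_setD (subsetP D2X _ vD) andbT.
      have := subsetP sS _ uS; rewrite in_setD => /andP[+ uX]; apply: contra => vD'.
      apply: (component_closed x2D vD'); last by rewrite e_sym.
      by rewrite in_setD1 (SD2 _ uS) andbT; apply: contraNneq aS => <-.
    have [|||u [w [+ wD + uw]]] := r1.2 (S :&: D1).
    * exact: subsetIr.
    * by apply/set0Pn; exists v.
    * by rewrite in_setI (negPf x1S).
    rewrite !in_setI wD andbT => /andP[uS uD] wS; exists u, w; split=> //.
    rewrite in_setD (subsetP D1X _ wD) andbT; apply: contraL wD => /(subsetP D'D2) h.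
    by apply/negP=> /dis; rewrite h.
  + exact: component_rooted.
  + by move=> v; rewrite in_setD => /andP[].
  + exact: setDU_sub.
by exists E1, E2; split=> //; apply: subset_trans D'D2.
Qed.

(* [a] is the vertex of [D2] nearest to [c] that is adjacent to [D1]; [P] is
   the part of [D2] cut off from [c] by [a], on the side of [x2]. *)
Record pivot D1 D2 (a : V) (P : {set V}) : Prop := Pivot {
  pivot_in : a \in D2;
  pivot_sub : P \subset D2 :\ a;
  pivot_root : x2 = a \/ x2 \in P;
  pivot_touch : ~~ touches P;
  pivot_closed : forall u v, u \in D2 :\: P -> u != a -> v \in P -> ~~ e u v;
  pivot_contact : forall u v, u \in D2 :\: P -> u != a -> v \in D1 -> ~~ e u v;
  pivot_path : exists q, [/\ path e x2 q, last x2 q = a, uniq (x2 :: q) &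
    {subset x2 :: q <= a |: P}] }.

(** Without a contact other than [x2], take [a = x2] and [P] empty. Otherwise choose a contact [a]
    for which the part [Q a] of [x2] in [D2 :\ a] is largest: for a further contact [u] outside
    [Q a] and different from [a], both [Q a] and [a] would lie in [Q u]. *)
Lemma pivot_exists D1 D2 : halves D1 D2 -> minimal2 D1 D2 -> exists a P, pivot D1 D2 a P.
Proof.
move=> [r1 r2 dis U] m2.
pose Q a := component e (D2 :\ a) x2.
pose contact a := [&& a \in D2, a != x2 & [exists b in D1, e a b]].
have [/existsP[a0 ca0]|/existsPn nc] := boolP [exists a, contact a]; last first.
  exists x2, set0; split.
  - by case: r2.
  - exact: sub0set.
  - by left.
  - by apply/negP=> /touchesP[u [w []]]; rewrite inE.
  - by move=> u v _ _; rewrite inE.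
  - move=> u v; rewrite in_setD => /andP[_ uD] ux vD; apply/negP=> uv.
    by case/negP: (nc u); rewrite /contact uD ux; apply/exists_inP; exists v.
  - by exists [::]; split=> // v; rewrite mem_seq1 => /eqP->; rewrite setU11.
case: (@arg_maxnP _ a0 contact (fun a => #|Q a|) ca0) => a /and3P[aD ax /exists_inP[b bD ab]] amax.
have x2a : x2 \in D2 :\ a by rewrite in_setD1 eq_sym ax; case: r2.
have sQ : Q a \subset D2 :\ a := component_sub e x2a.
have [q [pq lq uq sq]] := rooted_path e_sym r2 aD.
have [p Eq] : exists p, q = rcons p a.
  case/lastP: q lq {pq uq sq} => [/= E|p b' <-]; first by rewrite E eqxx in ax.
  by exists p; rewrite last_rcons.
have sp : {subset x2 :: p <= Q a}.
  apply: path_component; first by move: pq; rewrite Eq rcons_path => /andP[].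
  move=> v vp; rewrite in_setD1 sq ?andbT; last first.
    by rewrite Eq -rcons_cons mem_rcons inE vp orbT.
  apply: contraTneq vp => ->.
  by move: uq; rewrite Eq -rcons_cons rcons_uniq => /andP[].
exists a, (Q a); split=> //.
- by right; apply: component_refl.
- exact: m2 aD ax bD ab.
- move=> u v; rewrite in_setD => /andP[uQ uD] ua vQ; apply: contra uQ => uv.
  apply: (component_closed x2a vQ); last by rewrite e_sym.
  by rewrite in_setD1 ua.
- move=> u v; rewrite in_setD => /andP[uQ uD] ua vD; apply/negP=> uv.
  have ux : u != x2 by apply: contraNneq uQ => ->; apply: component_refl.
  have cu : contact u by rewrite /contact uD ux; apply/exists_inP; exists v.
  have : #|Q u| <= #|Q a| := amax u cu; rewrite leqNgt => /negP; apply; apply/proper_card/properP.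
  have x2u : x2 \in D2 :\ u by rewrite in_setD1 eq_sym ux; case: r2.
  have sQu : Q a \subset Q u.
    apply: (rooted_sub_component e_sym (x := x2)).
    + exact: component_rooted.
    + apply/subsetP=> w wQ; rewrite in_setD1; have := subsetP sQ _ wQ.
      by rewrite in_setD1 => /andP[_ ->]; rewrite andbT; apply: contraNneq uQ => <-.
    + exact: component_refl.
  split=> //; exists a; last by apply/negP=> /(subsetP sQ); rewrite in_setD1 eqxx.
  move: pq lq; rewrite Eq rcons_path => /andP[pp ea] _.
  apply: (component_closed x2u (subsetP sQu _ (sp _ (mem_last _ _))) _ ea).
  by rewrite in_setD1 aD andbT eq_sym.
- exists q; split=> // v; rewrite Eq -rcons_cons mem_rcons inE => /orP[/eqP->|/sp h].
    exact: setU11.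
  by rewrite in_setU h orbT.
Qed.

Lemma pivot_rooted D1 D2 a P : halves D1 D2 -> pivot D1 D2 a P -> rooted e (D2 :\: P) a.
Proof.
move=> [r1 r2 dis U] [aD sP rP tP cP kP _].
have aP : a \notin P by apply/negP=> /(subsetP sP); rewrite in_setD1 eqxx.
split; first by rewrite in_setD aP.
move=> S sS S0 aS.
have [|||u [v [uS vD vS uv]]] := r2.2 S.
- exact: subset_trans sS (subsetDl _ _).
- exact: S0.
- apply/negP=> xS; case: rP => [E|]; first by rewrite -E xS in aS.
  by apply/negP; have := subsetP sS _ xS; rewrite in_setD => /andP[].
exists u, v; split=> //; rewrite in_setD vD andbT; apply/negP=> vP.
have ua : u != a by apply: contraNneq aS => <-.
by have := cP u v (subsetP sS _ uS) ua vP; rewrite uv.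
Qed.

(** Removing [a] must not cut off [c]. The edge that prevents this ends in [D1] or [P]; it cannot
    start in the rest of [D2], and [c] has no edge to [P], so it joins [c] to [D1]. *)
Lemma pivot_touches1 D1 D2 a P : halves D1 D2 -> pivot D1 D2 a P -> touches D1.
Proof.
move=> [r1 r2 dis U] [aD sP rP tP cP kP _].
have DX v : (v \in D1) || (v \in D2) = (v \in reach e c x1 x2) by rewrite -U in_setU.
have PD v : v \in P -> v \in D2 by move/(subsetP sP); rewrite in_setD1 => /andP[].
have nXc v : v \in c -> (v \notin D1) && (v \notin D2).
  by move=> vc; rewrite -negb_or DX; apply: contraL vc; apply: reach_notin.
have [|||||u [v [+ + va uv]]] := lnk (S := W :\: (a |: (D1 :|: P))) (w := a).
- exact: subsetDl.
- have [v vc] := cyc_nonempty; apply/set0Pn; exists v.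
  have /andP[n1 n2] := nXc v vc.
  rewrite in_setD in_setU1 in_setU (negPf n1) (cyc_in_W vc) andbT /= negb_or.
  by apply/andP; split; [apply: contraNneq n2 => -> | apply: contra n2 => /PD].
- by rewrite in_setD in_setU1 in_setU r1.1 orbT.
- by rewrite in_setD in_setU1 in_setU; case: rP => [->|->]; rewrite ?eqxx ?orbT.
- by rewrite in_setD setU11.
rewrite !in_setD !in_setU1 !in_setU (negPf va) (supp_r e_sym supp uv) andbT negbK /=.
rewrite !negb_or => /andP[/and3P[ua uD1 uP] _] vDP.
have uc : u \in c.
  have [uX|uX] := boolP (u \in reach e c x1 x2).
    move: uX; rewrite -DX (negPf uD1) /= => uD2.
    have uDP : u \in D2 :\: P by rewrite in_setD uP.
    by case/orP: vDP => h; [have := kP _ _ uDP ua h | have := cP _ _ uDP ua h]; rewrite uv.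
  apply: (exit_reach (v := v)) => //; rewrite -DX.
  by case/orP: vDP => [->//|/PD ->]; rewrite orbT.
case/orP: vDP => h; first by apply/touchesP; exists v, u; rewrite e_sym.
by case/negP: tP; apply/touchesP; exists v, u; rewrite e_sym.
Qed.

Lemma split_exists : x1 != x2 -> exists D1 D2, [/\ halves D1 D2, touches D1 & touches D2].
Proof.
case/split_init=> D1 [D2 [s t]].
have [E1 [E2 [s' t' _ m]]] := split_shrink s t.
have [a [P pv]] := pivot_exists s' m.
by exists E1, E2; split=> //; apply: pivot_touches1 s' pv.
Qed.

End Split.

(** * Colourings of a cycle *)

(* [k] and [n - k] differ by [1] or [2]. *)
Definition near (n k : nat) : bool :=
  [|| k.*2.+1 == n, k.*2 == n.+1, k.*2.+2 == n | k.*2 == n.+2].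

Lemma chain (P : nat -> bool) lo hi :
  (forall i, lo <= i < hi -> P i -> P i.+1) -> (forall i, lo <= i < hi -> P i.+1 -> P i) ->
  forall i j, lo <= i <= hi -> lo <= j <= hi -> P i -> P j.
Proof.
move=> up dn i j /andP[li ih] /andP[lj jh] Pi.
have down d : lo + d <= hi -> P (lo + d) -> P lo.
  elim: d => [|d IH] h; first by rewrite addn0.
  rewrite addnS => /dn h'; apply: IH; first by lia.
  by apply: h'; lia.
have {}up d : lo + d <= hi -> P lo -> P (lo + d).
  elim: d => [|d IH] h Pl; first by rewrite addn0.
  rewrite addnS; apply: up; first by lia.
  by apply: IH => //; lia.
rewrite -(subnKC lj); apply: up; first by rewrite subnKC.
by apply: (down (i - lo)); rewrite subnKC.
Qed.

Section Propagation.
Variables (n : nat) (P : nat -> bool).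
Hypothesis n_gt2 : 2 < n.
Hypothesis per : forall i, P (i + n) = P i.
Hypothesis prop : forall i k, 0 < k < n -> near n k -> ~~ (n %| i + k) -> P i -> P (i + k).

Lemma per_mod i : P (i %% n) = P i.
Proof.
rewrite {2}(divn_eq i n) addnC; elim: (i %/ n) => [|q IH]; first by rewrite addn0.
by rewrite mulSn addnCA addnC per.
Qed.

Lemma prop_to i k j : 0 < k < n -> near n k -> 0 < j < n -> (i + k = j \/ i + k = j + n) ->
  P i -> P j.
Proof.
move=> hk nk /andP[j0 jn] E Pi.
have nd : ~~ (n %| i + k).
  by case: E => ->; rewrite ?dvdn_addl ?dvdnn // gtnNdvd.
have := prop hk nk nd Pi; case: E => -> //; by rewrite per.
Qed.

Lemma prop_two i k j s : 0 < k < n -> near n k -> 0 < j < n -> 0 < s < n ->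
  (i + k = j \/ i + k = j + n) -> (j + k = s \/ j + k = s + n) -> P i -> P s.
Proof. by move=> hk nk hj hs E1 E2 /(prop_to hk nk hj E1)/(prop_to hk nk hs E2). Qed.

(** Both [m] and [m.+1] are near, and two shifts by [m.+1] amount to a shift by 1 modulo [n]. Only
    the step from [m] to [m.+1] would pass through position 0, which may be uncoloured; hence two
    intervals, joined by single shifts between 1 and [m.+1]. *)
Lemma all_odd m i j : n = m.*2.+1 -> P i -> 0 < j < n -> P j.
Proof.
move=> En Pi jn.
have n1 : near n m by rewrite /near; lia.
have n2 : near n m.+1 by rewrite /near; lia.
have [i1 [i1n {}Pi]] : exists i1, 0 < i1 < n /\ P i1.
  have [i0|i0] := posnP (i %% n).
    exists m; split; first by lia.
    by apply: (@prop_to (i %% n) m) => //; rewrite ?per_mod ?i0 //; lia.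
  by exists (i %% n); rewrite per_mod i0 ltn_mod; split=> //; lia.
have step u : 0 < u -> u.+1 < n -> u != m -> (P u -> P u.+1) /\ (P u.+1 -> P u).
  move=> u0 un um; split.
    have [h|h] := ltnP u m.
      apply: (@prop_two u m.+1 (u + m.+1)) => //; lia.
    apply: (@prop_two u m.+1 (u - m)) => //; lia.
  have [h|h] := ltnP u m.
    apply: (@prop_two u.+1 m (u.+1 + m)) => //; lia.
  apply: (@prop_two u.+1 m (u - m)) => //; lia.
have lowc := @chain P 1 m _ _; have higc := @chain P m.+1 m.*2 _ _.
have low u v : 1 <= u <= m -> 1 <= v <= m -> P u -> P v.
  apply: lowc => w h; have [] := step w => //; lia.
have hig u v : m.+1 <= u <= m.*2 -> m.+1 <= v <= m.*2 -> P u -> P v.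
  apply: higc => w h; have [] := step w => //; lia.
have P1 : P 1.
  have [h|h] := leqP i1 m; first by apply: low Pi; lia.
  have /(hig _ m.+1) : m.+1 <= i1 <= m.*2 by lia.
  move=> /(_ _ Pi) h2; apply: (@prop_to m.+1 m.+1 1) (h2 _) => //; lia.
have [h|h] := leqP j m; first by apply: low P1; lia.
have P2 : P m.+1 by apply: (@prop_to 1 m m.+1) P1 => //; lia.
by apply: hig P2; lia.
Qed.

Lemma near_even m : n = m.*2 -> [/\ near n m.-1, near n m.+1, 0 < m.-1 < n & 0 < m.+1 < n].
Proof. by move=> En; split; rewrite /near; lia. Qed.

(** Two shifts by [m.+1] amount to a shift by 2 modulo [n]. The excluded [i] is the one whose
    intermediate position is 0. *)
Lemma two_steps m i : n = m.*2 -> 0 < i -> i.+2 < n -> i + m.+1 != n ->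
  (P i -> P i.+2) /\ (P i.+2 -> P i).
Proof.
move=> En i0 i2 im; have [n1 n2 k1 k2] := near_even En; split.
  have [h|h] := ltnP (i + m.+1) n.
    by apply: (@prop_two i m.+1 (i + m.+1)) => //; lia.
  by apply: (@prop_two i m.+1 (i + m.+1 - n)) => //; lia.
have [h|h] := ltnP (i.+2 + m.-1) n.
  by apply: (@prop_two i.+2 m.-1 (i.+2 + m.-1)) => //; lia.
by apply: (@prop_two i.+2 m.-1 (i.+2 + m.-1 - n)) => //; lia.
Qed.

(** The near distances [h.*2.-1] and [h.*2.+1] are odd, so they change parity. The blocked double
    step splits the odd positions into two intervals, and links to the even positions, whose chain
    is whole, join everything. *)
Lemma all_mod4 h i j : n = h.*2.*2 -> P i -> 0 < j < n -> P j.
Proof.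
move=> En Pi jn; have En' : n = (h.*2).*2 by [].
have [n1 n2 k1 k2] := near_even En'.
have st := two_steps En'.
have lowodd := @chain (fun t => P t.*2.+1) 0 h.-1.
have {}lowodd : forall u v, 0 <= u <= h.-1 -> 0 <= v <= h.-1 -> P u.*2.+1 -> P v.*2.+1.
  apply: lowodd => t ht; have [||| ] := st t.*2.+1; rewrite ?doubleS //; lia.
have higodd : forall u v, h <= u <= h.*2.-1 -> h <= v <= h.*2.-1 -> P u.*2.+1 -> P v.*2.+1.
  apply: (@chain (fun t => P t.*2.+1)) => t ht; have [||| ] := st t.*2.+1; rewrite ?doubleS //; lia.
have evens : forall u v, 1 <= u <= h.*2.-1 -> 1 <= v <= h.*2.-1 -> P u.*2 -> P v.*2.
  apply: (@chain (fun t => P t.*2)) => t ht; have [||| ] := st t.*2; rewrite ?doubleS //; lia.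
have link1 : P 2 -> P h.*2.+1 by apply: (@prop_to 2 h.*2.-1) => //; lia.
have link1' : P h.*2.+1 -> P 2 by apply: (@prop_to h.*2.+1 h.*2.+1) => //; lia.
have link2 : P h.*2 -> P 1 by apply: (@prop_to h.*2 h.*2.+1) => //; lia.
have link2' : P 1 -> P h.*2 by apply: (@prop_to 1 h.*2.-1) => //; lia.
have P2 : P 2.
  have nz : forall u, 0 < u < n -> P u -> P 2.
    move=> u un Pu; have [[t Et]|[t Et]] : (exists t, u = t.*2) \/ (exists t, u = t.*2.+1).
      by have [ou|eu] := boolP (odd u); [right|left]; exists u./2; lia.
      by apply: (evens t 1); rewrite -?Et //; lia.
    have [th|th] := ltnP t h.
      by apply: (evens h 1); try lia; apply/link2'/(lowodd t 0); rewrite -?Et //; lia.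
    by apply/link1'/(higodd t h); rewrite -?Et //; lia.
  have [i0|i0] := posnP (i %% n).
    apply: (nz h.*2.-1); first lia.
    by apply: (@prop_to (i %% n) h.*2.-1) => //; rewrite ?per_mod ?i0 //; lia.
  by apply: (nz (i %% n)); rewrite ?per_mod // i0 ltn_mod; lia.
have [[t Et]|[t Et]] : (exists t, j = t.*2) \/ (exists t, j = t.*2.+1).
  by have [ou|eu] := boolP (odd j); [right|left]; exists j./2; lia.
  by rewrite Et; apply: (evens 1 t) P2; lia.
have [th|th] := ltnP t h.
  rewrite Et; apply: (lowodd 0 t); try lia.
  by apply/link2/(evens 1 h) => //; lia.
by rewrite Et; apply: (higodd h t); [lia|lia|exact: link1].
Qed.

(** Now the near distances [h.*2] and [h.*2.+2] are even and preserve parity. No double step between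
    odd positions passes through 0. *)
Lemma odd_class h i j : n = h.*2.+1.*2 -> P i -> odd i -> odd j -> P j.
Proof.
move=> En Pi oi oj; have En' : n = (h.*2.+1).*2 by [].
have odds : forall u v, 0 <= u <= h.*2 -> 0 <= v <= h.*2 -> P u.*2.+1 -> P v.*2.+1.
  apply: (@chain (fun t => P t.*2.+1)) => t ht;
    have [||| ] := two_steps En' (i := t.*2.+1); rewrite ?doubleS //; lia.
rewrite -per_mod in Pi; rewrite -per_mod.
have mi : i %% n < n by rewrite ltn_mod; lia.
have mj : j %% n < n by rewrite ltn_mod; lia.
have no : odd n = false by rewrite En odd_double.
rewrite -(odd_mod i no) in oi; rewrite -(odd_mod j no) in oj.
have Ei : i %% n = (i %% n)./2.*2.+1 by rewrite -{1}(odd_double_half (i %% n)) oi.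
have Ej : j %% n = (j %% n)./2.*2.+1 by rewrite -{1}(odd_double_half (j %% n)) oj.
rewrite Ej; rewrite Ei in Pi; apply: odds Pi; lia.
Qed.

(** Among the even positions the step from [h.*2] to [h.*2.+2] would pass through 0; the links
    between 2 and [h.+1.*2] go around it. *)
Lemma even_class h i j : n = h.*2.+1.*2 -> P i -> ~~ odd i -> ~~ odd j -> ~~ (n %| j) -> P j.
Proof.
move=> En Pi oi oj nj; have En' : n = (h.*2.+1).*2 by [].
have [n1 n2 k1 k2] := near_even En'.
have st := two_steps En'.
have low : forall u v, 1 <= u <= h -> 1 <= v <= h -> P u.*2 -> P v.*2.
  apply: (@chain (fun t => P t.*2)) => t ht; have [||| ] := st t.*2; rewrite ?doubleS //; lia.
have hig : forall u v, h.+1 <= u <= h.*2 -> h.+1 <= v <= h.*2 -> P u.*2 -> P v.*2.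
  apply: (@chain (fun t => P t.*2)) => t ht; have [||| ] := st t.*2; rewrite ?doubleS //; lia.
have link : P 2 -> P h.+1.*2 by apply: (@prop_to 2 h.*2) => //; lia.
have link' : P h.+1.*2 -> P 2 by apply: (@prop_to h.+1.*2 h.*2.+2) => //; lia.
have no : odd n = false by rewrite En odd_double.
rewrite -(odd_mod i no) in oi; rewrite -(odd_mod j no) in oj.
have mi : i %% n < n by rewrite ltn_mod; lia.
have mj : j %% n < n by rewrite ltn_mod; lia.
have Ei : i %% n = (i %% n)./2.*2 by rewrite -{1}(odd_double_half (i %% n)) (negPf oi).
have Ej : j %% n = (j %% n)./2.*2 by rewrite -{1}(odd_double_half (j %% n)) (negPf oj).
rewrite -per_mod in Pi; rewrite -per_mod.
have j0 : 0 < j %% n by rewrite lt0n.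
have P2 : P 2.
  have nz t : 0 < t.*2 < n -> P t.*2 -> P 2.
    move=> tn Pt; have [th|th] := leqP t h; first by apply: (low t 1) Pt; lia.
    by apply/link'/(hig t h.+1) => //; lia.
  have [i0|i0] := posnP (i %% n).
    apply: (nz h); first by lia.
    by apply: (@prop_to (i %% n) h.*2) => //; rewrite ?i0 //; lia.
  by apply: (nz (i %% n)./2); rewrite -Ei // i0.
rewrite Ej; have [th|th] := leqP (j %% n)./2 h; first by apply: (low 1) P2; lia.
by apply: (hig h.+1); [lia|lia|exact: link].
Qed.

End Propagation.

(* [a] and [b] are the two colours of the positions of a cycle of length [n];
   position [0] may be uncoloured. *)
Lemma alternating n (a b : nat -> bool) : 2 < n ->
  (forall i, a (i + n) = a i) -> (forall i, b (i + n) = b i) ->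
  (forall i, ~~ (n %| i) -> a i || b i) ->
  (forall i k, 0 < k < n -> near n k -> ~~ (a i && b (i + k))) ->
  (exists i, a i) -> (exists i, b i) ->
  exists2 h, n = h.*2.+1.*2 &
    ((forall i, odd i -> a i) /\ (forall i, ~~ odd i -> ~~ (n %| i) -> b i)) \/
    ((forall i, odd i -> b i) /\ (forall i, ~~ odd i -> ~~ (n %| i) -> a i)).
Proof.
move=> n2 pa pb col conf [i ai] [j bj].
have conf' i' k : 0 < k < n -> near n k -> ~~ (b i' && a (i' + k)).
  move=> kn nk; have /(conf (i' + k)) : 0 < n - k < n by lia.
  by rewrite -addnA subnKC ?pb 1?andbC; [apply; move: nk; rewrite /near; lia | lia].
have propa i' k : 0 < k < n -> near n k -> ~~ (n %| i' + k) -> a i' -> a (i' + k).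
  move=> kn nk nd ai'; have := conf i' k kn nk; rewrite ai' /= => nb.
  by have := col _ nd; rewrite (negPf nb) orbF.
have propb i' k : 0 < k < n -> near n k -> ~~ (n %| i' + k) -> b i' -> b (i' + k).
  move=> kn nk nd bi'; have := conf' i' k kn nk; rewrite bi' /= => na.
  by have := col _ nd; rewrite (negPf na).
(* Unless [n] is 2 modulo 4, each colour fills all nonzero positions, and a conflicting pair appears
   at distance [n./2] or [n./2.-1]. *)
have [on|en] := boolP (odd n).
  have En : n = n./2.*2.+1 by rewrite -{1}(odd_double_half n) on.
  have := conf 1 n./2; rewrite (all_odd n2 pa propa En ai) ?(all_odd n2 pb propb En bj) //; try lia.
  by move=> H; have : false; [apply: H => //; rewrite /near; lia|].
have En : n = n./2.*2 by rewrite -{1}(odd_double_half n) (negPf en).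
have [om|em] := boolP (odd n./2); last first.
  have Em : n = n./2./2.*2.*2.
    by rewrite {1}En; congr _.*2; rewrite -{1}(odd_double_half n./2) (negPf em).
  have := conf 1 n./2.-1.
  rewrite (all_mod4 n2 pa propa Em ai) ?(all_mod4 n2 pb propb Em bj) //; try lia.
  by move=> H; have : false; [apply: H => //; rewrite /near; lia|].
have Em : n = n./2./2.*2.+1.*2.
  by rewrite {1}En; congr _.*2; rewrite -{1}(odd_double_half n./2) om.
exists n./2./2 => //; set h := n./2./2 in Em.
have no t : ~~ odd t -> odd (t + 1) by lia.
have nd t : 0 < t < n -> ~~ (n %| t) by move=> tn; rewrite gtnNdvd //; lia.
(* Occurrences of both colours in the same parity class would each fill that class, which contains
   two nonzero positions at the near distance [h.*2]. *)
have [oi|ei] := boolP (odd i); have [oj|ej] := boolP (odd j).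
- have := conf 1 h.*2.
  rewrite (odd_class n2 pa propa Em ai oi) // (odd_class n2 pb propb Em bj oj); last by lia.
  by move=> H; have : false; [apply: H => //; rewrite /near; lia|].
- left; split=> t ht; first exact: (odd_class n2 pa propa Em ai oi).
  exact: (even_class n2 pb propb Em bj ej).
- right; split=> t ht; first exact: (odd_class n2 pb propb Em bj oj).
  exact: (even_class n2 pa propa Em ai ei).
- have := conf 2 h.*2.
  rewrite (even_class n2 pa propa Em ai ei) //; last by apply: nd; lia.
  rewrite (even_class n2 pb propb Em bj ej) //; try lia; last by apply: nd; lia.
  by move=> H; have : false; [apply: H => //; rewrite /near; lia|].
Qed.

(** * Paths through a cycle *)

Section Joining.
Variables (V : finType) (e : rel V).
Hypothesis e_sym : symmetric e.
Implicit Types (D S U : {set V}) (x y v w : V) (p c r : seq V).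

(** A parametrization of the cycle by all natural numbers with period [n], so that an arc is a start
    and a length even if it wraps around. *)
Record winding (c : seq V) (n : nat) (f : nat -> V) : Prop := Winding {
  wind_gt2 : 2 < n;
  wind_mem : forall i, f i \in c;
  wind_onto : forall v, v \in c -> exists i, f i = v;
  wind_per : forall i, f (i + n) = f i;
  wind_inj : forall i k, k < n -> f i = f (i + k) -> k = 0;
  wind_edge : forall i, e (f i) (f i.+1) }.

Lemma winding_exists c v : iscyc e c -> v \in c ->
  exists f, winding c (size c) f /\ f 0 = v.
Proof.
move=> cc vc; have [i s E] := rot_to vc.
have := cc; rewrite -(iscyc_rot e i) E => /and3P[sz cyc un].
have Es : size c = size (v :: s) by rewrite -E size_rot.
pose n := size (v :: s); have n0 : 0 < n by [].
exists (fun j => nth v (v :: s) (j %% n)); split; last by rewrite mod0n.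
have mem u : (u \in c) = (u \in v :: s) by rewrite -E mem_rot.
rewrite Es -/n; split=> //.
- by move=> j; rewrite mem mem_nth // ltn_mod.
- move=> u; rewrite mem => uc; exists (index u (v :: s)).
  by rewrite modn_small ?nth_index // index_mem.
- by move=> j; rewrite modnDr.
- move=> j k kn /eqP; rewrite nth_uniq ?ltn_mod // -{1}(addn0 j) eqn_modDl mod0n modn_small //.
  by move=> /eqP.
- move=> j; have jn : j %% n < n by rewrite ltn_mod.
  have := cyc; rewrite -[cycle e _]/(path e v (rcons s v)) => /(pathP v) /(_ (j %% n)).
  rewrite size_rcons => /(_ jn).
  have -> : nth v (v :: rcons s v) (j %% n) = nth v (v :: s) (j %% n).
    by rewrite -rcons_cons nth_rcons jn.
  have -> : nth v (rcons s v) (j %% n) = nth v (v :: s) (j.+1 %% n); last by [].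
  have [h|h] := ltnP (j %% n) (size s).
    have -> : j.+1 %% n = (j %% n).+1 by rewrite -addn1 -modnDml addn1 modn_small.
    by rewrite nth_rcons h.
  have Ej : j %% n = size s by apply/eqP; rewrite eqn_leq h andbT -ltnS.
  have -> : j.+1 %% n = 0 by rewrite -addn1 -modnDml Ej addn1 modnn.
  by rewrite Ej nth_rcons ltnn eqxx.
Qed.

(** The final edge into [v] counts towards [l], although [v] need not lie in [D]; it is meant to lie
    on the cycle. *)
Definition leg D x v l := exists p, [/\ path e x p, uniq (x :: p), {subset x :: p <= D},
  e (last x p) v & l = (size p).+1].

Variables (c : seq V) (n : nat) (f : nat -> V).
Hypothesis wf : winding c n f.

Definition arc i k := [seq f (i + j.+1) | j <- iota 0 k].

Lemma arcS i k : arc i k.+1 = rcons (arc i k) (f (i + k.+1)).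
Proof. by rewrite /arc -[in iota 0 k.+1]addn1 iotaD map_cat cats1 add0n. Qed.

Lemma arc_last i k : last (f i) (arc i k) = f (i + k).
Proof. by case: k => [|k]; rewrite ?addn0 // arcS last_rcons. Qed.

Lemma arc_path i k : path e (f i) (arc i k).
Proof.
elim: k => // k IH; rewrite arcS rcons_path IH arc_last addnS; exact: (wind_edge wf).
Qed.

Lemma arc_sub i k : {subset f i :: arc i k <= c}.
Proof.
move=> v; rewrite inE => /orP[/eqP->|/mapP[j _ ->]]; exact: (wind_mem wf).
Qed.

Lemma arc_uniq i k : k < n -> uniq (f i :: arc i k).
Proof.
elim: k => // k IH kn; rewrite arcS -rcons_cons rcons_uniq IH 1?ltnW // andbT.
apply/negP; rewrite inE => /orP[/eqP E|/mapP[j]].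
  by have := wind_inj wf kn (esym E).
rewrite mem_iota add0n => jk E.
have := @wind_inj _ _ _ wf (i + j.+1) (k - j); rewrite (_ : i + j.+1 + (k - j) = i + k.+1); last by lia.
by move=> /(_ _ (esym E)); lia.
Qed.

Lemma join D1 D2 x1 x2 i k l1 l2 :
  (forall v, v \in D1 -> v \notin D2) -> (forall v, v \in c -> (v \notin D1) && (v \notin D2)) ->
  k < n -> leg D1 x1 (f i) l1 -> leg D2 x2 (f (i + k)) l2 -> haslen e x1 x2 (l1 + k + l2).
Proof.
move=> dis dc kn [p [pp up sp ep ->]] [q [pq uq sq eq ->]].
exists (p ++ (f i :: arc i k) ++ rev (x2 :: q)); last first.
  by rewrite !size_cat /= size_rev size_map size_iota /=; lia.
split.
- rewrite cat_path pp /= ep cat_path arc_path arc_last.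
  have := rev_path_sym e_sym x2 (rcons q (f (i + k))).
  by rewrite last_rcons belast_rcons rcons_path pq eq.
- by rewrite !last_cat rev_cons last_rcons.
- have U2 : uniq ((f i :: arc i k) ++ rev (x2 :: q)).
    rewrite cat_uniq arc_uniq // rev_uniq uq andbT; apply/hasPn=> v.
    rewrite mem_rev => /sq vD; apply/negP=> /arc_sub /dc; by rewrite vD andbF.
  rewrite -[x1 :: _]/((x1 :: p) ++ ((f i :: arc i k) ++ rev (x2 :: q))).
  rewrite cat_uniq up U2 andbT; apply/hasPn=> v.
  rewrite mem_cat mem_rev => /orP[vc|/sq vD].
    have /andP[h _] := dc v (arc_sub vc); exact: contra (@sp v) h.
  by apply/negP=> /sp /dis; rewrite vD.
Qed.

Definition attached D v := [exists u in D, e u v].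

Lemma attached_leg D x v : rooted e D x -> attached D v -> exists l, leg D x v l.
Proof.
move=> rD /exists_inP[u uD uv]; have [p [pp lp up sp]] := rooted_path e_sym rD uD.
by exists (size p).+1, p; split=> //; rewrite lp.
Qed.

Section TwoSides.
Variables (D1 D2 : {set V}) (x1 x2 : V).
Hypotheses (r1 : rooted e D1 x1) (r2 : rooted e D2 x2).
Hypothesis dis : forall v, v \in D1 -> v \notin D2.
Hypothesis dc : forall v, v \in c -> (v \notin D1) && (v \notin D2).
Hypothesis ngood : ~ good e x1 x2.

Let dis' v : v \in D2 -> v \notin D1.
Proof. by move=> h; apply/negP=> /dis; rewrite h. Qed.
Let dc' v : v \in c -> (v \notin D2) && (v \notin D1).
Proof. by rewrite andbC; apply: dc. Qed.

Lemma join12 i k l1 l2 : k < n -> leg D1 x1 (f i) l1 -> leg D2 x2 (f (i + k)) l2 ->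
  haslen e x1 x2 (l1 + k + l2).
Proof. exact: join. Qed.

Lemma join21 i k l1 l2 : k < n -> leg D2 x2 (f i) l2 -> leg D1 x1 (f (i + k)) l1 ->
  haslen e x1 x2 (l1 + k + l2).
Proof.
move=> kn h2 h1; apply: haslen_sym => //.
rewrite (_ : l1 + k + l2 = l2 + k + l1); last by lia.
exact: (join dis' dc' kn h2 h1).
Qed.

Lemma no_near i k : 0 < k < n -> near n k ->
  ~~ (attached D1 (f i) && attached D2 (f (i + k))).
Proof.
move=> kn nk; apply/negP=> /andP[/(attached_leg r1)[l1 h1] /(attached_leg r2)[l2 h2]].
have kn' : k < n by case/andP: kn.
have kn2 : n - k < n by lia.
have h3 := join12 kn' h1 h2.
have h4 : haslen e x1 x2 (l1 + (n - k) + l2).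
  apply: (join21 kn2 h2); rewrite -addnA subnKC ?(wind_per wf) //; exact: ltnW.
case: ngood; move: nk; rewrite /near => nk.
have [h|h] := ltnP k (n - k).
  by apply: (good_near h3 h4); lia.
by apply: (good_near h4 h3); lia.
Qed.

Lemma sides_alternate :
  (exists i, attached D1 (f i)) -> (exists i, attached D2 (f i)) ->
  (forall i, ~~ (n %| i) -> attached D1 (f i) || attached D2 (f i)) ->
  exists2 h, n = h.*2.+1.*2 &
    ((forall i, odd i -> attached D1 (f i)) /\
     (forall i, ~~ odd i -> ~~ (n %| i) -> attached D2 (f i))) \/
    ((forall i, odd i -> attached D2 (f i)) /\
     (forall i, ~~ odd i -> ~~ (n %| i) -> attached D1 (f i))).
Proof.
move=> e1 e2 col.
apply: (alternating (a := fun i => attached D1 (f i)) (b := fun i => attached D2 (f i))) => //.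
- exact: (wind_gt2 wf).
- by move=> i; rewrite (wind_per wf).
- by move=> i; rewrite (wind_per wf).
- exact: no_near.
Qed.

(* The third position used is the midpoint of one of the two arcs from [i] to
   [i + d.*2] or, if [l = l'], a neighbour of it. *)
Lemma even_legs h i d l l' : n = h.*2.+1.*2 ->
  (forall i, odd i -> attached D1 (f i)) ->
  ~~ odd i -> 0 < d <= h.*2 ->
  leg D2 x2 (f i) l -> leg D2 x2 (f (i + d.*2)) l' -> l <= l'.+2 -> l' <= l.+2 -> False.
Proof.
move=> En odds ei dh hl hl' ll' l'l.
(* The half-lengths [d] and [h.*2.+1 - d] of the two arcs have opposite parities, so exactly one
   midpoint is odd. For [l != l'] that midpoint serves. For equal lengths a neighbour of the even
   midpoint is used, whose distances to the two ends differ by 2. *)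
have [E|ne] := eqVneq l l'.
  subst l'; have [od|ed] := boolP (odd d).
    have [|g hg] := attached_leg r1 (odds (i + d.*2 + (h.*2.+2 - d)) _); first by lia.
    have b1 := @join21 (i + d.*2) (h.*2.+2 - d) g l; have b2 := @join12 (i + d.*2 + (h.*2.+2 - d)) (h.*2 - d) g l.
    case: ngood; apply: (@good_near _ _ _ _ (g + (h.*2 - d) + l) (g + (h.*2.+2 - d) + l)); try lia.
      apply: b2 => //; try lia; rewrite (_ : _ + _ = i + n); last by lia.
      by rewrite (wind_per wf).
    by apply: b1 => //; lia.
  have [|g hg] := attached_leg r1 (odds (i + d.+1) _); first by lia.
  have b1 := @join21 i d.+1 g l; have b2 := @join12 (i + d.+1) d.-1 g l.
  case: ngood; apply: (@good_near _ _ _ _ (g + d.-1 + l) (g + d.+1 + l)); try lia.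
    by apply: b2 => //; try lia; rewrite (_ : _ + _ = i + d.*2) //; lia.
  by apply: b1 => //; lia.
have [g [k [h1 h2]]] : exists g k, haslen e x1 x2 (g + k + l) /\ haslen e x1 x2 (g + k + l').
  have [od|ed] := boolP (odd d).
    have [|g hg] := attached_leg r1 (odds (i + d) _); first by lia.
    exists g, d; split; first by apply: (join21 _ hl) => //; lia.
    by apply: (join12 _ hg); [lia | rewrite -addnA addnn].
  have [|g hg] := attached_leg r1 (odds (i + d.*2 + (h.*2.+1 - d)) _); first by lia.
  exists g, (h.*2.+1 - d); split; last by apply: (join21 _ hl') => //; lia.
  apply: (join12 _ hg); first by lia.
  by rewrite (_ : _ + _ = i + n) ?(wind_per wf) //; lia.
case: ngood; have [lt|ge] := ltnP l l'; first by apply: (good_near h1 h2); lia.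
by apply: (good_near h2 h1); lia.
Qed.

End TwoSides.
End Joining.

(** * Contracting the cycle *)

Section Contraction.
Variables (V : finType) (e : rel V).
Hypothesis e_sym : symmetric e.
Hypothesis e_irr : irreflexive e.
Implicit Types (D S U : {set V}) (x y v w : V) (p r : seq V).
Variables (x1 x2 : V) (W : {set V}).
Hypothesis supp : forall u v, e u v -> u \in W.
Hypothesis lnk : linked e x1 x2 W.
Hypotheses (x1W : x1 \in W) (x2W : x2 \in W).
Variable c : seq V.
Hypotheses (ac : avoids x1 x2 c) (cc : iscyc e c).
Variables (D1 D2 P : {set V}) (a t : V).
Hypothesis sp : halves e x1 x2 c D1 D2.
Hypothesis pv : pivot e x2 c D1 D2 a P.
Hypothesis tc : t \in c.

Let R := D2 :\: P.

(* Contracts [c] to its vertex [t] and deletes everything but [R]. *)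
Definition contract : rel V := [rel u v |
  [|| [&& u \in R, v \in R & e u v], [&& u \in R, v == t & has (e u) c]
    | [&& v \in R, u == t & has (e v) c]]].

Lemma cyc_notin_split v : v \in c -> (v \notin D1) && (v \notin D2).
Proof.
move=> vc; rewrite -negb_or -in_setU (splitU sp); apply: contraL vc; exact: reach_notin.
Qed.

Lemma t_notin_R : t \notin R.
Proof. by rewrite in_setD negb_and; have /andP[_ ->] := cyc_notin_split tc; rewrite orbT. Qed.

Lemma contract_sym : symmetric contract.
Proof.
move=> u v; rewrite /contract /= e_sym.
by case: (u \in R); case: (v \in R); case: (u == t); case: (v == t);
  case: (has (e u) c); case: (has (e v) c); case: (e v u).
Qed.

Lemma contract_irr : irreflexive contract.
Proof.
move=> u; rewrite /contract /= e_irr !andbF /=.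
have [E|] := eqVneq u t; last by rewrite !andbF.
by rewrite E (negPf t_notin_R).
Qed.

Lemma contract_supp u v : contract u v -> u \in t |: R.
Proof.
rewrite in_setU1 /contract /= => /or3P[/and3P[->]|/and3P[->]|/and3P[_ ->]] //; by rewrite ?orbT.
Qed.

Lemma contract_R u v : u \in R -> v \in R -> contract u v = e u v.
Proof.
move=> uR vR; rewrite /contract /= uR vR /=.
have ut : (u == t) = false by apply: contraTF uR => /eqP ->; apply: t_notin_R.
have vt : (v == t) = false by apply: contraTF vR => /eqP ->; apply: t_notin_R.
by rewrite ut vt !orbF.
Qed.

Lemma contract_t u : u \in R -> contract u t = has (e u) c.
Proof. by move=> uR; rewrite /contract /= uR (negPf t_notin_R) eqxx /= orbF. Qed.

Lemma R_sub : R \subset D2. Proof. exact: subsetDl. Qed.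

Lemma a_in_R : a \in R.
Proof.
rewrite in_setD (pivot_in pv) andbT; apply/negP=> /(subsetP (pivot_sub pv)).
by rewrite in_setD1 eqxx.
Qed.

Lemma x2_R : x2 \in R -> x2 = a.
Proof. by case: (pivot_root pv) => [//|h]; rewrite in_setD h. Qed.

(** This is what the pivot is for: away from [a], every edge at a vertex of [R] survives the
    contraction. *)
Lemma R_neighbour u v : u \in R -> u != a -> e u v -> (v \in R) || (v \in c).
Proof.
move=> uR ua uv; have uD2 := subsetP R_sub _ uR.
have uX : u \in reach e c x1 x2 by rewrite -(splitU sp) in_setU uD2 orbT.
have [vX|vX] := boolP (v \in reach e c x1 x2); last first.
  by rewrite (exit_reach (x1 := x1) (x2 := x2) (e := e) e_sym ac uX vX) ?orbT // e_sym.
have vP : v \notin P by apply: contraL uv; apply: (pivot_closed pv uR ua).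
have vD1 : v \notin D1 by apply: contraL uv; apply: (pivot_contact pv uR ua).
by move: vX; rewrite -(splitU sp) in_setU (negPf vD1) in_setD vP /= => ->.
Qed.

(** If [w] is [t], connectedness of [R] gives the edge. Otherwise [linked] for [e] does: its edge
    leaves [S] towards [R] or towards [c], and in the second case becomes an edge to [t]. *)
Lemma contract_linked : linked contract a t (t |: R).
Proof.
move=> S w sS S0 aS tS wS.
have SR : S \subset R.
  apply/subsetP=> v vS; have := subsetP sS _ vS; rewrite in_setU1 => /orP[/eqP E|//].
  by rewrite -E vS in tS.
have [Ew|wt] := eqVneq w t.
  have [//|u [v [uS vR vS uv]]] := (pivot_rooted sp pv).2 S SR S0.
  exists u, v; split=> //; first by rewrite Ew; apply: contraTneq vR => ->; apply: t_notin_R.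
  by rewrite contract_R // (subsetP SR).
have RW : R \subset W.
  apply: subset_trans R_sub (subset_trans (subsetUr D1 _) _); rewrite (splitU sp).
  by rewrite subUset !component_supp.
have [||||u [v [uS vS vw uv]]] := lnk (S := S) (w := w) _ S0.
- exact: subset_trans RW.
- apply/negP=> /(subsetP SR)/(subsetP R_sub) h; have := splitI sp (split1 sp).1.
  by rewrite h.
- by apply/negP=> h; have := x2_R (subsetP SR _ h) => E; rewrite -E h in aS.
- exact: wS.
have uR := subsetP SR _ uS.
have ua : u != a by apply: contraNneq aS => <-.
case/orP: (R_neighbour uR ua uv) => [vR|vc].
  by exists u, v; split=> //; rewrite contract_R.
exists u, t; split=> //; first by rewrite eq_sym.
by rewrite contract_t //; apply/hasP; exists v.
Qed.

(** With a single neighbour on [c], no parallel edges are merged. *)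
Lemma contract_degree v : v \in R -> v != a ->
  (forall w w', w \in c -> w' \in c -> e v w -> e v w' -> w = w') ->
  degree contract v = degree e v.
Proof.
move=> vR va one; rewrite /degree.
rewrite -(cardsID R [set w | contract v w]) -(cardsID R [set w | e v w]); congr (_ + _).
  apply: eq_card => w; rewrite !in_setI; case: (boolP (w \in R)) => wR; last by rewrite !andbF.
  by rewrite !andbT !in_set contract_R.
have [/hasP[w wc vw]|nh] := boolP (has (e v) c).
  rewrite (_ : _ :\: _ = [set t]) ?cards1; last first.
    apply/setP=> u; rewrite in_setD in_set in_set1; have [uR|uR] /= := boolP (u \in R).
      by apply/esym; apply: contraTF uR => /eqP->; apply: t_notin_R.
    rewrite /contract /= vR (negPf uR) /=.
    have -> : has (e v) c by apply/hasP; exists w.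
    by rewrite orbF andbT.
  rewrite (_ : _ :\: _ = [set w]) ?cards1 //.
  apply/setP=> u; rewrite in_setD in_set in_set1; have [uR|uR] /= := boolP (u \in R).
    apply/esym; apply: contraTF uR => /eqP->.
    by rewrite in_setD negb_and; have /andP[_ ->] := cyc_notin_split wc; rewrite orbT.
  apply/idP/eqP => [vu|->//]; have := R_neighbour vR va vu; rewrite (negPf uR) /= => uc.
  exact: one.
rewrite (_ : _ :\: _ = set0) ?cards0; last first.
  apply/setP=> u; rewrite in_setD in_set in_set0; have [uR|uR] //= := boolP (u \in R).
  rewrite /contract /= vR (negPf uR) (negPf nh) /= andbF.
  by [].
rewrite (_ : _ :\: _ = set0) ?cards0 //.
apply/setP=> u; rewrite in_setD in_set in_set0; have [uR|uR] //= := boolP (u \in R).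
apply: contraNF nh => vu; have := R_neighbour vR va vu; rewrite (negPf uR) /= => uc.
by apply/hasP; exists u.
Qed.

(** [s] is the length of a fixed path from [x2] to [a] through [P]. Since [P] is disjoint from [R],
    that path can precede every path of the contracted graph, and differences of lengths are
    kept. *)
Lemma contract_leg : exists s, forall l, haslen contract a t l ->
  exists2 w, w \in c & leg e D2 x2 w (s + l).
Proof.
have [q [pq lq uq sq]] := pivot_path pv.
exists (size q) => l [p [pp lp up] <-].
case/lastP: p pp lp up => [_ /= E _|p t'].
  by have := a_in_R; rewrite E (negPf t_notin_R).
rewrite rcons_path last_rcons => /andP[pp lt] E; rewrite E in lt *.
rewrite -rcons_cons rcons_uniq => /andP[tp up].
have pR : {subset a :: p <= R}.
  move=> v; rewrite inE => /orP[/eqP->|vp]; first exact: a_in_R.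
  have vt : v != t by apply: contraNneq tp => <-; rewrite inE vp orbT.
  suff : v \in t |: R by rewrite in_setU1 (negPf vt).
  elim: p {lt tp up} a pp vp => //= b p IH a' /andP[ab pp]; rewrite inE => /orP[/eqP->|].
    by apply: contract_supp; rewrite contract_sym; apply: ab.
  exact: IH pp.
have pe : path e a p.
  have aR := pR _ (mem_head _ _).
  have {}pR : {subset p <= R} by move=> v vp; apply: pR; rewrite inE vp orbT.
  elim: p {lt tp up} a aR pR pp => //= b p IH a' aR pR /andP[ab pp].
  have bR := pR _ (mem_head _ _).
  rewrite -contract_R // ab IH // => v vp; apply: pR; by rewrite inE vp orbT.
have lR := pR _ (mem_last _ _).
move: lt; rewrite contract_t // => /hasP[w wc lw]; exists w => //.
exists (q ++ p); split.
- by rewrite cat_path pq lq.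
- rewrite -cat_cons cat_uniq uq; move: up => /= /andP[ap ->]; rewrite andbT /=.
  apply/hasPn=> v vp; apply/negP=> /sq; rewrite in_setU1 => /orP[/eqP E'|vP].
    by rewrite -E' vp in ap.
  have : v \in R by apply: pR; rewrite inE vp orbT.
  by rewrite in_setD vP.
- move=> v; rewrite -cat_cons mem_cat => /orP[/sq|vp].
    rewrite in_setU1 => /orP[/eqP->|/(subsetP (pivot_sub pv))]; first exact: pivot_in pv.
    by rewrite in_setD1 => /andP[].
  by apply: (subsetP R_sub); apply: pR; rewrite inE vp orbT.
- by rewrite last_cat lq.
- by rewrite size_cat size_rcons addnS.
Qed.

End Contraction.

(* [lia] does not terminate in reasonable time on the graph hypotheses. *)
Ltac nat_lia :=
  repeat match goal with
  | H : ?T |- _ =>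
    lazymatch T with
    | nat => fail
    | is_true (leq _ _) => fail
    | is_true (andb (leq _ _) (leq _ _)) => fail
    | is_true (odd _) => fail
    | is_true (negb (odd _)) => fail
    | @eq nat _ _ => fail
    | is_true (negb (@eq_op _ _ _)) => fail
    | _ => clear H
    end
  end; lia.

Section Symmetry.
Variables (V : finType) (e : rel V) (x1 x2 : V).
Implicit Types (W D : {set V}) (c : seq V).

Lemma linked_sym W : linked e x1 x2 W -> linked e x2 x1 W.
Proof. by move=> lnk S w sS S0 h2 h1; apply: lnk. Qed.

Lemma avoids_sym c : avoids x1 x2 c = avoids x2 x1 c.
Proof. by rewrite /avoids andbC. Qed.

Lemma reach_sym c : reach e c x1 x2 = reach e c x2 x1.
Proof. by rewrite /reach setUC. Qed.

Lemma halves_sym c D1 D2 : halves e x1 x2 c D1 D2 -> halves e x2 x1 c D2 D1.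
Proof.
case=> r1 r2 dis U; split=> //.
- by move=> v h; apply/negP=> /dis; rewrite h.
- by rewrite setUC -reach_sym.
Qed.

End Symmetry.

(** Degrees of the roots are left open because a contracted cycle becomes a root. It takes the place
    of [x2], where two neighbours are guaranteed. *)
Definition one_exception_below (V : finType) (k : nat) : Prop :=
  forall (e : rel V) (W : {set V}) (x1 x2 z : V), #|W| < k ->
  symmetric e -> irreflexive e -> (forall u v, e u v -> u \in W) ->
  x1 \in W -> x2 \in W -> x1 != x2 -> linked e x1 x2 W ->
  (forall v, v \in W -> v != x1 -> v != x2 -> degree e v <= 3) ->
  (forall v, v \in W -> v != x1 -> v != x2 -> v != z -> degree e v = 3) ->
  1 < degree e x2 -> good e x1 x2.

Section Finish.
Variables (V : finType) (e : rel V).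
Hypothesis e_sym : symmetric e.
Hypothesis e_irr : irreflexive e.
Implicit Types (D S U : {set V}) (x y v w : V) (p r : seq V).
Variables (x1 x2 : V) (W : {set V}).
Hypothesis supp : forall u v, e u v -> u \in W.
Hypothesis lnk : linked e x1 x2 W.
Hypotheses (x1W : x1 \in W) (x2W : x2 \in W).
Hypothesis IHB : one_exception_below V #|W|.
Hypothesis degW : forall v, v \in W -> v != x1 -> v != x2 -> degree e v <= 3.
Variable c : seq V.
Hypotheses (ac : avoids x1 x2 c) (cc : iscyc e c).

Lemma halves_W D1 D2 v : halves e x1 x2 c D1 D2 -> v \in D1 :|: D2 -> v \in W.
Proof.
by move=> sp; apply: subsetP; rewrite (splitU sp) subUset !(component_supp e_sym supp).
Qed.

(** The odd position [i + h.*2] belongs to [D1], and from there position [i] is reached after the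
    near distance [h.*2.+2]. *)
Lemma odd_not_even D1 D2 h n f i : winding e c n f -> halves e x1 x2 c D1 D2 ->
  ~ good e x1 x2 -> n = h.*2.+1.*2 -> (forall i, odd i -> attached e D1 (f i)) ->
  odd i -> ~~ attached e D2 (f i).
Proof.
move=> wf sp ng En odds oi.
have n2 := wind_gt2 wf.
have := @no_near _ _ e_sym _ _ _ wf D1 D2 x1 x2 (split1 sp) (split2 sp) (splitI sp)
  (cyc_notin_split ac sp) ng (i + h.*2) (h.*2.+2).
rewrite odds /= ?oddD ?odd_double ?addbF // -addnA (_ : h.*2 + h.*2.+2 = n); last by nat_lia.
rewrite (wind_per wf); apply; first by nat_lia.
by rewrite /near; nat_lia.
Qed.

(** Shrinking [D2] only enlarges [D1], so the odd positions keep their colour and the colouring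
    still alternates. All legs of the second side then end at even positions, where [even_legs]
    forbids two legs of close lengths unless they agree in end and length. Hence a vertex of this
    side has at most one neighbour on [c], the contraction preserves degrees, and the two close
    paths provided by induction give a forbidden pair of legs. *)
Lemma finish D1 D2 n f h z : halves e x1 x2 c D1 D2 -> winding e c n f ->
  n = h.*2.+1.*2 -> (forall i, odd i -> attached e D1 (f i)) ->
  (forall i, ~~ odd i -> ~~ (n %| i) -> attached e D2 (f i)) ->
  (forall v, v \in D2 -> v != x2 -> v != z -> degree e v = 3) ->
  good e x1 x2.
Proof.
move=> sp0 wf En odds0 evens0 deg3; apply: NNPP => ng.
have n2 := wind_gt2 wf.
have wc := wind_mem wf.
have nd t : 0 < t < n -> ~~ (n %| t) by move=> tn; rewrite gtnNdvd //; nat_lia.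
have t2 : touches e c D2.
  have /exists_inP[u uD uf] : attached e D2 (f 2) by apply: evens0 => //; apply: nd; nat_lia.
  by apply/touchesP; exists u, (f 2).
have [E1 [E2 [sp t2' sub m2]]] := split_shrink e_sym sp0 t2.
have sub1 : D1 \subset E1.
  apply/subsetP=> v vD; have : v \in E1 :|: E2.
    by rewrite (splitU sp) -(splitU sp0) in_setU vD.
  rewrite in_setU => /orP[//|/(subsetP sub) h2]; have := splitI sp0 vD.
  by rewrite h2.
have odds i : odd i -> attached e E1 (f i).
  by move=> /odds0/exists_inP[u uD uf]; apply/exists_inP; exists u => //; apply: (subsetP sub1).
have noE2 i : odd i -> ~~ attached e E2 (f i) := odd_not_even wf sp ng En odds.
have dcE := cyc_notin_split ac sp.
have evens i : ~~ odd i -> ~~ (n %| i) -> attached e E2 (f i).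
  have [||i' ni'|h' Eh' [[_ e2]|[o2 _]]] :=
      sides_alternate e_sym wf (split1 sp) (split2 sp) (splitI sp) dcE ng.
  - by exists 1; apply: odds.
  - case/touchesP: t2' => u [w [uD win uw]]; have [j Ej] := wind_onto wf win.
    by exists j; rewrite Ej; apply/exists_inP; exists u.
  - have [oi|ei] := boolP (odd i'); first by rewrite odds.
    have /exists_inP[u uD uf] := evens0 i' ei ni'.
    have : u \in E1 :|: E2 by rewrite (splitU sp) -(splitU sp0) in_setU uD orbT.
    rewrite in_setU => /orP[] uE; apply/orP; [left|right]; apply/exists_inP; by exists u.
  - exact: e2.
  - by have := noE2 1 isT; rewrite o2.
have [a [P pv]] := pivot_exists e_sym sp m2.
have two w w' l l' : w \in c -> w' \in c -> leg e E2 x2 w l -> leg e E2 x2 w' l' ->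
    l <= l'.+2 -> l' <= l.+2 -> w != w' \/ l != l' -> False.
  have at2 u k : leg e E2 x2 u k -> attached e E2 u.
    case=> p [_ _ sp' el _]; apply/exists_inP; exists (last x2 p) => //.
    exact/sp'/mem_last.
  have wlog_ i j k k' : i <= j < n -> leg e E2 x2 (f i) k -> leg e E2 x2 (f j) k' ->
      k <= k'.+2 -> k' <= k.+2 -> f i != f j \/ k != k' -> False.
    move=> ij hk hk' k1 k2 ne.
    have ei : ~~ odd i by apply: contraTN (at2 _ _ hk); apply: noE2.
    have ej : ~~ odd j by apply: contraTN (at2 _ _ hk'); apply: noE2.
    (* Two legs of different lengths with the same end continue along one edge to the next position,
       which is odd, and from there into [E1]. *)
    have [E|nij] := eqVneq i j.
      subst j; case: ne => [|nk]; first by rewrite eqxx.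
      have oi1 : odd (i + 1) by rewrite oddD (negPf ei).
      have [g hg] := attached_leg e_sym (split1 sp) (odds _ oi1).
      have kn1 : 1 < n by nat_lia.
      have j1 := join21 e_sym wf (splitI sp) dcE kn1 hk hg.
      have j2 := join21 e_sym wf (splitI sp) dcE kn1 hk' hg.
      case: ng; have [lt|ge] := ltnP k k'; first by apply: (good_near j1 j2); nat_lia.
      by apply: (good_near j2 j1); nat_lia.
    apply: (@even_legs _ _ e_sym _ _ _ wf E1 E2 x1 x2 (split1 sp) (splitI sp) dcE ng
      h i ((j - i)./2) k k') => //; try nat_lia.
    by rewrite (_ : i + _ = j) //; nat_lia.
  move=> /(wind_onto wf)[i0 Ei] /(wind_onto wf)[j0 Ej].
  have fm t : f (t %% n) = f t.
    rewrite {2}(divn_eq t n) addnC; elim: (t %/ n) => [|q IH]; first by rewrite addn0.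
    by rewrite mulSn addnCA addnC (wind_per wf).
  rewrite -Ei -Ej -(fm i0) -(fm j0).
  have mi : i0 %% n < n by rewrite ltn_mod; nat_lia.
  have mj : j0 %% n < n by rewrite ltn_mod; nat_lia.
  move=> hl hl' l1 l2 ne; have [le|lt] := leqP (i0 %% n) (j0 %% n).
    by apply: (wlog_ _ _ _ _ _ hl hl') => //; rewrite le.
  apply: (wlog_ _ _ _ _ _ hl' hl) => //; first by rewrite ltnW.
  by rewrite eq_sym (eq_sym l'); exact: ne.
have one u : u \in E2 -> forall w w', w \in c -> w' \in c -> e u w -> e u w' -> w = w'.
  move=> uE w w' win win' uw uw'; apply/eqP; apply: contraT => ne.
  have [p [pp lp up sp']] := rooted_path e_sym (split2 sp) uE.
  have lg v : e u v -> leg e E2 x2 v (size p).+1 by move=> uv; exists p; rewrite lp.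
  by case: (two w w' _ _ win win' (lg _ uw) (lg _ uw')); [nat_lia|nat_lia|left].
pose t := f 0; pose e1 := contract e c E2 P t; pose R := E2 :\: P.
have RE u : u \in R -> u \in E2 by apply/subsetP/subsetDl.
have [s hs] := contract_leg e_sym ac sp pv (wc 0).
have aR : a \in R := a_in_R pv.
have tR : t \notin R := t_notin_R ac P sp (wc 0).
have RW u : u \in R -> u \in W.
  by move=> /RE uE; apply: (halves_W sp); rewrite in_setU uE orbT.
have gd : good e1 a t.
  apply: (@IHB e1 (t |: R) a t z).
  - apply: proper_card; apply/properP; split.
      apply/subsetP=> u; rewrite in_setU1 => /orP[/eqP->|/RW//]; exact: (cyc_in_W supp cc (wc 0)).
    exists (f 1); first exact: (cyc_in_W supp cc (wc 1)).
    rewrite in_setU1 negb_or; apply/andP; split.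
      have n1 : 1 < n by nat_lia.
      by apply/negP=> /eqP E; have := wind_inj wf n1 (esym E : f 0 = f (0 + 1)).
    exact: (t_notin_R ac P sp (wc 1)).
  - exact: contract_sym.
  - exact: (contract_irr e_irr ac P sp (wc 0)).
  - by move=> u v; apply: contract_supp.
  - by rewrite in_setU1 aR orbT.
  - by rewrite setU11.
  - by apply: contraNneq tR => <-.
  - exact: (contract_linked e_sym supp lnk x1W x2W ac sp pv (wc 0)).
  - move=> v; rewrite in_setU1 => /orP[/eqP->|vR]; first by rewrite eqxx.
    move=> va vt; rewrite (contract_degree e_sym ac sp pv (wc 0) vR va (one v (RE _ vR))).
    apply: degW; first exact: RW.
      by apply: contraTneq (RE _ vR) => ->; apply: (splitI sp); case: (split1 sp).
    by apply: contraNneq va => E; rewrite E (x2_R pv) // -E.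
  - move=> v; rewrite in_setU1 => /orP[/eqP->|vR]; first by rewrite eqxx.
    move=> va vt vz; rewrite (contract_degree e_sym ac sp pv (wc 0) vR va (one v (RE _ vR))).
    apply: deg3 => //; first exact/(subsetP sub)/RE.
    by apply: contraNneq va => E; rewrite E (x2_R pv) // -E.
  - have touch i : attached e E2 (f i) -> exists2 u, u \in R & e u (f i).
      case/exists_inP=> u uE uf; exists u => //; rewrite in_setD uE andbT.
      by apply: contra (pivot_touch pv) => uP; apply/touchesP; exists u, (f i).
    (* Positions 2 and 4 are distinct and nonzero modulo [n], as [n] is at least 6. Their neighbours
       in [R] are distinct, each having one neighbour on [c]. *)
    have [|u uR uf] := touch 2; first by apply: evens => //; apply: nd; nat_lia.
    have [|u' uR' uf'] := touch 4; first by apply: evens => //; apply: nd; nat_lia.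
    have : size [:: u; u'] <= degree e1 t.
      apply: degree_uniq.
        rewrite /= inE andbT; apply/eqP=> E; rewrite -E in uf'.
        have := one u (RE _ uR) _ _ (wc 2) (wc 4) uf uf' => E24.
        by have := @wind_inj _ _ _ _ _ wf 2 2 n2 E24.
      rewrite /= andbT /e1 (contract_sym e_sym c E2 P t t u) (contract_sym e_sym c E2 P t t u').
      rewrite !(contract_t ac sp (wc 0)) //.
      by apply/andP; split; apply/hasP; [exists (f 2) | exists (f 4)].
    by [].
case: gd => l [/hs[w win lw] [] /hs[w' win' lw']].
  by case: (two w w' _ _ win win' lw lw'); [nat_lia|nat_lia|right; nat_lia].
by case: (two w w' _ _ win win' lw lw'); [nat_lia|nat_lia|right; nat_lia].
Qed.

End Finish.

Lemma third_neighbour (V : finType) (e : rel V) a b v : 2 < degree e v ->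
  exists u, [/\ e v u, u != a & u != b].
Proof.
move=> d3; have [/existsP[u /and3P[]]|/existsPn nu] :=
  boolP [exists u, [&& e v u, u != a & u != b]]; first by exists u.
have : degree e v <= #|[set a; b]|.
  apply/subset_leq_card/subsetP=> u; rewrite !inE => vu; have := nu u.
  by rewrite vu /= negb_and !negbK.
by rewrite cards2 => h; have := leq_trans d3 h; case: (_ != _).
Qed.

(** * Position of the exceptional vertices relative to the cycle *)

Section CycleStep.
Variables (V : finType) (e : rel V).
Hypothesis e_sym : symmetric e.
Hypothesis e_irr : irreflexive e.
Variable W : {set V}.
Hypothesis supp : forall u v, e u v -> u \in W.
Hypothesis IHB : one_exception_below V #|W|.

Section Core.
Variables (x1 x2 y z : V).
Hypothesis lnk : linked e x1 x2 W.
Hypotheses (x1W : x1 \in W) (x2W : x2 \in W).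
Hypothesis degW : forall v, v \in W -> v != x1 -> v != x2 -> degree e v <= 3.
Hypothesis deg3 : forall v, v \in W -> v != x1 -> v != x2 -> v != y -> v != z -> degree e v = 3.
Variable c : seq V.
Hypotheses (ac : avoids x1 x2 c) (cc : iscyc e c).
Variables (D1 D2 : {set V}) (f : nat -> V) (n h : nat).
Hypothesis sp : halves e x1 x2 c D1 D2.
Hypothesis wf : winding e c n f.
Hypothesis En : n = h.*2.+1.*2.
Hypothesis odds : forall i, odd i -> attached e D1 (f i).
Hypothesis evens : forall i, ~~ odd i -> ~~ (n %| i) -> attached e D2 (f i).

(** At most one of [y] and [z] lies in [D2], which is all that [finish] allows on the side where
    induction is applied. *)
Lemma core_same : y \in D1 \/ z \in c -> y \notin c -> good e x1 x2.
Proof.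
move=> yz yc.
have DW v : v \in D2 -> v \in W.
  by move=> vD; apply: (halves_W e_sym supp x1W x2W sp); rewrite in_setU vD orbT.
have nx1 v : v \in D2 -> v != x1.
  by move=> vD; apply: contraTneq vD => ->; apply: (splitI sp); case: (split1 sp).
case: yz => [yD|zc].
  apply: (finish e_sym e_irr supp lnk x1W x2W IHB degW ac cc sp wf En odds evens (z := z)).
  move=> v vD v2 vz; apply: deg3 => //; [exact: DW|exact: nx1|].
  by apply: contraTneq vD => ->; apply: (splitI sp).
apply: (finish e_sym e_irr supp lnk x1W x2W IHB degW ac cc sp wf En odds evens (z := y)).
move=> v vD v2 vy; apply: deg3 => //; [exact: DW|exact: nx1|].
by apply: contraTneq vD => ->; have /andP[_] := cyc_notin_split ac sp zc.
Qed.

End Core.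

Lemma winding_shift c n f : winding e c n f -> winding e c n (fun i => f i.+1).
Proof.
case=> n2 fm fo fp fi fe; split=> //.
- move=> v vc; have [i Ei] := fo v vc; exists (i + n.-1).
  by rewrite -Ei -(fp i); congr f; lia.
- by move=> i; rewrite -addSn fp.
- by move=> i k kn; rewrite -addSn; apply: fi.
Qed.

(** The remaining case has [y] in [D2] and [z] off [c]. Then position 0 is coloured as well,
    necessarily 2, since colour 1 would conflict with position [h.*2]. In this perfect alternation a
    rotation by one exchanges the sides, and [y] lies on the side that is not contracted. *)
Lemma core (x1 x2 y z : V) c D1 D2 f n h : linked e x1 x2 W -> x1 \in W -> x2 \in W ->
  (forall v, v \in W -> v != x1 -> v != x2 -> degree e v <= 3) ->
  (forall v, v \in W -> v != x1 -> v != x2 -> v != y -> v != z -> degree e v = 3) ->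
  avoids x1 x2 c -> iscyc e c -> halves e x1 x2 c D1 D2 -> winding e c n f ->
  y \in reach e c x1 x2 -> (z \notin c -> attached e D1 (f 0) || attached e D2 (f 0)) ->
  n = h.*2.+1.*2 -> (forall i, odd i -> attached e D1 (f i)) ->
  (forall i, ~~ odd i -> ~~ (n %| i) -> attached e D2 (f i)) -> good e x1 x2.
Proof.
move=> lnk x1W x2W degW deg3 ac cc sp wf yR c0 En odds evens.
have yc : y \notin c := reach_notin ac yR.
have [zc|zc] := boolP (z \in c).
  by apply: (core_same lnk x1W x2W degW deg3 ac cc sp wf En odds evens) => //; right.
move: yR; rewrite -(splitU sp) in_setU => /orP[yD|yD].
  by apply: (core_same lnk x1W x2W degW deg3 ac cc sp wf En odds evens) => //; left.
apply: NNPP => ng; have n2 := wind_gt2 wf.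
have a0 : attached e D2 (f 0).
  have := c0 zc; rewrite orbC; case/orP=> // a0.
  have := @no_near _ _ e_sym _ _ _ wf D1 D2 x1 x2 (split1 sp) (split2 sp) (splitI sp)
    (cyc_notin_split ac sp) ng 0 (h.*2).
  have nd : ~~ (n %| 0 + h.*2) by rewrite gtnNdvd //; nat_lia.
  rewrite a0 evens ?odd_double //= => H; have : false; last by [].
  by apply: H; [nat_lia | rewrite /near; nat_lia].
have fd i : n %| i -> f i = f 0.
  move=> /dvdnP[q ->]; elim: q => // q IH; by rewrite mulSn addnC (wind_per wf).
apply: ng; apply: good_sym => //.
apply: (@core_same x2 x1 y z (linked_sym lnk) x2W x1W _ _ c _ cc D2 D1 (fun i => f i.+1) n h) => //.
- by move=> v vW v2 v1; apply: degW.
- by move=> v vW v2 v1; apply: deg3.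
- by rewrite avoids_sym.
- exact: halves_sym.
- exact: winding_shift.
- move=> i oi; have [nd|nd] := boolP (n %| i.+1); first by rewrite fd.
  by apply: evens => //=; rewrite oi.
- by move=> i oi _; apply: odds.
- by left.
Qed.

Variables (x1 x2 y z : V).
Hypothesis lnk : linked e x1 x2 W.
Hypotheses (x1W : x1 \in W) (x2W : x2 \in W) (x12 : x1 != x2).
Hypothesis degW : forall v, v \in W -> v != x1 -> v != x2 -> degree e v <= 3.
Hypothesis deg3 : forall v, v \in W -> v != x1 -> v != x2 -> v != y -> v != z -> degree e v = 3.

Lemma good_of_cycle c : avoids x1 x2 c -> iscyc e c -> y \in reach e c x1 x2 -> good e x1 x2.
Proof.
move=> ac0 cc0 yR0; apply: NNPP => ng.
have [c' [cc ac sub st]] := settle e_sym e_irr supp lnk ac0 cc0 degW.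
have yR := subsetP sub _ yR0.
have [D1 [D2 [sp t1 t2]]] := split_exists e_sym supp lnk ac cc x12.
(* Since [y] is off the cycle, only [z] can be uncoloured; if it lies on the cycle it is made
   position 0. *)
have [v0 [v0c v0z]] : exists v0, v0 \in c' /\ (z \in c' -> v0 = z).
  have [zc|zc] := boolP (z \in c'); first by exists z.
  by have [v vc] := cyc_nonempty cc; exists v.
have [f [wf f0]] := winding_exists cc v0c.
set n := size c' in wf; have n2 := wind_gt2 wf.
have fd i : n %| i -> f i = f 0.
  move=> /dvdnP[q ->]; elim: q => // q IH; by rewrite mulSn addnC (wind_per wf).
have df i : f i = f 0 -> n %| i.
  have fm t : f (t %% n) = f t.
    rewrite {2}(divn_eq t n) addnC; elim: (t %/ n) => [|q IH]; first by rewrite addn0.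
    by rewrite mulSn addnCA addnC (wind_per wf).
  rewrite -fm => E; have mi : i %% n < n by rewrite ltn_mod; nat_lia.
  by apply/eqP; have := wind_inj wf mi (esym E : f 0 = f (0 + i %% n)).
have col v : v \in c' -> v != z -> attached e D1 v || attached e D2 v.
  move=> vc vz.
  have vW := cyc_in_W supp cc vc.
  have dv : degree e v = 3.
    apply: deg3 => //.
    - by apply: contraTneq vc => ->; case/andP: ac.
    - by apply: contraTneq vc => ->; case/andP: ac.
    - by apply: contraTneq vc => ->; apply: reach_notin yR.
  have [|u [vu un up]] := @third_neighbour _ e (next c' v) (prev c' v) v; first by rewrite dv.
  have := st v vc u vu un up; rewrite -(splitU sp) in_setU.
  by move=> /orP[] uD; apply/orP; [left|right]; apply/exists_inP; exists u; rewrite // e_sym.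
have at_ D : touches e c' D -> exists i, attached e D (f i).
  move=> /touchesP[u [w [uD wc uw]]]; have [i Ei] := wind_onto wf wc.
  by exists i; rewrite Ei; apply/exists_inP; exists u.
have c0 : z \notin c' -> attached e D1 (f 0) || attached e D2 (f 0).
  by move=> zc; apply: col; [exact: wind_mem wf 0 | apply: contraNneq zc => <-; exact: wind_mem wf 0].
have [||i ni|h En [[odds evens]|[odds evens]]] :=
  sides_alternate e_sym wf (split1 sp) (split2 sp) (splitI sp) (cyc_notin_split ac sp) ng.
- exact: at_.
- exact: at_.
- apply: col; first exact: (wind_mem wf i).
  have [zc|zc] := boolP (z \in c'); last by apply: contraNneq zc => <-; exact: (wind_mem wf i).
  by apply: contra ni => /eqP E; apply: df; rewrite E f0 v0z.
- exact/ng/(core lnk x1W x2W degW deg3 ac cc sp wf yR c0 En odds evens).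
apply/ng/good_sym => //.
apply: (core (y := y) (z := z) (linked_sym lnk) x2W x1W _ _ _ cc (halves_sym sp) wf _ _ En odds evens).
- by move=> v vW v2 v1; apply: degW.
- by move=> v vW v2 v1; apply: deg3.
- by rewrite avoids_sym.
- by rewrite reach_sym.
- by move=> /c0; rewrite orbC.
Qed.

End CycleStep.

(** * One exceptional vertex *)

Lemma two_neighbours (V : finType) (e : rel V) v (B : {set V}) : 2 < degree e v ->
  (forall a b, e v a -> e v b -> a \in B -> b \in B -> a = b) ->
  exists a b, [/\ a != b, e v a, e v b, a \notin B & b \notin B].
Proof.
move=> d3 one; have : #|[set w | e v w] :&: B| <= 1.
  by apply/card_le1_eqP=> a b; rewrite !in_setI !in_set => /andP[va aB] /andP[vb bB]; apply: one.
have := cardsID B [set w | e v w]; rewrite -/(degree e v) => E l1.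
have /card_gt1P[a [b [+ + ab]]] : 1 < #|[set w | e v w] :\: B| by lia.
by rewrite !in_setD !in_set => /andP[aB va] /andP[bB vb]; exists a, b.
Qed.

Section OneException.
Variables (V : finType) (e : rel V).
Hypothesis e_sym : symmetric e.
Hypothesis e_irr : irreflexive e.
Variables (W : {set V}) (x1 x2 z : V).
Hypothesis supp : forall u v, e u v -> u \in W.
Hypothesis IHB : one_exception_below V #|W|.
Hypothesis lnk : linked e x1 x2 W.
Hypotheses (x1W : x1 \in W) (x2W : x2 \in W) (x12 : x1 != x2).
Hypothesis degW : forall v, v \in W -> v != x1 -> v != x2 -> degree e v <= 3.
Hypothesis deg3 : forall v, v \in W -> v != x1 -> v != x2 -> v != z -> degree e v = 3.

Lemma haslen_seq x y p : path e x p -> last x p = y -> uniq (x :: p) -> haslen e x y (size p).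
Proof. by exists p. Qed.

Lemma edge_neq u v : e u v -> u != v.
Proof. by apply: contraTneq => ->; rewrite e_irr. Qed.

(** A cycle avoiding both roots is handled by [good_of_cycle], so [F] may be taken to induce a
    forest. A common neighbour of the roots gives length 2 and thereby forbids lengths 3 and 4; this
    keeps so many edges inside [F :\: S] that only [z] can be left there. *)
Lemma good_short : 1 < degree e x2 -> good e x1 x2.
Proof.
move=> d2; apply: NNPP => ng.
have nc c : iscyc e c -> avoids x1 x2 c -> False.
  (* [x1] plays the part of the reachable exceptional vertex. *)
  move=> cc ac; apply: ng; apply: (@good_of_cycle _ _ e_sym e_irr W supp IHB x1 x2 x1 z lnk
    x1W x2W x12 degW _ c) => //; last exact: reach1.
  by move=> v vW v1 v2 _; apply: deg3.
pose F := W :\ x1 :\ x2.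
have FP v : reflect [/\ v \in W, v != x1 & v != x2] (v \in F).
  by rewrite /F !in_setD1; apply: (iffP and3P) => [[]|[]].
pose S := [set v in F | [&& v != z, e x1 v & e x2 v]].
have SP v : v \in S -> [/\ v \in F, v != z, e x1 v & e x2 v] by rewrite in_set => /and4P.
have len2 l : l \in S -> haslen e x1 x2 2.
  move=> /SP[/FP[lW l1 l2] lz e1 e2]; apply: (@haslen_seq _ _ [:: l; x2]) => //=.
    by rewrite e1 e_sym e2.
  by rewrite !inE negb_or x12 (eq_sym x1) l1 l2.
have len3 u v : u \in F -> v \in F -> e x1 u -> e u v -> e v x2 -> haslen e x1 x2 3.
  move=> /FP[uW u1 u2] /FP[vW v1 v2] e1 e2 e3; apply: (@haslen_seq _ _ [:: u; v; x2]) => //=.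
    by rewrite e1 e2 e3.
  by rewrite !inE !negb_or x12 (eq_sym x1) u1 (eq_sym x1) v1 u2 v2 (edge_neq e2).
have len4 u v w : u \in F -> v \in F -> w \in F -> e x1 u -> e u v -> e v w -> e w x2 ->
    u != w -> haslen e x1 x2 4.
  move=> /FP[uW u1 u2] /FP[vW v1 v2] /FP[wW w1 w2] e1 e2 e3 e4 uw.
  apply: (@haslen_seq _ _ [:: u; v; w; x2]) => //=; first by rewrite e1 e2 e3 e4.
  rewrite !inE !negb_or x12 (eq_sym x1) u1 (eq_sym x1) v1 (eq_sym x1) w1 u2 v2 w2.
  by rewrite (edge_neq e2) (edge_neq e3) uw.
have no3 l : l \in S -> haslen e x1 x2 3 -> False.
  by move=> lS h3; apply: ng; exists 2; split; [apply: len2 lS | left].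
have no4 l : l \in S -> haslen e x1 x2 4 -> False.
  by move=> lS h4; apply: ng; exists 2; split; [apply: len2 lS | right].
(* Two neighbours of [v] among [x1], [x2] and [S] would put [v] into [S] or give a path of length 3
   or 4 beside one of length 2. *)
have deg v : v \in F :\: S -> v != z ->
    exists a b, [/\ a \in F :\: S, b \in F :\: S, a != b, e v a & e v b].
  rewrite in_setD => /andP[vS vF] vz; have [vW v1 v2] := FP v vF.
  have [||a [b [ab va vb aB bB]]] := @two_neighbours _ e v (x1 |: (x2 |: S)).
  - by rewrite deg3.
  - have q1 l : e v x1 -> l \in S -> e v l -> False.
      move=> vx lS vl; have [lF _ _ l2] := SP l lS.
      by apply: (no3 l lS); apply: (len3 v l) => //; rewrite e_sym.
    have q2 l : e v x2 -> l \in S -> e v l -> False.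
      move=> vx lS vl; have [lF _ l1 _] := SP l lS.
      by apply: (no3 l lS); apply: (len3 l v) => //; rewrite e_sym.
    have q12 : e v x1 -> e v x2 -> False.
      by move=> vx vx'; case/negP: vS; rewrite in_set vF vz e_sym vx e_sym vx'.
    move=> a b va vb; rewrite !in_setU1.
    case/or3P=> [/eqP Ea|/eqP Ea|aS]; case/or3P=> [/eqP Eb|/eqP Eb|bS]; subst => //.
    + by case: q12.
    + by case: (q1 b).
    + by case: q12.
    + by case: (q2 b).
    + by case: (q1 a).
    + by case: (q2 a).
    apply/eqP; apply: contraT => ab; have [aF _ a1 _] := SP a aS; have [bF _ _ b2] := SP b bS.
    by case: (no4 a aS); apply: (len4 a v b) => //; rewrite e_sym.
  have inFS w : e v w -> w \notin x1 |: (x2 |: S) -> w \in F :\: S.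
    move=> vw; rewrite !in_setU1 !negb_or in_setD => /and3P[w1 w2 ->] /=.
    by apply/FP; split=> //; apply: supp; rewrite e_sym; apply: vw.
  by exists a, b; split=> //; apply: inFS.
have FSz u : u \in F :\: S -> u = z.
  move=> uFS; apply/eqP; apply: contraT => uz.
  have [c cc cU] := cycle_of_degrees e_sym e_irr uFS uz deg.
  case: (nc c cc); apply/andP; split; apply/negP=> /cU; rewrite in_setD => /andP[_ /FP[_]];
    by rewrite eqxx.
have Fz u : u \in F -> u \in S \/ u = z.
  move=> uF; have [uS|uS] := boolP (u \in S); [by left|right].
  by apply: FSz; rewrite in_setD uS.
(* The third neighbour of [l] is in [S] or is [z]. In the second case [linked] gives [z] a neighbour
   other than [l]; either way a path of length 3 or 4 arises. *)
have S0 l : l \in S -> False.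
  move=> lS; have [lF lz l1 l2] := SP l lS; have [lW ll1 ll2] := FP l lF.
  have [|u [lu u1 u2]] := @third_neighbour _ e x1 x2 l; first by rewrite deg3.
  have uF : u \in F by apply/FP; split=> //; apply: supp; rewrite e_sym; apply: lu.
  case: (Fz u uF) => [uS|uz].
    have [_ _ _ e2] := SP u uS.
    by apply: (no3 l lS); apply: (len3 l u) => //; rewrite e_sym.
  subst u; have [|||||u' [v [+ + vl zv]]] := lnk (S := [set z]) (w := l).
  - by rewrite sub1set; case/FP: uF.
  - by apply/set0Pn; exists z; rewrite set11.
  - by rewrite in_set1 eq_sym.
  - by rewrite in_set1 eq_sym.
  - by rewrite in_set1.
  rewrite !in_set1 => /eqP E vz; rewrite E in zv => {u' E}.
  have vW : v \in W by apply: supp; rewrite e_sym; apply: zv.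
  have [E|v1] := eqVneq v x1.
    apply: (no3 l lS); apply: (len3 z l) => //; rewrite e_sym //; by rewrite -E.
  have [E|v2] := eqVneq v x2.
    by apply: (no3 l lS); apply: (len3 l z) => //; rewrite -E.
  have vF : v \in F by apply/FP.
  case: (Fz v vF) => [vS|E]; last by rewrite E eqxx in vz.
  have [_ _ _ e2] := SP v vS.
  by apply: (no4 l lS); apply: (len4 l z v) => //; rewrite 1?e_sym // eq_sym.
have Fz' u : u \in F -> u = z by case/Fz=> // /S0.
(* Besides the roots only [z] is left: the two neighbours of [x2] are [x1] and [z], and [z] is
   adjacent to [x1] since [x2] does not cut it off. The lengths are 1 and 2. *)
move: d2; rewrite /degree => /card_gt1P[a [b [+ + ab]]]; rewrite !in_set => xa xb.
have nb u : e x2 u -> u = x1 \/ (u = z /\ z \in F).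
  move=> xu; have [->|u1] := eqVneq u x1; [by left|right].
  have uF : u \in F.
    apply/FP; split=> //; first by apply: supp; rewrite e_sym; apply: xu.
    by rewrite eq_sym; apply: edge_neq.
  by rewrite -(Fz' u uF).
have [e12 [e2z zF]] : e x2 x1 /\ e x2 z /\ z \in F.
  case: (nb a xa) (nb b xb) => [Ea|[Ea zF]] [Eb|[Eb zF']]; subst => //.
  - by rewrite eqxx in ab.
  - by rewrite eqxx in ab.
have [zW z1 z2] := FP z zF.
have [|||||u' [v [+ + vl zv]]] := lnk (S := [set z]) (w := x2).
- by rewrite sub1set.
- by apply/set0Pn; exists z; rewrite set11.
- by rewrite in_set1 eq_sym.
- by rewrite in_set1 eq_sym.
- by rewrite in_set1 eq_sym.
rewrite !in_set1 => /eqP E vz; rewrite E in zv => {u' E}.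
have v1 : v = x1.
  apply/eqP; apply: contraT => v1; have vF : v \in F.
    by apply/FP; split=> //; apply: supp; rewrite e_sym; apply: zv.
  by rewrite (Fz' v vF) eqxx in vz.
subst v; apply: ng; exists 1; split.
  by apply: (@haslen_seq _ _ [:: x2]) => //=; rewrite ?inE ?x12 // e_sym e12.
left; apply: (@haslen_seq _ _ [:: z; x2]) => //=; first by rewrite e_sym zv e_sym e2z.
by rewrite !inE negb_or x12 (eq_sym x1) z1 z2.
Qed.

End OneException.

Lemma good_one_exception (V : finType) k : one_exception_below V k.
Proof.
elim: k => [|k IH] e W x1 x2 z; first by rewrite ltn0.
rewrite ltnS => Wk e_sym e_irr supp x1W x2W x12 lnk degW deg3 d2.
apply: (good_short (z := z) e_sym e_irr supp _ lnk) => //.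
by move=> e' W' y1 y2 z' hW; apply: IH; apply: leq_trans Wk.
Qed.

(** * Counting edges *)

Section Counting.
Variables (V : finType) (e : rel V).
Hypothesis e_sym : symmetric e.
Hypothesis e_irr : irreflexive e.
Implicit Types (U S : {set V}).

Definition degree_in U v : nat := \sum_(u in U) e v u.

(** Twice the number of edges inside [U]. *)
Definition total U : nat := \sum_(v in U) degree_in U v.

Lemma degree_inE U v : degree_in U v = #|[set u in U | e v u]|.
Proof.
rewrite /degree_in -sum1_card big_mkcond [RHS]big_mkcond /=; apply: eq_bigr => u _.
by rewrite in_set; case: (u \in U); case: (e v u).
Qed.

Lemma total_rem U v : v \in U -> total U = total (U :\ v) + (degree_in U v).*2.
Proof.
move=> vU; rewrite /total (big_setD1 v vU) /=.
rewrite (eq_bigr (fun u => degree_in (U :\ v) u + e v u)); last first.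
  by move=> u _; rewrite /degree_in (big_setD1 v vU) /= addnC e_sym.
rewrite big_split /= (_ : \sum_(i in U :\ v) e v i = degree_in U v); last first.
  by rewrite /degree_in [RHS](big_setD1 v vU) /= e_irr.
by rewrite addnC -addnA addnn.
Qed.

Lemma total_even U : ~~ odd (total U).
Proof.
have [n] := ubnP #|U|; elim: n U => // n IH U hn.
have [->|[v vU]] := set_0Vmem U; first by rewrite /total big_set0.
rewrite (total_rem vU) oddD odd_double addbF; apply: IH.
by move: hn; rewrite (cardsD1 v) vU.
Qed.

(** The doubled edge bound for forests. Vertices with at most one neighbour in [U] are removed; if
    there is none, [cycle_of_degrees] provides a cycle. *)
Lemma acyclic_total U : U != set0 ->
  (forall c, iscyc e c -> {subset c <= U} -> False) -> total U + 2 <= #|U|.*2.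
Proof.
have [n] := ubnP #|U|; elim: n U => // n IH U hn U0 nc.
have [/existsP[v /andP[vU dv]]|/existsPn big] := boolP [exists v, (v \in U) && (degree_in U v <= 1)].
  rewrite (total_rem vU) (cardsD1 v) vU.
  have [E|ne] := eqVneq (U :\ v) set0.
    have UE : U = [set v] by rewrite -(setD1K vU) E setU0.
    by rewrite E /total big_set0 cards0 /degree_in UE big_set1 e_irr.
  have /IH : #|U :\ v| < n by move: hn; rewrite (cardsD1 v) vU.
  move=> /(_ ne) H; have : total (U :\ v) + 2 <= #|U :\ v|.*2.
    by apply: H => c cc cU; apply: (nc c cc) => u /cU; rewrite in_setD1 => /andP[].
  by move: dv; clear; lia.
have two v : v \in U -> exists a b, [/\ a \in U, b \in U, a != b, e v a & e v b].
  move=> vU; have := big v; rewrite vU /= -ltnNge degree_inE => /card_gt1P[a [b [+ + ab]]].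
  by rewrite !in_set => /andP[aU va] /andP[bU vb]; exists a, b.
have [v vU] := set0Pn _ U0; have [a [b [aU bU ab va vb]]] := two v vU.
have av : a != v by apply: contraTneq va => ->; rewrite e_irr.
have [|c cc cU] := cycle_of_degrees (z := v) e_sym e_irr aU av; last by case: (nc c cc cU).
by move=> u uU _; apply: two.
Qed.

Variable W : {set V}.
Hypothesis supp : forall u v, e u v -> u \in W.

Lemma degree_split S v : S \subset W -> degree e v = degree_in (W :\: S) v + degree_in S v.
Proof.
move=> /subsetP SW; rewrite !degree_inE /degree -(cardsID S [set w | e v w]) addnC.
congr (_ + _); apply: eq_card => u; rewrite !inE.
  case vu: (e v u); rewrite ?andbF // !andbT.
  by rewrite (supp (_ : e u v)) ?andbT // e_sym.
by rewrite andbC.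
Qed.

(** Both sides count the edges inside [W :\: S] and inside [S] twice, and those in between once. *)
Lemma total_complement S : S \subset W ->
  total (W :\: S) + (\sum_(s in S) degree e s) = \sum_(v in W :\: S) degree e v + total S.
Proof.
move=> SW.
rewrite [X in _ + X](eq_bigr (fun s => degree_in (W :\: S) s + degree_in S s)); last first.
  by move=> s _; apply: degree_split.
rewrite [X in _ = X + _](eq_bigr (fun s => degree_in (W :\: S) s + degree_in S s)); last first.
  by move=> s _; apply: degree_split.
rewrite !big_split /= addnA -/(total S); congr (_ + _ + _).
rewrite /degree_in exchange_big /=; apply: eq_bigr => v _; apply: eq_bigr => u _.
by rewrite e_sym.
Qed.

Lemma total_all : total W = \sum_(v in W) degree e v.
Proof.
have := total_complement (sub0set W); rewrite setD0 big_set0 addn0 => ->.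
by rewrite /total big_set0 addn0.
Qed.

Variables x1 x2 y z : V.
Hypothesis un : uniq [:: x1; x2; y; z].
Hypothesis inW : {subset [:: x1; x2; y; z] <= W}.
Hypothesis deg2 : forall v, v \in [:: x1; x2; y; z] -> degree e v = 2.
Hypothesis deg3 : forall v, v \in W -> v \notin [:: x1; x2; y; z] -> degree e v = 3.

Lemma card_even : ~~ odd #|W|.
Proof.
have := total_even W; rewrite total_all.
rewrite (bigID (fun v => v \in [:: x1; x2; y; z])) /=.
rewrite [X in _ + X](eq_bigr (fun=> 3)) => [|v /andP[vW v4]]; last exact: deg3.
rewrite [X in X + _](eq_bigr (fun=> 2)) => [|v /andP[vW v4]]; last exact: deg2.
rewrite !sum_nat_const oddD !oddM andbF andbT /=; apply: contra.
rewrite -(cardsID [set v in [:: x1; x2; y; z]] W) oddD => o.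
have E : #|W :&: [set v in [:: x1; x2; y; z]]| = 4.
  have -> : W :&: [set v in [:: x1; x2; y; z]] = [set v in [:: x1; x2; y; z]].
    by apply/setIidPr/subsetP=> v; rewrite in_set => /inW.
  by rewrite cardsE; apply/card_uniqP.
move: o; rewrite E /= (eq_card (B := [pred v in W | v \notin [:: x1; x2; y; z]])) //.
by move=> v; rewrite !inE andbC.
Qed.

(** With [S] for the set of [x1], [x2] and [y], comparing the degree sum with the forest bound gives
    [#|W| + total S <= 8]. An edge from [y] to a root makes [total S] at least 2. *)
Lemma card_acyclic :
  (forall c, iscyc e c -> {subset c <= W :\: [set x1; x2; y]} -> False) ->
  #|W| <= 8 /\ (e y x1 || e y x2 -> #|W| <= 6).
Proof.
move=> nc.
have [x1W x2W yW zW] : [/\ x1 \in W, x2 \in W, y \in W & z \in W].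
  by split; apply: inW; rewrite !inE eqxx ?orbT.
move: (un); rewrite /= !inE !negb_or => /and4P[/and3P[n12 n1y n1z] /andP[n2y n2z] nyz _].
pose S := [set x1; x2; y].
have SW : S \subset W by apply/subsetP=> v; rewrite !inE -orbA => /or3P[] /eqP->.
have zU : z \in W :\: S by rewrite in_setD zW !inE !negb_or !(eq_sym z) n1z n2z nyz.
have cS : #|S| = 3 by rewrite /S setUC cardsU1 !inE negb_or !(eq_sym y) n1y n2y cards2 n12.
have cU : #|W| = #|W :\: S| + 3.
  by rewrite -(cardsID S W) (setIidPr SW) cS addnC.
have := acyclic_total (introT (set0Pn _) (ex_intro _ z zU)) nc.
have := total_complement SW.
have -> : \sum_(s in S) degree e s = 6.
  rewrite (eq_bigr (fun=> 2)) ?sum_nat_const ?cS // => s.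
  by rewrite !inE -orbA => /or3P[] /eqP->; apply: deg2; rewrite !inE eqxx ?orbT.
have -> : \sum_(v in W :\: S) degree e v = 2 + (#|W :\: S|.-1) * 3.
  rewrite (big_setD1 z zU) deg2 ?inE ?eqxx ?orbT //=; congr (_ + _).
  rewrite (eq_bigr (fun=> 3)) ?sum_nat_const; last first.
    move=> v; rewrite !inE !negb_or => /and3P[vz /andP[/andP[v1 v2] vy] vW].
    by apply: deg3 => //; rewrite !inE !negb_or v1 v2 vy vz.
  by rewrite (cardsD1 z (W :\: S)) zU.
have U0 : 0 < #|W :\: S| by apply/card_gt0P; exists z.
move=> E1 E2; split; first by move: E1 E2 cU U0; clear; lia.
move=> yx; suff t2 : 0 < total S.
  have te := total_even S.
  by move: E1 E2 cU U0 t2 te; clear; lia.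
have yS : y \in S by rewrite !inE eqxx orbT.
rewrite (total_rem yS) addn_gt0; apply/orP; right; rewrite double_gt0 degree_inE.
by apply/card_gt0P; case/orP: yx => yx; [exists x1 | exists x2]; rewrite !inE yx eqxx ?orbT.
Qed.

End Counting.

(** * Small graphs *)

(* Exhaustive search over the graphs on [0, .., N - 1] with the given residual
   degrees: [0] and [1] stand for [x1] and [x2], then come [y] and [z]. *)
Section Search.
Variable N : nat.

Definition adj (E : seq (nat * nat)) i j := ((i, j) \in E) || ((j, i) \in E).

Definition pool := iota 2 (N - 2).

Fixpoint walk (E : seq (nat * nat)) k u (vis : seq nat) : bool :=
  if k is k'.+1 then
    has (fun w => if adj E u w && (w \notin vis) then walk E k' w (w :: vis) else false) pool
  else adj E u 1.

Definition two_common E :=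
  has (fun i => adj E 0 i && adj E 1 i &&
    has (fun j => [&& i < j, adj E 0 j & adj E 1 j]) pool) pool.

(** All edges at [i], [j] (degree 3) and [k] (degree 2) run among these three and 0, so [x1] cuts
    them off, against [linked]. *)
Definition closed_triangle E :=
  has (fun i => adj E 0 i &&
    has (fun j => [&& i < j, adj E 0 j, adj E i j &
      has (fun k => adj E k i && adj E k j) [:: 2; 3]]) (iota 4 (N - 4))) (iota 4 (N - 4)).

(** [h k] asks for a path with [k] interior vertices, that is [k.+1] edges. The accepted lengths are
    3 with 4 or 5, 2 with 3 or 4, and 4 with 5. The last two clauses accept graphs that the
    hypotheses exclude. *)
Definition test E :=
  let h k := walk E k 0 [:: 0; 1] in
  [|| h 2 && (h 3 || h 4), h 1 && (h 2 || h 3), h 3 && h 4, two_common E | closed_triangle E].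

Definition dec i (res : seq nat) := set_nth 0 res i (nth 0 res i).-1.

Fixpoint search (free E : seq (nat * nat)) (res : seq nat) : bool :=
  if free is (i, j) :: fr then
    search fr E res &&
    (if (0 < nth 0 res i) && (0 < nth 0 res j) then search fr ((i, j) :: E) (dec i (dec j res))
     else true)
  else if all (pred1 0) res then test E else true.

End Search.

Definition pairs i s : seq (nat * nat) := [seq (i, j) | j <- s].
(** All pairs except [(0, 1)], the roots being nonadjacent. *)
Definition free6 := pairs 0 [:: 2; 3; 4; 5] ++ pairs 1 [:: 2; 3; 4; 5] ++ pairs 2 [:: 3; 4; 5]
  ++ pairs 3 [:: 4; 5] ++ pairs 4 [:: 5].
(** With eight vertices neither [y] nor [z] is adjacent to a root. So the neighbours of [x1] have
    degree 3 and are numbered 4 and 5 beforehand, no pair at 0 is left, and 1 is not paired with 2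
    or 3. *)
Definition free8 := pairs 1 [:: 4; 5; 6; 7] ++ pairs 2 [:: 3; 4; 5; 6; 7] ++ pairs 3 [:: 4; 5; 6; 7]
  ++ pairs 4 [:: 5; 6; 7] ++ pairs 5 [:: 6; 7] ++ pairs 6 [:: 7].

Lemma search6 : search 6 free6 [::] [:: 2; 2; 2; 2; 3; 3].
Proof. by vm_compute. Qed.

Lemma search8 : search 8 free8 [:: (0, 4); (0, 5)] [:: 0; 2; 2; 2; 2; 2; 3; 3].
Proof. by vm_compute. Qed.

Section SearchSound.
Variables (N : nat) (A : rel nat).
Hypothesis A_sym : symmetric A.

Definition incidence v (p : nat * nat) : nat := (p.1 == v) + (p.2 == v).

Lemma nth_dec i res v : nth 0 (dec i res) v = nth 0 res v - (i == v).
Proof. by rewrite nth_set_nth /= eq_sym; case: eqP => [->|]; rewrite ?subn1 ?subn0. Qed.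

Lemma searchP free E res : search N free E res ->
  all (fun p => (p.1 != p.2) && (p.1 < N) && (p.2 < N)) free -> size res <= N ->
  (forall v, v < N -> nth 0 res v = sumn [seq A p.1 p.2 * incidence v p | p <- free]) ->
  {in E, forall p, A p.1 p.2} ->
  exists2 E', test N E' & {in E', forall p, A p.1 p.2}.
Proof.
elim: free E res => [|[i j] fr IH] E res /=.
  move=> + _ sz r0 AE; rewrite (_ : all _ _); first by exists E.
  apply/(all_nthP 0) => v vs; apply/eqP/r0; exact: leq_trans sz.
case/andP=> s1 s2 /andP[/andP[/andP[ij iN] jN] afr] sz hr AE.
have [Aij|nA] := boolP (A i j); last first.
  apply: (IH E res s1 afr sz _ AE) => v vN.
  by rewrite hr // (negPf nA) mul0n.
have ri : 0 < nth 0 res i by rewrite hr // Aij /incidence /= eqxx.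
have rj : 0 < nth 0 res j by rewrite hr // Aij /incidence /= eqxx addn1.
rewrite ri rj /= in s2; apply: (IH _ _ s2 afr).
- have lt t : 0 < nth 0 res t -> t < size res.
    by move=> h; rewrite ltnNge; apply: contraL h => h; rewrite nth_default.
  have := lt _ ri; have := lt _ rj; rewrite !size_set_nth; move: sz; clear; lia.
- move=> v vN; rewrite !nth_dec hr // Aij mul1n /incidence /=.
  by clear; lia.
- by move=> p; rewrite inE => /orP[/eqP->|/AE].
Qed.

Variable E : seq (nat * nat).
Hypothesis AE : {in E, forall p, A p.1 p.2}.

Lemma adjP i j : adj E i j -> A i j.
Proof. by case/orP=> /AE //=; rewrite A_sym. Qed.

Lemma walkP k u vis : walk N E k u vis -> exists m, [/\ size m = k, path A u (rcons m 1),
  uniq m, {subset m <= pool N} & {in m, forall w, w \notin vis}].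
Proof.
elim: k u vis => [|k IH] u vis /=; first by move/adjP=> h; exists [::]; rewrite /= h.
case/hasP=> w wp; case: ifP => // /andP[/adjP uw wv] /IH[m [sm pm um mp mv]].
exists (w :: m); split=> /=.
- by rewrite sm.
- by rewrite uw.
- by rewrite um andbT; apply/negP=> /mv; rewrite mem_head.
- by move=> a; rewrite inE => /orP[/eqP->|/mp].
- move=> a; rewrite inE => /orP[/eqP->//|/mv]; by rewrite inE negb_or => /andP[].
Qed.

End SearchSound.

Section SmallGraphs.
Variables (V : finType) (e : rel V).
Hypothesis e_sym : symmetric e.
Hypothesis e_irr : irreflexive e.
Variables (W : {set V}) (x1 x2 : V) (s : seq V).
Hypothesis supp : forall u v, e u v -> u \in W.
Hypothesis lnk : linked e x1 x2 W.
Let vs := [:: x1, x2 & s].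
Hypothesis uvs : uniq vs.
Hypothesis Wvs : forall v, (v \in W) = (v \in vs).
Hypothesis deg : forall i, i < size vs -> degree e (nth x1 vs i) = if i < 4 then 2 else 3.
Hypothesis common : forall a b, e x1 a -> e x2 a -> e x1 b -> e x2 b -> a = b.
Let N := size vs.
Let A : rel nat := fun i j => e (nth x1 vs i) (nth x1 vs j).

Lemma A_sym : symmetric A. Proof. by move=> i j; apply: e_sym. Qed.

(** Each pair is read with the smaller index first, matching the order in [free6] and [free8]. *)
Lemma degree_column v : v < N ->
  degree e (nth x1 vs v) = sumn [seq nat_of_bool (if i < v then A i v else A v i) | i <- iota 0 N].
Proof.
move=> vN; have -> : degree e (nth x1 vs v) = count (e (nth x1 vs v)) vs.
  rewrite -size_filter /degree cardE; apply/perm_size/uniq_perm; rewrite ?enum_uniq ?filter_uniq //.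
  move=> u; rewrite mem_enum in_set mem_filter andbC.
  have [ev|] := boolP (e (nth x1 vs v) u); last by rewrite andbF.
  by rewrite andbT -Wvs; apply: esym; apply: supp (_ : e u (nth x1 vs v)); rewrite e_sym.
rewrite -{2}(mkseq_nth x1 vs) /mkseq count_map -sumn_count -/N.
congr sumn; apply: eq_map => i /=; case: ifP => // _; by rewrite A_sym.
Qed.

Section Tested.
Variable E : seq (nat * nat).
Hypothesis AE : {in E, forall p, A p.1 p.2}.

Lemma walk_haslen k : walk N E k 0 [:: 0; 1] -> haslen e x1 x2 k.+1.
Proof.
case/(walkP A_sym AE)=> m [sm pm um mp mv].
exists (map (nth x1 vs) (rcons m 1)); last by rewrite size_map size_rcons sm.
split.
- by rewrite -[x1]/(nth x1 vs 0) path_map.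
- by rewrite map_rcons last_rcons.
- rewrite -[x1 in x1 :: _]/(nth x1 vs 0) -map_cons map_inj_in_uniq.
    have m0 i : i \in m -> i != 0 /\ i != 1.
      by move=> /mv; rewrite !inE negb_or => /andP[].
    rewrite /= mem_rcons inE rcons_uniq um /= andbT; apply/andP; split; apply/negP=> /m0[] //.
  have lN i : i \in 0 :: rcons m 1 -> i < N.
    rewrite inE mem_rcons inE => /or3P[/eqP->|/eqP->|/mp] //.
    by rewrite mem_iota; move: (isT : 1 < N); clear; lia.
  by move=> i j /lN iN /lN jN /eqP; rewrite nth_uniq // => /eqP.
Qed.

Lemma nth_eq i j : i < N -> j < N -> nth x1 vs i = nth x1 vs j -> i = j.
Proof. by move=> iN jN /eqP; rewrite nth_uniq // => /eqP. Qed.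

Lemma test_good : 3 < N -> test N E -> good e x1 x2.
Proof.
move=> N3.
have gd k l : walk N E k 0 [:: 0; 1] -> walk N E l 0 [:: 0; 1] -> k < l <= k.+2 -> good e x1 x2.
  move=> /walk_haslen h1 /walk_haslen h2 kl; apply: (good_near h1 h2); lia.
have aP i j := @adjP A A_sym E AE i j.
case/or4P=> [/andP[h2 /orP[] h]|/andP[h1 /orP[] h]|/andP[h3 h4]|/orP[]].
- exact: (gd _ _ h2 h).
- exact: (gd _ _ h2 h).
- exact: (gd _ _ h1 h).
- exact: (gd _ _ h1 h).
- exact: (gd _ _ h3 h4).
- case/hasP=> i ip /andP[/andP[/aP a1 /aP a2] /hasP[j jp /and3P[ij /aP b1 /aP b2]]].
  have E1 := common a1 a2 b1 b2.
  have := @nth_eq i j _ _ E1; move: ip jp; rewrite !mem_iota => ip jp h.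
  by have : i = j; [apply: h; move: N3 ip jp; clear; lia | move=> E2; rewrite E2 ltnn in ij].
case/hasP=> i ip /andP[/aP a1 /hasP[j jp /and4P[ij /aP a2 /aP a3 /hasP[k kp /andP[/aP b1 /aP b2]]]]].
move: ip jp; rewrite !mem_iota => ip jp.
have iN : i < N by move: N3 ip; clear; lia.
have jN : j < N by move: N3 jp; clear; lia.
have kN : k < N by move: kp N3; rewrite !inE => /orP[] /eqP->; clear; lia.
have ki : k != i by move: kp ip; rewrite !inE => /orP[] /eqP->; clear; lia.
have kj : k != j by move: kp jp; rewrite !inE => /orP[] /eqP->; clear; lia.
have k0 : (0 != k) && (k != 1) by move: kp; rewrite !inE => /orP[] /eqP->.
pose f := nth x1 vs.
have fneq a b : a < N -> b < N -> a != b -> f a != f b by move=> aN bN; rewrite nth_uniq.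
(* As soon as the known neighbours of [f v] among three candidates reach its degree, there are no
   others. *)
have nb v a b c0 w : v < N -> a < N -> b < N -> c0 < N -> uniq [:: a; b; c0] ->
    size [seq x <- [:: a; b; c0] | A v x] >= degree e (f v) -> e (f v) w ->
    w \in [:: f a; f b; f c0].
  move=> vN aN bN cN uabc sz vw; apply: contraT => wn.
  set F := [seq x <- [:: a; b; c0] | A v x] in sz.
  have FP x : x \in F -> A v x /\ x \in [:: a; b; c0].
    by rewrite /F mem_filter => /andP[].
  have FN x : x \in F -> x < N.
    by case/FP=> _; rewrite !inE => /or3P[] /eqP->.
  have um : uniq (map f F).
    rewrite map_inj_in_uniq ?filter_uniq // => p q /FN pN /FN qN; exact: nth_eq.
  have : size (w :: map f F) <= degree e (f v).
    apply: degree_uniq; last by rewrite /= vw all_map; apply/allP=> x /FP[].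
    rewrite /= um andbT; apply: contra wn => /mapP[x /FP[_ xin] ->].
    exact: (map_f f xin).
  by rewrite /= size_map ltnNge sz.
have [|||||u [v [uS vS vw uv]]] := lnk (S := [set f i; f j; f k]) (w := x1).
- by apply/subsetP=> v; rewrite !inE Wvs -orbA => /or3P[] /eqP->; apply: mem_nth.
- by apply/set0Pn; exists (f i); rewrite !inE eqxx.
- rewrite !inE -[x1]/(f 0) !negb_or !fneq //; case/andP: k0 => // k0 _; move: ip jp k0; clear; lia.
- rewrite !inE -[x2]/(f 1) !negb_or !fneq //; case/andP: k0 => // _ k0; rewrite 1?eq_sym //; move: ip jp; clear; lia.
- rewrite !inE -[x1]/(f 0) !negb_or !fneq //; case/andP: k0 => // k0 _; move: ip jp k0; clear; lia.
have Aik : A i k by rewrite A_sym.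
have Ajk : A j k by rewrite A_sym.
have Ai0 : A i 0 by rewrite A_sym.
have Aj0 : A j 0 by rewrite A_sym.
have Aji : A j i by rewrite A_sym.
have i0 : 0 != i by move: ip; clear; lia.
have j0 : 0 != j by move: jp; clear; lia.
have ij' : i != j by move: ij; clear; lia.
have N0 : 0 < N by [].
have k0' : 0 != k by case/andP: k0.
have di : degree e (f i) = 3 by rewrite deg // (_ : i < 4 = false) //; move: ip; clear; lia.
have dj : degree e (f j) = 3 by rewrite deg // (_ : j < 4 = false) //; move: jp; clear; lia.
have dk : degree e (f k) = 2.
  by rewrite deg // (_ : k < 4) //; move: kp; rewrite !inE => /orP[] /eqP->.
move: vS; rewrite !inE !negb_or -andbA => /and3P[vi vj vk].
move: uS; rewrite !inE -orbA => /or3P[] /eqP Eu; rewrite Eu in uv.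
- have := nb i 0 j k v iN N0 jN kN.
  rewrite /= !inE negb_or j0 k0' (eq_sym j) kj Ai0 a3 Aik di => /(_ isT isT uv).
  by rewrite (negPf vj) (negPf vk) orbF (negPf vw).
- have := nb j 0 i k v jN N0 iN kN.
  rewrite /= !inE negb_or i0 k0' (eq_sym i) ki Aj0 Aji Ajk dj => /(_ isT isT uv).
  by rewrite (negPf vi) (negPf vk) orbF (negPf vw).
- have := nb k 0 i j v kN N0 iN jN.
  rewrite /= !inE negb_or i0 j0 ij' b1 b2 dk.
  case: (A k 0) => /(_ isT isT uv); rewrite (negPf vi) (negPf vj) orbF (negPf vw) //.
Qed.

End Tested.

End SmallGraphs.

Section SixEight.
Variables (V : finType) (e : rel V).
Hypothesis e_sym : symmetric e.
Hypothesis e_irr : irreflexive e.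
Variables (W : {set V}) (x1 x2 y z p q : V).
Hypothesis supp : forall u v, e u v -> u \in W.
Hypothesis lnk : linked e x1 x2 W.
Hypothesis common : forall a b, e x1 a -> e x2 a -> e x1 b -> e x2 b -> a = b.
Hypothesis x12 : e x1 x2 = false.

Lemma good6 : let vs := [:: x1; x2; y; z; p; q] in uniq vs ->
  (forall v, (v \in W) = (v \in vs)) ->
  (forall i, i < size vs -> degree e (nth x1 vs i) = if i < 4 then 2 else 3) ->
  good e x1 x2.
Proof.
move=> vs uvs Wvs deg; pose A i j := e (nth x1 vs i) (nth x1 vs j).
have [||||E tE AE] := @searchP 6 A _ _ _ search6; last first.
- exact: (test_good e_sym lnk uvs Wvs deg common AE isT tE).
- by [].
- move=> v vN; have := degree_column e_sym supp uvs Wvs vN; rewrite deg //.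
  have A01 : e x1 x2 = false := x12.
  by case: v vN => [|[|[|[|[|[|v]]]]]] vN //=;
    rewrite /A /incidence /= ?A01 ?e_irr ?muln0 ?muln1 ?addn0 ?add0n => ->.
- by [].
- by [].
Qed.

Lemma good8 r t : let vs := [:: x1; x2; y; z; p; q; r; t] in uniq vs ->
  (forall v, (v \in W) = (v \in vs)) ->
  (forall i, i < size vs -> degree e (nth x1 vs i) = if i < 4 then 2 else 3) ->
  e x1 p -> e x1 q -> e x1 y = false -> e x1 z = false -> e x2 y = false -> e x2 z = false ->
  good e x1 x2.
Proof.
move=> vs uvs Wvs deg e1 e2 e3 e4 e5 e6; pose A i j := e (nth x1 vs i) (nth x1 vs j).
have As : symmetric A by move=> i j; apply: e_sym.
have [||||E tE AE] := @searchP 8 A _ _ _ search8; last first.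
- exact: (test_good e_sym lnk uvs Wvs deg common AE isT tE).
- by move=> a; rewrite !inE => /orP[] /eqP->.
- have d0 := degree_column e_sym supp uvs Wvs (isT : 0 < size vs).
  rewrite deg // /= e_irr x12 e1 e2 e3 e4 in d0.
  have e7 : e x1 r = false by move: d0; case: (e x1 r).
  have e8 : e x1 t = false by move: d0; case: (e x1 t); rewrite ?addn1 ?addnS.
  move=> v vN; have := degree_column e_sym supp uvs Wvs vN; rewrite deg //.
  by case: v vN => [|[|[|[|[|[|[|[|v]]]]]]]] vN //=;
    rewrite /A /= ?x12 ?e1 ?e2 ?e3 ?e4 ?e5 ?e6 ?e7 ?e8
      /incidence /= ?e_irr ?muln0 ?muln1 ?addn0 ?add0n /=;
    try by [move=> -> | case=> ->].
- by [].
- by [].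
Qed.

End SixEight.

(** * Cycles separating the exceptional vertices from the roots *)

Section Connections.
Variables (V : finType) (e : rel V).
Hypothesis e_sym : symmetric e.
Implicit Types (D S : {set V}) (c s : seq V).

Lemma path_connected s a u v : path e a s -> u \in s -> v \in s ->
  v \in component e [set w in s] u.
Proof.
case: s => // h t /= /andP[_ pt] uin vin.
have sD : {subset h :: t <= [set w in h :: t]} by move=> w; rewrite in_set.
have sC := path_component pt sD.
apply: component_trans (sC _ vin); apply: component_sym => //; last exact: sC.
by rewrite in_set mem_head.
Qed.

Lemma cycle_connected c u v : iscyc e c -> u \in c -> v \in c -> v \in component e [set w in c] u.
Proof.
case/and3P=> _ cc uc uin vin; have [i s E] := rot_to uin.
have mem w : (w \in c) = (w \in u :: s) by rewrite -E mem_rot.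
have := cc; rewrite -(rot_cycle i) E /= rcons_path => /andP[ps _].
have := path_component (D := [set w in c]) ps.
apply; last by rewrite -mem.
by move=> w; rewrite in_set mem.
Qed.

Lemma reach_component x1 x2 c D u v : avoids x1 x2 c -> u \in D ->
  {in D, forall w, w \notin c} -> u \in reach e c x1 x2 -> v \in component e D u ->
  v \in reach e c x1 x2.
Proof.
move=> ac uD Dc uR vC; have [p [pp <- _ sp]] := component_path uD vC.
apply: reach_closed_path => // w wp; apply/Dc/sp; by rewrite inE wp orbT.
Qed.

End Connections.

Section TwoExceptions.
Variables (V : finType) (e : rel V).
Hypothesis e_sym : symmetric e.
Hypothesis e_irr : irreflexive e.
Variables (W : {set V}) (x1 x2 y z : V).
Implicit Types (D S : {set V}) (c s : seq V).
Hypothesis supp : forall u v, e u v -> u \in W.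
Hypothesis lnk : linked e x1 x2 W.
Hypothesis un : uniq [:: x1; x2; y; z].
Hypothesis inW : {subset [:: x1; x2; y; z] <= W}.
Hypothesis deg2 : forall v, v \in [:: x1; x2; y; z] -> degree e v = 2.
Hypothesis deg3 : forall v, v \in W -> v \notin [:: x1; x2; y; z] -> degree e v = 3.
Hypothesis stucky : forall c, avoids x1 x2 c -> iscyc e c -> y \notin reach e c x1 x2.
Hypothesis stuckz : forall c, avoids x1 x2 c -> iscyc e c -> z \notin reach e c x1 x2.

Let deg_le3 v : v \in W -> degree e v <= 3.
Proof.
by move=> vW; have [h|h] := boolP (v \in [:: x1; x2; y; z]); [rewrite (deg2 h) | rewrite (deg3 vW h)].
Qed.

Let x1W : x1 \in W. Proof. by apply: inW; rewrite !inE eqxx. Qed.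
Let x2W : x2 \in W. Proof. by apply: inW; rewrite !inE eqxx ?orbT. Qed.
Let yW : y \in W. Proof. by apply: inW; rewrite !inE eqxx ?orbT. Qed.
Let zW : z \in W. Proof. by apply: inW; rewrite !inE eqxx ?orbT. Qed.

Lemma distinct : [/\ x1 != x2, x1 != y, x1 != z, x2 != y & x2 != z] /\ y != z.
Proof. by move: (un); rewrite /= !inE !negb_or => /and4P[/and3P[-> -> ->] /andP[-> ->] -> _]. Qed.

Lemma two_exits v : degree e v = 2 ->
  exists a b, [/\ a != b, e v a, e v b & forall w, e v w -> w = a \/ w = b].
Proof.
move=> d; have /cards2P[a [b [ab E]]] : #|[set w | e v w]| == 2 by rewrite -/(degree e v) d.
have h w : e v w = (w \in [set a; b]) by rewrite -E in_set.
by exists a, b; split; rewrite ?h ?in_set2 ?eqxx ?orbT // => w; rewrite h in_set2 => /orP[] /eqP; [left|right].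
Qed.

Section Maximal.
Variable c : seq V.
Hypotheses (ac : avoids x1 x2 c) (cc : iscyc e c) (yc : y \notin c).
Hypothesis maxc : ~ growable e x1 x2 [set y] c.

Let K a := component e (offc c [set y]) a.

Let cW v : v \in c -> v \in W. Proof. exact: (cyc_in_W supp cc). Qed.

Let dc : {in c, forall v, degree e v <= 3}.
Proof. by move=> v /cW /deg_le3. Qed.

Let Sc : {in [set y], forall v, v \notin c}.
Proof. by move=> v; rewrite in_set1 => /eqP->. Qed.

Let c_ne v : v \in c -> [/\ v != x1, v != x2 & v != y].
Proof.
move=> vc; split; [|  | by apply: contraNneq yc => <-].
  by apply: contraTneq vc => ->; case/andP: ac.
by apply: contraTneq vc => ->; case/andP: ac.
Qed.

Let offP a : a \notin c -> a != y -> a \in offc c [set y].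
Proof. by move=> ? ?; rewrite in_offc in_set1; apply/andP. Qed.

Let K_off a v : a \notin c -> a != y -> v \in K a -> (v \notin c) && (v != y).
Proof.
by move=> h1 h2 /(subsetP (component_sub e (offP h1 h2))); rewrite in_offc in_set1.
Qed.

Let K_exit a u v : a \notin c -> a != y -> u \in K a -> v \notin K a -> e u v -> v = y \/ v \in c.
Proof.
move=> h1 h2 uK vK uv; have [vc|vc] := boolP (v \in c); [by right|left].
apply/eqP; apply: contraT => vy; case/negP: vK.
exact: component_closed (offP h1 h2) uK (offP vc vy) uv.
Qed.

(** Two attachments on [c] would give an ear through [K a], which misses [y], and [c] would be
    growable. *)
Lemma one_attachment a k k' b b' : a \notin c -> a != y -> a \notin reach e c x1 x2 ->
  k \in K a -> k' \in K a -> b \in c -> b' \in c -> e k b -> e k' b' -> b = b'.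
Proof.
move=> h1 h2 aR kK kK' bc bc' kb kb'; apply/eqP; apply: contraT => bb.
case: maxc; have aD := offP h1 h2.
have nR := component_notreach e_sym ac aD aR.
apply: (growable_ear e_sym supp lnk ac cc dc Sc bc' (u := k') (k := k) (b := b)) => //.
- by rewrite e_sym.
- exact: (subsetP (component_sub e aD)).
- exact: nR.
- by apply: component_trans kK; apply: component_sym.
Qed.

Lemma K_linked a w : a \in W -> a \notin c -> a != y -> a \notin reach e c x1 x2 -> w \notin K a ->
  exists k v, [/\ k \in K a, v \notin K a, v != w & e k v].
Proof.
move=> aW h1 h2 aR wK; have aD := offP h1 h2; have nR := component_notreach e_sym ac aD aR.
apply: lnk => //.
- exact: (component_supp e_sym supp).
- by apply/set0Pn; exists a; apply: component_refl.
- by apply/negP=> /nR; rewrite reach1.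
- by apply/negP=> /nR; rewrite reach2.
Qed.

Lemma y_neighbour_notreach a : e y a -> a \notin reach e c x1 x2.
Proof.
move=> ya; apply: contra (stucky ac cc) => aR.
by apply: reach_closed aR yc _ => //; rewrite e_sym.
Qed.

(** Suppose not. Then [K a] is joined to the rest only by the edge to [y] and an edge to one vertex
    [b] of [c], and so contains a cycle [c']. Off [c'] all of [c] is reachable, hence so is the
    other neighbour [a'] of [y], and then [y] itself, against [stucky]. *)
Lemma y_neighbour a : e y a -> a \in c \/ a = z.
Proof.
move=> ya; have [h1|h1] := boolP (a \in c); [by left|right].
apply/eqP; apply: contraT => az.
have aW : a \in W by apply: supp; rewrite e_sym; apply: ya.
have ay : a != y by rewrite eq_sym; apply: edge_neq ya.
have aR := y_neighbour_notreach ya.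
have aD := offP h1 ay.
have nR := component_notreach e_sym ac aD aR.
have [a' [a'a ya' ysub]] : exists a', [/\ a' != a, e y a' & forall w, e y w -> w = a \/ w = a'].
  have [|p [q [pq yp yq ys]]] := @two_exits y; first by apply: deg2; rewrite !inE eqxx ?orbT.
  case: (ys a ya) => E; subst a.
    by exists q; split=> //; rewrite eq_sym.
  by exists p; split=> // w /ys[]; [right|left].
have yK : y \notin K a by apply/negP=> /(K_off h1 ay); rewrite eqxx andbF.
have [k [b [kK bK by_ kb]]] := K_linked aW h1 ay aR yK.
have bc : b \in c by case: (K_exit h1 ay kK bK kb) => // E; rewrite E eqxx in by_.
have onlyb u v : u \in K a -> v \notin K a -> v != y -> e u v -> v = b.
  move=> uK vK vy uv; case: (K_exit h1 ay uK vK uv) => [E|vc]; first by rewrite E eqxx in vy.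
  exact: (one_attachment h1 ay aR uK kK vc bc uv kb).
have a'K : a' \notin K a.
  apply/negP=> a'K; have [|||||u [v [+ + vb uv]]] := lnk (S := y |: K a) (w := b).
  - by rewrite subUset sub1set yW (component_supp e_sym supp).
  - by apply/set0Pn; exists y; rewrite setU11.
  - have [[_ h _ _ _] _] := distinct; rewrite in_setU1 negb_or h; apply/negP=> /nR; by rewrite reach1.
  - have [[_ _ _ h _] _] := distinct; rewrite in_setU1 negb_or h; apply/negP=> /nR; by rewrite reach2.
  - by rewrite in_setU1 negb_or bK by_.
  rewrite !in_setU1 negb_or => /orP[/eqP E|uK] /andP[vy vK].
    rewrite E in uv; case: (ysub v uv) => E'; rewrite E' in vK; last by rewrite a'K in vK.
    by rewrite component_refl in vK.
  by rewrite (onlyb u v uK vK vy uv) eqxx in vb.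
have Ky v : v \in K a -> e v y -> v = a.
  by move=> vK; rewrite e_sym => /ysub[//|E]; rewrite E (negPf a'K) in vK.
have Kb v v' : v \in K a -> v' \in K a -> e v b -> e v' b -> v = v'.
  move=> vK vK' vb vb'; apply/eqP; apply: contraT => vv.
  have : size [:: v; v'; next c b; prev c b] <= degree e b.
    have vc u : u \in K a -> u \notin c by move=> /(K_off h1 ay)/andP[].
    apply: degree_uniq; last first.
      by rewrite /= !(e_sym b) vb vb' !(e_sym _ b) cyc_next // cyc_prev.
    have nn u : u \in K a -> (u != next c b) && (u != prev c b).
      by move=> /vc; rewrite -negb_or; apply: contra => /orP[] /eqP->; rewrite ?mem_next ?mem_prev.
    by rewrite /= !inE !negb_or vv (next_neq_prev cc bc) !nn.
  by rewrite leqNgt ltnS dc.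
have KW v : v \in K a -> v \in W by apply: subsetP; apply: (component_supp e_sym supp).
have K3 v : v \in K a -> v != z -> degree e v = 3.
  move=> vK vz; apply: deg3; first exact: KW.
  rewrite !inE !negb_or vz andbT; apply/and3P; split.
  - by apply: contraTneq vK => ->; apply/negP=> /nR; rewrite reach1.
  - by apply: contraTneq vK => ->; apply/negP=> /nR; rewrite reach2.
  - by case/andP: (K_off h1 ay vK).
have stay u v : u \in K a -> e u v -> v != y -> v != b -> v \in K a.
  by move=> uK uv vy vb; apply: contraT => vK; rewrite (onlyb u v uK vK vy uv) eqxx in vb.
have aK : a \in K a := component_refl _ _ _.
have [c' cc' c'K] : exists2 c', iscyc e c' & {subset c' <= K a}.
  (* If [a] carries both exits, all other vertices keep their full degree, at least 2, inside [K a].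
     If not, every vertex loses at most one edge and [z] is the one left without a requirement. *)
  have [ab|nab] := boolP (e a b).
    have [|u0 [au0 u0y u0b]] := @third_neighbour _ e y b a; first by rewrite K3.
    have u0K := stay a u0 aK au0 u0y u0b.
    have u0a : u0 != a by rewrite eq_sym; apply: edge_neq au0.
    apply: (cycle_of_degrees e_sym e_irr u0K u0a) => v vK va.
    have vy : ~~ e v y by apply: contraNN va => vy; rewrite (Ky v vK vy).
    have vb : ~~ e v b by apply: contraNN va => vb; rewrite (Kb v a vK aK vb ab).
    have : 1 < degree e v.
      have [->|vz] := eqVneq v z; last by rewrite K3.
      by rewrite deg2 // !inE eqxx ?orbT.
    rewrite /degree => /card_gt1P[p [q [+ + pq]]]; rewrite !in_set => vp vq.
    exists p, q; split=> //; apply: (stay v) => //.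
    + by apply: contraTneq vp => ->.
    + by apply: contraTneq vp => ->.
    + by apply: contraTneq vq => ->.
    + by apply: contraTneq vq => ->.
  apply: (cycle_of_degrees (z := z) e_sym e_irr aK az) => v vK vz.
  have [||p [q [pq vp vq]]] := @two_neighbours _ e v [set y; b].
  - by rewrite K3.
  - move=> p q vp vq; rewrite !in_set2.
    case/orP=> /eqP Ep; case/orP=> /eqP Eq; subst p q => //.
      by case/negP: nab; rewrite -(Ky v vK vp).
    by case/negP: nab; rewrite -(Ky v vK vq).
  rewrite !in_set2 !negb_or => /andP[py pb] /andP[qy qb].
  by exists p, q; split=> //; apply: (stay v).
have ac' : avoids x1 x2 c'.
  by apply/andP; split; apply/negP=> /c'K/nR; rewrite ?reach1 ?reach2.
have sub : reach e c x1 x2 \subset reach e c' x1 x2.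
  by apply: reach_mono => // v vR; apply: contraL vR => /c'K/nR.
have cc'dis v : v \in c -> v \notin c'.
  by move=> vc; apply/negP=> /c'K/(K_off h1 ay); rewrite vc.
have cR v : v \in c -> v \in reach e c' x1 x2.
  have [w [u [wc uR wu]]] := reach_attach e_sym supp lnk ac cc.
  have wR : w \in reach e c' x1 x2.
    by apply: reach_closed (subsetP sub _ uR) (cc'dis _ wc) _ => //; rewrite e_sym.
  move=> vc; apply: (reach_component (D := [set t in c]) ac' _ _ wR (cycle_connected cc wc vc)).
    by rewrite in_set.
  by move=> t; rewrite in_set; apply: cc'dis.
(* Off [c], the component [K a'] still has an edge to [c] by [linked], since [y] does not cut it
   off. *)
have a'R : a' \in reach e c' x1 x2.
  have [/cR//|a'c] := boolP (a' \in c).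
  have a'y : a' != y by rewrite eq_sym; apply: edge_neq ya'.
  have a'W : a' \in W by apply: supp; rewrite e_sym; apply: ya'.
  have a'D := offP a'c a'y.
  have yK' : y \notin K a' by apply/negP=> /(K_off a'c a'y); rewrite eqxx andbF.
  have [k' [b' [kK' bK' by' kb']]] := K_linked a'W a'c a'y (y_neighbour_notreach ya') yK'.
  have bc' : b' \in c by case: (K_exit a'c a'y kK' bK' kb') => // E; rewrite E eqxx in by'.
  have dis v : v \in K a' -> v \notin c'.
    move=> vK'; apply/negP=> /c'K vK; case/negP: a'K.
    by apply: component_trans vK _; apply: component_sym.
  have kR : k' \in reach e c' x1 x2.
    by apply: reach_closed (cR _ bc') (dis _ kK') _ => //; rewrite e_sym.
  apply: (reach_component (D := K a') ac' kK' dis kR).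
  have := rooted_sub_component e_sym (component_rooted e_sym a'D) (subxx _) kK'.
  by move=> /subsetP; apply; apply: component_refl.
have yc' : y \notin c' by apply/negP=> /c'K; apply/negP.
by have := stucky ac' cc'; rewrite (reach_closed ac' a'R yc') // e_sym.
Qed.

Section NoEdge.
Variables a1 a2 : V.
Hypotheses (ya1 : e y a1) (ya2 : e y a2) (a1c : a1 \in c) (a2c : a2 \in c).
Hypothesis ysub : forall w, e y w -> w = a1 \/ w = a2.

Let y_to_c k : e y k -> k \in c.
Proof. by case/ysub=> ->. Qed.

(** The analogue of [settled] for cycles maximal among those missing [y]. As both neighbours of [y]
    lie on [c], no component off [c] can exit through [y]. *)
Lemma cycle_neighbour w u : w \in c -> e w u -> u != next c w -> u != prev c w -> u != y ->
  u \in reach e c x1 x2.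
Proof.
move=> wc wu un' up uy; apply: contraT => uR; case: maxc.
have [uc|uc] := boolP (u \in c).
  exact: (growable_chord e_sym e_irr supp lnk ac cc dc Sc wc uc wu un' up).
have uW : u \in W by apply: supp; rewrite e_sym; apply: wu.
have wK : w \notin K u by apply/negP=> /(K_off uc uy); rewrite wc.
have [k [v [kK vK vw kv]]] := K_linked uW uc uy uR wK.
have vc : v \in c.
  case: (K_exit uc uy kK vK kv) => // E; rewrite E e_sym in kv.
  by have := K_off uc uy kK; rewrite (y_to_c kv).
exact: (growable_ear e_sym supp lnk ac cc dc Sc wc wu (offP uc uy) uR kK vc vw kv).
Qed.

(** Off [c], the component of [z] would have exits to two vertices of [c], against
    [one_attachment]. *)
Lemma z_in_cycle : z \in c.
Proof.
apply: contraT => zc; have [_ yz] := distinct; have zy : z != y by rewrite eq_sym.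
have zR := stuckz ac cc.
have nR := component_notreach e_sym ac (offP zc zy) zR.
have ex w : w \notin K z -> exists k b, [/\ k \in K z, b \in c, b != w & e k b].
  move=> wK; have [k [v [kK vK vw kv]]] := K_linked zW zc zy zR wK.
  exists k, v; split=> //; case: (K_exit zc zy kK vK kv) => // E; rewrite E e_sym in kv.
  by have := K_off zc zy kK; rewrite (y_to_c kv).
have [|k [b [kK bc _ kb]]] := ex x1; first by apply/negP=> /nR; rewrite reach1.
have [|k' [b' [kK' bc' bb kb']]] := ex b; first by apply/negP=> /(K_off zc zy); rewrite bc.
by rewrite (one_attachment zc zy zR kK kK' bc bc' kb kb') eqxx in bb.
Qed.

Lemma cycle_y_neighbour_ne_z a : a \in c -> e y a -> a != z.
Proof.
move=> ain ya; apply/eqP=> E; have dz : degree e z = 2 by rewrite deg2 // !inE eqxx ?orbT.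
have : size [:: y; next c a; prev c a] <= degree e a.
  apply: degree_uniq; last by rewrite /= e_sym ya cyc_next // cyc_prev.
  rewrite /= !inE !negb_or (next_neq_prev cc ain) !andbT.
  by apply/andP; split; apply: contraNneq yc => ->; rewrite ?mem_next ?mem_prev.
by rewrite E dz.
Qed.

(** Replace the arc [s1] by [y]. A vertex of [s1] other than [z] has its third edge into the
    reachable part, so the whole arc, and [z] with it, would be reachable off the new cycle, against
    [stuckz]. *)
Lemma twin_arc a b s1 s2 : (forall v, (v \in c) = (v \in a :: s1 ++ b :: s2)) ->
  iscyc e (a :: s1 ++ b :: s2) -> e y a -> e y b -> z \in s1 -> s1 = [:: z].
Proof.
move=> mem cc1 ya yb zs.
pose c2 := b :: s2 ++ a :: rev [:: y].
have cc2 : iscyc e c2.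
  apply: (@ear_seq _ e e_sym b s2 a s1 [:: y]) => //.
  - by rewrite -(iscyc_rot e (size (a :: s1))) -cat_cons rot_size_cat in cc1.
  - by rewrite /= e_sym yb ya.
  - move=> v; rewrite mem_seq1 => /eqP->; apply: contra yc; rewrite mem -!cat_cons !mem_cat.
    by rewrite orbC.
have c2mem v : v \in c2 -> v \in c \/ v = y.
  rewrite /c2 mem !inE !mem_cat !inE.
  by case/or4P=> [->|->|->|/eqP->]; rewrite ?orbT; [left|left|left|right].
have dis v : v \in reach e c x1 x2 -> v \notin c2.
  move=> vR; apply/negP=> /c2mem[vc|E]; first by have := reach_notin ac vR; rewrite vc.
  by have := stucky ac cc; rewrite -E vR.
have ac2 : avoids x1 x2 c2 by rewrite /avoids !dis ?reach1 ?reach2.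
have sub := reach_mono e_sym ac ac2 dis.
have un1 : uniq (a :: s1 ++ b :: s2) by case/and3P: cc1.
have s1c2 v : v \in s1 -> v \notin c2.
  move=> vs; have vy : v != y by apply: contraNneq yc => <-; rewrite mem inE mem_cat vs orbT.
  rewrite /c2 !inE mem_cat !inE (negPf vy) orbF !negb_or.
  move: un1; rewrite /= cat_uniq mem_cat negb_or /= => /andP[/andP[as1 _]].
  case/and3P=> _ /norP[bs1 /hasPn ns2] _.
  apply/and3P; split; first by apply: contraNneq bs1 => <-.
  - by apply: contraL vs; apply: ns2.
  - by apply: contraNneq as1 => <-.
have ps : path e a s1.
  by case/and3P: cc1 => _ + _; rewrite /= rcons_cat cat_path => /andP[].
have allz w : w \in s1 -> w = z.
  move=> ws; apply/eqP; apply: contraT => wz.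
  have wc : w \in c by rewrite mem inE mem_cat ws orbT.
  have [w1 w2 wy] := c_ne wc.
  have dw : degree e w = 3 by apply: deg3; [exact: cW | rewrite !inE !negb_or w1 w2 wy wz].
  have [|u [wu un' up]] := @third_neighbour _ e (next c w) (prev c w) w; first by rewrite dw.
  have uy : u != y.
    apply: contraTneq wu => ->; rewrite e_sym; apply/negP=> yw.
    have := s1c2 w ws; rewrite /c2 !inE mem_cat !inE !negb_or => /and3P[wb _ /andP[wa _]].
    have ab : a != b.
      by move: un1; rewrite /= mem_cat inE !negb_or => /andP[/and3P[]].
    have [E|E] : w = a \/ w = b; [|by rewrite E eqxx in wa|by rewrite E eqxx in wb].
    case: (ysub yw) => Ew; case: (ysub ya) => Ea; case: (ysub yb) => Eb; rewrite Ew Ea Eb; auto;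
      by rewrite Ea Eb eqxx in ab.
  have uR := cycle_neighbour wc wu un' up uy.
  have wR : w \in reach e c2 x1 x2.
    by apply: reach_closed ac2 (subsetP sub _ uR) (s1c2 w ws) _; rewrite e_sym.
  have : z \in reach e c2 x1 x2.
    apply: (reach_component (D := [set t in s1]) ac2 _ _ wR (path_connected e_sym ps ws zs)).
      by rewrite in_set.
    by move=> t; rewrite in_set; apply: s1c2.
  by have := stuckz ac2 cc2 => /negP.
case: s1 zs allz un1 {mem cc1 cc2 c2mem dis ac2 sub s1c2 ps c2} => // h t _ allz.
rewrite (allz h (mem_head _ _)); case: t allz => // h' t allz.
by rewrite (allz h') ?inE ?eqxx ?orbT //= !inE eqxx !andbF.
Qed.

Lemma twins : a1 != a2 -> e z a1 /\ e z a2.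
Proof.
move=> a12; have [i s E] := rot_to a1c.
have mem v : (v \in c) = (v \in a1 :: s) by rewrite -E mem_rot.
have a2s : a2 \in s by have := a2c; rewrite mem inE eq_sym (negPf a12).
have cc1 : iscyc e (a1 :: s) by rewrite -E iscyc_rot.
case/splitPr: s / a2s mem cc1 {E} => s1 s2 mem cc1.
have ends a b t1 t2 : iscyc e (a :: t1 ++ b :: t2) -> t1 = [:: z] -> e z a /\ e z b.
  by move=> /and3P[_ + _] E; rewrite E /= => /and3P[az zb _]; rewrite e_sym.
have := z_in_cycle; rewrite mem inE mem_cat inE.
rewrite !(eq_sym z) (negPf (cycle_y_neighbour_ne_z a1c ya1)) (negPf (cycle_y_neighbour_ne_z a2c ya2)) /=.
case/orP=> zs; first exact: ends cc1 (twin_arc mem cc1 ya1 ya2 zs).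
have cc2 : iscyc e (a2 :: s2 ++ a1 :: s1).
  by rewrite -(iscyc_rot e (size (a1 :: s1))) -cat_cons rot_size_cat in cc1.
have mem2 v : (v \in c) = (v \in a2 :: s2 ++ a1 :: s1).
  by rewrite mem -!cat_cons !mem_cat orbC.
by have [] := ends _ _ _ _ cc2 (twin_arc mem2 cc2 ya2 ya1 zs).
Qed.

End NoEdge.

Lemma rung_or_twins : e y z \/ exists a b, [/\ a != b, e y a /\ e y b, e z a /\ e z b,
  (a \in c) && (b \in c) & forall w, e y w -> w = a \/ w = b].
Proof.
have [yz|yz] := boolP (e y z); [by left|right].
have [|a [b [ab ya yb ysub]]] := @two_exits y; first by apply: deg2; rewrite !inE eqxx ?orbT.
have ain : a \in c by case: (y_neighbour ya) => // E; rewrite E (negPf yz) in ya.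
have bin : b \in c by case: (y_neighbour yb) => // E; rewrite E (negPf yz) in yb.
by exists a, b; split=> //; [apply: twins | rewrite ain].
Qed.

End Maximal.
End TwoExceptions.

(** * Deleting the exceptional vertices *)

(** The condition on 4-cycles appears as uniqueness of a common neighbour of the roots, which passes
    to subgraphs. *)
Definition two_exceptions_below (V : finType) (k : nat) : Prop :=
  forall (e : rel V) (W : {set V}) (x1 x2 y z : V), #|W| < k ->
  symmetric e -> irreflexive e -> (forall u v, e u v -> u \in W) ->
  linked e x1 x2 W -> uniq [:: x1; x2; y; z] -> {subset [:: x1; x2; y; z] <= W} ->
  (forall v, v \in [:: x1; x2; y; z] -> degree e v = 2) ->
  (forall v, v \in W -> v \notin [:: x1; x2; y; z] -> degree e v = 3) ->
  e x1 x2 = false ->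
  (forall a b, e x1 a -> e x2 a -> e x1 b -> e x2 b -> a = b) -> good e x1 x2.

Lemma good_sub (V : finType) (e e' : rel V) x1 x2 : subrel e' e -> good e' x1 x2 -> good e x1 x2.
Proof.
move=> sub; have h l : haslen e' x1 x2 l -> haslen e x1 x2 l.
  by case=> p [pp lp up] sp; exists p => //; split=> //; apply: sub_path pp.
by case=> l [h1 [] h2]; exists l; split; [exact: h|left; exact: h|exact: h|right; exact: h].
Qed.

Section Deletion.
Variables (V : finType) (e : rel V).
Hypothesis e_sym : symmetric e.
Hypothesis e_irr : irreflexive e.
Variables (W : {set V}) (x1 x2 y z : V).
Implicit Types (D S : {set V}) (c s : seq V).
Hypothesis supp : forall u v, e u v -> u \in W.
Hypothesis lnk : linked e x1 x2 W.
Hypothesis un : uniq [:: x1; x2; y; z].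
Hypothesis inW : {subset [:: x1; x2; y; z] <= W}.
Hypothesis deg2 : forall v, v \in [:: x1; x2; y; z] -> degree e v = 2.
Hypothesis deg3 : forall v, v \in W -> v \notin [:: x1; x2; y; z] -> degree e v = 3.
Hypothesis x12 : e x1 x2 = false.
Hypothesis common : forall a b, e x1 a -> e x2 a -> e x1 b -> e x2 b -> a = b.
Hypothesis stucky : forall c, avoids x1 x2 c -> iscyc e c -> y \notin reach e c x1 x2.
Hypothesis IH : two_exceptions_below V #|W|.

Variable G : {set V}.
Hypothesis GW : G \subset W.
Hypotheses (yG : y \in G) (zG : z \in G) (x1G : x1 \notin G) (x2G : x2 \notin G).
Hypothesis rG : rooted e G y.

Section Exits.
Variables (g1 g2 d1 d2 : V).
Hypotheses (gd1 : e g1 d1) (gd2 : e g2 d2).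
Hypotheses (g1G : g1 \in G) (g2G : g2 \in G) (d1G : d1 \notin G) (d2G : d2 \notin G).
Hypotheses (d12 : d1 != d2) (d2x1 : d2 != x1) (d2x2 : d2 != x2).
Hypothesis exits : forall u v, u \in G -> v \notin G -> e u v ->
  (u = g1 /\ v = d1) \/ (u = g2 /\ v = d2).

Let x1W : x1 \in W. Proof. by apply: inW; rewrite !inE eqxx. Qed.
Let x2W : x2 \in W. Proof. by apply: inW; rewrite !inE eqxx ?orbT. Qed.

(* If [S] were cut off by [w], it would contain a cycle, missed by a path
   leaving [G] through [d1]. *)
Lemma one_side S w : S \subset W :\: G -> d2 \in S -> d1 \notin S -> x1 \notin S -> x2 \notin S ->
  w \notin S -> (forall u v, u \in S -> v \notin S -> v \notin G -> e u v -> v = w) -> False.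
Proof.
move=> sS d2S d1S x1S x2S wS ex.
have SW : S \subset W := subset_trans sS (subsetDl _ _).
have SG u : u \in S -> u \notin G by move=> /(subsetP sS); rewrite in_setD => /andP[].
have S3 u : u \in S -> degree e u = 3.
  move=> uS; apply: deg3; first exact: (subsetP SW).
  rewrite !inE !negb_or; apply/and4P; split.
  - by apply: contraNneq x1S => <-.
  - by apply: contraNneq x2S => <-.
  - by apply: contraTneq yG => <-; apply: SG.
  - by apply: contraTneq zG => <-; apply: SG.
have toG u v : u \in S -> v \in G -> e u v -> u = d2 /\ v = g2.
  move=> uS vG uv; rewrite e_sym in uv; case: (exits vG (SG u uS) uv) => [[_ E]|[-> ->]] //.
  by rewrite -E uS in d1S.
have [c cc cS] : exists2 c, iscyc e c & {subset c <= S}.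
  have [|u0 [du ug uw]] := @third_neighbour _ e g2 w d2; first by rewrite S3.
  have u0S : u0 \in S.
    have [//|u0S] := boolP (u0 \in S); have [u0G|u0G] := boolP (u0 \in G).
      by have [_ E] := toG d2 u0 d2S u0G du; rewrite E eqxx in ug.
    by rewrite (ex d2 u0 d2S u0S u0G du) eqxx in uw.
  have u0d : u0 != d2 by rewrite eq_sym; apply: edge_neq du.
  apply: (cycle_of_degrees e_sym e_irr u0S u0d) => v vS vd.
  have [||p [q [pq vp vq pw qw]]] := @two_neighbours _ e v [set w].
  - by rewrite S3.
  - by move=> a b _ _; rewrite !in_set1 => /eqP-> /eqP->.
  rewrite in_set1 in pw; rewrite in_set1 in qw.
  have inS t : e v t -> t != w -> t \in S.
    move=> vt tw; apply: contraT => tS; have [tG|tG] := boolP (t \in G).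
      by have [E _] := toG v t vS tG vt; rewrite E eqxx in vd.
    by rewrite (ex v t vS tS tG vt) eqxx in tw.
  by exists p, q; split=> //; apply: inS.
have ac : avoids x1 x2 c by apply/andP; split; apply/negP=> /cS; apply/negP.
(* [T] misses [c], so a root in [T] would make [y] reachable. Hence [S :|: T], which contains [G],
   has no exit but [w]. *)
pose T := component e (~: S) y.
have yS : y \in ~: S by rewrite in_setC; apply: contraL yG => /SG.
have GT : G \subset T.
  apply: (rooted_sub_component e_sym rG) => //.
  by apply/subsetP=> v vG; rewrite in_setC; apply: contraL vG => /SG.
have noT x : x \in T -> x \in reach e c x1 x2 -> False.
  move=> xT xR; have := stucky ac cc; apply/negP; rewrite negbK.
  apply: (reach_component (D := ~: S) ac (subsetP (component_sub e yS) _ xT) _ xR).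
    by move=> t; rewrite in_setC; apply: contra => /cS.
  exact: component_sym.
have x1T : x1 \notin T by apply/negP=> h; apply: (noT x1 h); apply: reach1.
have x2T : x2 \notin T by apply/negP=> h; apply: (noT x2 h); apply: reach2.
(* If [w] lies in [T] there is nothing to avoid, and [x1] is a placeholder outside the set. *)
pose w0 := if w \in T then x1 else w.
have [|||||u [v [+ + vw uv]]] := lnk (S := S :|: T) (w := w0).
- rewrite subUset SW (component_supp e_sym supp) //; exact: (subsetP GW).
- by apply/set0Pn; exists d2; rewrite in_setU d2S.
- by rewrite in_setU negb_or x1S.
- by rewrite in_setU negb_or x2S.
- by rewrite /w0 in_setU negb_or; case: ifP => [_|->]; [rewrite x1S | rewrite wS].
rewrite !in_setU negb_or => /orP[uS|uT] /andP[vS vT].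
  have vG : v \notin G by apply: contra vT; apply: (subsetP GT).
  have E := ex u v uS vS vG uv.
  by move: vw; rewrite /w0 -E (negPf vT) eqxx.
case/negP: vT; apply: (component_closed yS uT _ uv); by rewrite in_setC.
Qed.

End Exits.

Variables (g1 g2 d1 d2 : V).
Hypotheses (gd1 : e g1 d1) (gd2 : e g2 d2).
Hypotheses (g1G : g1 \in G) (g2G : g2 \in G) (d1G : d1 \notin G) (d2G : d2 \notin G).
Hypotheses (d12 : d1 != d2) (d1x1 : d1 != x1) (d1x2 : d1 != x2) (d2x1 : d2 != x1) (d2x2 : d2 != x2).
Hypothesis exits : forall u v, u \in G -> v \notin G -> e u v ->
  (u = g1 /\ v = d1) \/ (u = g2 /\ v = d2).

Definition delete : rel V := [rel u v | [&& u \notin G, v \notin G & e u v]].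

Let x1W : x1 \in W. Proof. by apply: inW; rewrite !inE eqxx. Qed.
Let x2W : x2 \in W. Proof. by apply: inW; rewrite !inE eqxx ?orbT. Qed.

(** A set containing both ends [d1] and [d2] is completed by [G], one containing neither is a cut of
    [e] already, and [one_side] excludes the mixed case. *)
Lemma delete_linked : linked delete x1 x2 (W :\: G).
Proof.
move=> S w sS S0 x1S x2S wS; apply: NNPP => nex.
have SW : S \subset W := subset_trans sS (subsetDl _ _).
have SG u : u \in S -> u \notin G by move=> /(subsetP sS); rewrite in_setD => /andP[].
have ex u v : u \in S -> v \notin S -> v \notin G -> e u v -> v = w.
  move=> uS vS vG uv; apply/eqP; apply: contraT => vw; case: nex; exists u, v.
  by split=> //; rewrite /delete /= SG // vG.
have exits' u v : u \in G -> v \notin G -> e u v -> (u = g2 /\ v = d2) \/ (u = g1 /\ v = d1).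
  by move=> h1 h2 h3; case: (exits h1 h2 h3); [right|left].
have [d1S|d1S] := boolP (d1 \in S); have [d2S|d2S] := boolP (d2 \in S).
- pose w0 := if w \in G then x1 else w.
  have [|||||u [v [+ + vw uv]]] := lnk (S := S :|: G) (w := w0).
  + by rewrite subUset SW.
  + by apply/set0Pn; exists d1; rewrite in_setU d1S.
  + by rewrite in_setU negb_or x1S.
  + by rewrite in_setU negb_or x2S.
  + by rewrite /w0 in_setU negb_or; case: ifP => [_|->]; [rewrite x1S | rewrite wS].
  rewrite !in_setU negb_or => /orP[uS|uG] /andP[vS vG].
    by move: vw; rewrite /w0 -(ex u v uS vS vG uv) (negPf vG) eqxx.
  by case: (exits uG vG uv) => [[_ E]|[_ E]]; rewrite E ?d1S ?d2S in vS.
- by apply: (@one_side g2 g1 d2 d1 exits' S w).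
- by apply: (@one_side g1 g2 d1 d2 exits S w).
have [|||||u [v [uS vS vw uv]]] := lnk (S := S) (w := w) => //.
have [vG|vG] := boolP (v \in G); last by rewrite (ex u v uS vS vG uv) eqxx in vw.
rewrite e_sym in uv; case: (exits vG (SG u uS) uv) => [[_ E]|[_ E]].
  by rewrite -E uS in d1S.
by rewrite -E uS in d2S.
Qed.

Lemma good_delete : good e x1 x2.
Proof.
have sub : subrel delete e by move=> u v /and3P[].
have d1W : d1 \in W by apply: supp; rewrite e_sym; apply: gd1.
have d2W : d2 \in W by apply: supp; rewrite e_sym; apply: gd2.
have notG4 v : v \in W -> v \notin G -> v != x1 -> v != x2 -> degree e v = 3.
  move=> vW vG v1 v2; apply: deg3 => //; rewrite !inE !negb_or v1 v2 /=.
  by apply/andP; split; [apply: contraNneq vG => -> | apply: contraNneq vG => ->].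
have degE v : v \notin G -> degree e v = degree delete v + #|[set u in G | e v u]|.
  move=> vG; rewrite /degree -(cardsID G [set w | e v w]) addnC; congr (_ + _).
    by apply: eq_card => u; rewrite !inE /delete /= vG.
  by apply: eq_card => u; rewrite !inE andbC.
have deg0 v : v \notin G -> v != d1 -> v != d2 -> degree delete v = degree e v.
  move=> vG v1 v2; rewrite degE // (_ : [set u in G | e v u] = set0) ?cards0 ?addn0 //.
  apply/setP=> u; rewrite in_set in_set0; apply/negP=> /andP[uG vu]; rewrite e_sym in vu.
  by case: (exits uG vG vu) => [[_ E]|[_ E]]; rewrite E eqxx in v1 v2.
have deg1 v g : v \notin G -> g \in G -> e g v -> (forall u, u \in G -> e u v -> u = g) ->
    degree e v = (degree delete v).+1.
  move=> vG gG gv only; rewrite degE // (_ : [set u in G | e v u] = [set g]) ?cards1 ?addn1 //.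
  apply/setP=> u; rewrite in_set in_set1; apply/andP/eqP => [[uG vu]|->].
    by apply: only; rewrite // e_sym.
  by rewrite e_sym.
have dd1 : degree delete d1 = 2.
  have : degree e d1 = 3 by apply: notG4.
  rewrite (deg1 d1 g1) // => [[//]|u uG ud]; case: (exits uG d1G ud) => [[]|[_ E]] //.
  by move: d12; rewrite E eqxx.
have dd2 : degree delete d2 = 2.
  have : degree e d2 = 3 by apply: notG4.
  rewrite (deg1 d2 g2) // => [[//]|u uG ud]; case: (exits uG d2G ud) => [[_ E]|[]] //.
  by move: d12; rewrite E eqxx.
have n12 : x1 != x2 by move: (un); rewrite /= !inE !negb_or => /andP[/andP[]].
apply: (good_sub sub); apply: (IH (e := delete) (W := W :\: G) (y := d1) (z := d2)).
- apply: proper_card; rewrite properE subsetDl; apply/subsetPn; exists y; first exact: (subsetP GW).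
  by rewrite in_setD yG.
- by move=> u v; rewrite /delete /= e_sym andbCA.
- by move=> u; rewrite /delete /= e_irr !andbF.
- by move=> u v; rewrite in_setD => /and3P[-> _ /supp].
- exact: delete_linked.
- by rewrite /= !inE !negb_or n12 !(eq_sym x1) !(eq_sym x2) d1x1 d1x2 d2x1 d2x2 d12.
- by move=> v; rewrite !inE => /or4P[] /eqP->; rewrite ?x1G ?x2G ?d1G ?d2G.
- move=> v; rewrite !inE => /or4P[] /eqP->; rewrite ?dd1 ?dd2 //.
    by rewrite deg0 1?eq_sym // deg2 // !inE eqxx.
  by rewrite deg0 1?eq_sym // deg2 // !inE eqxx orbT.
- move=> v; rewrite in_setD !inE !negb_or => /andP[vG vW] /and4P[v1 v2 v3 v4].
  by rewrite deg0 // notG4.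
- by rewrite /delete /= x12 !andbF.
- by move=> a b /sub h1 /sub h2 /sub h3 /sub h4; apply: common.
Qed.

End Deletion.

(** * Twins whose common neighbour is adjacent to a root *)

Section TwinsAtRoot.
Variables (V : finType) (e : rel V).
Hypothesis e_sym : symmetric e.
Hypothesis e_irr : irreflexive e.
Variables (W : {set V}) (x1 x2 y z a b d : V).
Hypothesis supp : forall u v, e u v -> u \in W.
Hypothesis deg2x1 : degree e x1 = 2.
Hypothesis deg2x2 : degree e x2 = 2.
Hypothesis deg3 : forall v, v \in W -> v \notin [:: x1; x2; y; z] -> degree e v = 3.
Hypothesis x12 : e x1 x2 = false.
Hypothesis n12 : x1 != x2.
Hypothesis stucky : forall c, avoids x1 x2 c -> iscyc e c -> y \notin reach e c x1 x2.
Hypotheses (ya : e y a) (ax1 : e a x1) (bd : e b d).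
Hypothesis Ny : forall w, e y w -> w \in [:: a; b].
Hypothesis Nz : forall w, e z w -> w \in [:: a; b].
Hypothesis Na : forall w, e a w -> w \in [:: y; z; x1].
Hypothesis Nb : forall w, e b w -> w \in [:: y; z; d].
Hypothesis nx : [/\ x1 \notin [:: y; z; a; b], x2 \notin [:: y; z; a; b] & b != a].
Hypotheses (dx1 : d != x1).
Hypothesis dG : d \notin [:: y; z; a; b].

Let U := [set v in W | v \notin [:: x1; x2; y; z; a; b]].

Let inU v : v \in U -> [/\ v \in W, v != x1, v != x2, v \notin [:: y; z; a; b] & degree e v = 3].
Proof.
rewrite in_set => /andP[vW]; rewrite !inE !negb_or => /and5P[v1 v2 vy vz /andP[va vb]].
by split=> //; [rewrite vy vz va vb | apply: deg3 => //; rewrite !inE !negb_or v1 v2 vy vz].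
Qed.

Let U_acyclic c : iscyc e c -> {subset c <= U} -> False.
Proof.
move=> cc cU.
have nc v : v \in [:: x1; x2; y; z; a; b] -> v \notin c.
  by move=> vin; apply/negP=> /cU; rewrite in_set vin andbF.
have ac : avoids x1 x2 c by rewrite /avoids !nc // !inE eqxx ?orbT.
have := stucky ac cc; apply/negP; rewrite negbK.
have aR : a \in reach e c x1 x2.
  apply: reach_closed ac (reach1 e x1 x2 c) _ _; last by rewrite e_sym.
  by apply: nc; rewrite !inE eqxx ?orbT.
apply: reach_closed ac aR _ _; last by rewrite e_sym.
by apply: nc; rewrite !inE eqxx ?orbT.
Qed.

Let stepU v w : e v w -> v \notin [:: y; z; a; b] -> v != x1 -> w != x1 -> w != x2 ->
  w != b -> w \in U.
Proof.
move=> vw vG v1 w1 w2 wb; have wW : w \in W by apply: supp; rewrite e_sym; apply: vw.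
rewrite in_set wW /= !inE (negPf w1) (negPf w2) (negPf wb) /= orbF; rewrite e_sym in vw.
rewrite !inE !negb_or in vG; case/and4P: vG => vy vz va vb.
apply/negP=> /or3P[] /eqP E; subst w.
- by move: (Ny vw); rewrite !inE (negPf va) (negPf vb).
- by move: (Nz vw); rewrite !inE (negPf va) (negPf vb).
- by move: (Na vw); rewrite !inE (negPf vy) (negPf vz) (negPf v1).
Qed.

(** A cycle inside [U] would leave [y] reachable through [x1] and [a], so [U] is acyclic, while its
    vertices have degree 3. Edges leave [U] only to [x1] (from [m]), to [b] (from [d]) and to [x2].
    Unless [x2] has the distinct neighbours [d] and [m], all vertices of [U] but one keep two
    neighbours there, which yields a cycle. *)
Lemma good_twins_at_root : good e x1 x2.
Proof.
case: nx => x1G x2G ba.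
have bx v : e v b -> v \notin [:: y; z; a; b] -> v = d.
  rewrite e_sym => /Nb; rewrite !inE => /or3P[/eqP->|/eqP->|/eqP//]; by rewrite eqxx ?orbT.
have [m [x1m ma mx]] : exists m, [/\ e x1 m, m != a & forall w, e x1 w -> w = a \/ w = m].
  have [p [q [pq xp xq xs]]] := two_exits deg2x1.
  have xa : e x1 a by rewrite e_sym.
  by case: (xs a xa) => E; subst a; [exists q | exists p]; split=> //;
    [rewrite eq_sym | move=> w /xs[]; [right|left]].
have mU : m \in U.
  rewrite in_set (supp (_ : e m x1)) 1?e_sym //= !inE !negb_or ma /=.
  rewrite eq_sym (edge_neq e_irr x1m) /=.
  have mx2 : m != x2 by apply: contraTneq x1m => ->; rewrite x12.
  rewrite mx2 /=; rewrite e_sym in x1m; apply/and3P; split; apply/eqP=> E; subst m.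
  - by move: (Ny x1m); rewrite !inE => /orP[] /eqP E; move: x1G; rewrite !inE E eqxx ?orbT.
  - by move: (Nz x1m); rewrite !inE => /orP[] /eqP E; move: x1G; rewrite !inE E eqxx ?orbT.
  - by have E := bx x1; move: dx1; rewrite -E ?eqxx // e_sym.
have [mW m1 m2 mG m3] := inU mU.
have toU v w : v \in U -> e v w -> w != x1 -> w != x2 -> w != b -> w \in U.
  by move=> /inU[_ v1 _ vG _] vw; apply: stepU vw vG v1.
have x1only v : v \in U -> e v x1 -> v = m.
  move=> /inU[_ _ _ vG _]; rewrite e_sym => /mx[E|//]; by move: vG; rewrite E !inE eqxx ?orbT.
have bonly v : v \in U -> e v b -> v = d.
  by move=> /inU[_ _ _ vG _] vb; apply: bx.
have x2U w : e x2 w -> w != b -> w \in U.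
  move=> xw wb; apply: (stepU xw x2G) => //; first by rewrite eq_sym.
    by apply: contraTneq xw => ->; rewrite e_sym x12.
  by rewrite eq_sym; apply: edge_neq xw.
have d2 : e x2 d -> d != x2 by rewrite eq_sym; apply: edge_neq.
have dU : e x2 d -> d \in U.
  by move=> xd; apply: x2U => //; apply: contraNneq dG => ->; rewrite !inE eqxx ?orbT.
(* Here both [d] and [m] lose two edges. If they are adjacent, there are paths of lengths 2 and 3
   through [m]; if not, [m] is removed too and only [d] remains exceptional. *)
have [|caseB] := boolP [&& d != m, e x2 d & e x2 m].
  case/and3P=> dm xd xm; have {}dU := dU xd; have [dW _ dx2 _ d3] := inU dU.
  have x2nb w : e x2 w -> w = d \/ w = m.
    have [p [q [pq xp xq xs]]] := two_exits deg2x2.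
    by case: (xs d xd) (xs m xm) => E1 [] E2; subst => // /xs[]; auto; rewrite eqxx in dm.
  have [md|md] := boolP (e m d).
    exists 2; split.
      exists [:: m; x2] => //; split=> //=; first by rewrite x1m e_sym xm.
      by rewrite !inE negb_or n12 (eq_sym x1) m1 m2.
    left; exists [:: m; d; x2] => //; split=> //=; first by rewrite x1m md e_sym xd.
    by rewrite !inE !negb_or n12 (eq_sym x1) m1 m2 (eq_sym x1) dx1 dx2 (eq_sym m) dm.
  exfalso.
  have [|m' [mm' m'1 m'2]] := @third_neighbour _ e x1 x2 m; first by rewrite m3.
  have m'b : m' != b.
    by apply: contraNneq dm => E; rewrite eq_sym; apply/eqP/bonly; rewrite // -E.
  have m'U := toU m m' mU mm' m'1 m'2 m'b.
  have m'U' : m' \in U :\ m by rewrite in_setD1 m'U andbT eq_sym; apply: edge_neq mm'.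
  have m'd : m' != d by apply: contraNneq md => <-.
  have [|c cc cU] := cycle_of_degrees e_sym e_irr m'U' m'd; last first.
    by apply: (U_acyclic cc) => v /cU; rewrite in_setD1 => /andP[].
  move=> v; rewrite in_setD1 => /andP[vm vU] vd; have [_ _ _ _ v3] := inU vU.
  have [||p [q [pq vp vq pm qm]]] := @two_neighbours _ e v [set m].
  - by rewrite v3.
  - by move=> p q _ _; rewrite !in_set1 => /eqP-> /eqP->.
  have inU' t : e v t -> t \notin [set m] -> t \in U :\ m.
    move=> vt; rewrite in_set1 => tm; rewrite in_setD1 tm; apply: (toU v) => //.
    + by apply: contraNneq vm => E; apply/eqP/x1only; rewrite // -E.
    + apply: contraNneq vm => E; rewrite E e_sym in vt.
      by case: (x2nb v vt) => E'; rewrite E' ?eqxx // in vd *.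
    + by apply: contraNneq vd => E; apply/eqP/bonly; rewrite // -E.
  by exists p, q; split=> //; apply: inU'.
(* [e0] is the only vertex of [U] that can have two of its edges leaving: two exits force the vertex
   to be [m], or to be [d] with [d] adjacent to [x2]. *)
exfalso; pose e0 := if e x2 d then d else m.
have [u0 u0U u0e] : exists2 u0, u0 \in U & u0 != e0.
  rewrite /e0; case: ifP => xd.
    have [p [q [pq xp xq xs]]] := two_exits deg2x2.
    have nb w : e x2 w -> w != b.
      move=> xw; apply: contraTneq xw => ->; apply/negP=> xb.
      by have := d2 xd; rewrite -(bx x2 xb x2G) eqxx.
    have [E|pd] := eqVneq p d; last by exists p => //; apply: x2U (nb p xp).
    by exists q; [apply: x2U (nb q xq) | rewrite -E eq_sym].
  have [md|md] := eqVneq m d.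
    have [|t [mt t1 tb]] := @third_neighbour _ e x1 b m; first by rewrite m3.
    exists t; last by rewrite eq_sym; apply: edge_neq mt.
    apply: (toU m) => //; apply: contraFneq xd => E; by rewrite -md -E e_sym.
  have [|t [mt t1 t2]] := @third_neighbour _ e x1 x2 m; first by rewrite m3.
  exists t; last by rewrite eq_sym; apply: edge_neq mt.
  by apply: (toU m) => //; apply: contraNneq md => E; apply/eqP/bonly; rewrite // -E.
have [|c cc cU] := cycle_of_degrees e_sym e_irr u0U u0e; last exact: (U_acyclic cc).
move=> v vU ve; have [_ _ _ _ v3] := inU vU.
have q12 : e v x1 -> e v x2 -> False.
  move=> /(x1only v vU) E; rewrite e_sym => xv; move: ve; rewrite /e0; case: ifP => xd.
    by move=> vd; move: caseB; rewrite xd -E xv eq_sym vd.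
  by rewrite E eqxx.
have q1b : e v x1 -> e v b -> False.
  move=> /(x1only v vU) E1 /(bonly v vU) E2; move: ve; rewrite /e0; case: ifP => _.
    by rewrite E2 eqxx.
  by rewrite E1 eqxx.
have q2b : e v x2 -> e v b -> False.
  rewrite e_sym => xv /(bonly v vU) E; move: ve; rewrite /e0 -E xv E.
  by rewrite eqxx.
have [||p [q [pq vp vq]]] := @two_neighbours _ e v [set x1; x2; b].
- by rewrite v3.
- move=> p q vp vq; rewrite !inE -!orbA.
  case/or3P=> /eqP Ep; case/or3P=> /eqP Eq; rewrite Ep Eq //; rewrite Ep in vp; rewrite Eq in vq;
    exfalso; by [apply: q12 | apply: q1b | apply: q2b].
rewrite !inE !negb_or -!andbA => /and3P[p1 p2 pb] /and3P[q1 q2 qb].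
by exists p, q; split=> //; apply: (toU v).
Qed.

End TwinsAtRoot.

(** * Two exceptional vertices *)

Section Main.
Variables (V : finType) (e : rel V).
Hypothesis e_sym : symmetric e.
Hypothesis e_irr : irreflexive e.
Variables (W : {set V}).
Hypothesis supp : forall u v, e u v -> u \in W.
Hypothesis IH : two_exceptions_below V #|W|.

Lemma max_cycle x1 x2 y c : linked e x1 x2 W -> avoids x1 x2 c -> iscyc e c -> y \notin c ->
  exists c', [/\ avoids x1 x2 c', iscyc e c', y \notin c' & ~ growable e x1 x2 [set y] c'].
Proof.
move=> lnk; have [n] := ubnP (#|V| - #|reach e c x1 x2|).
elim: n c => // n IHn c hn ac cc yc.
have [[c' [cc' ac' yc' _ lt]]|ng] := classic (growable e x1 x2 [set y] c); last by exists c.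
apply: (IHn c') => //; last by apply: yc'; rewrite set11.
have : #|reach e c' x1 x2| <= #|V| := max_card _.
by move: hn lt; clear; lia.
Qed.

Section Roots.
Variables (x1 x2 : V).
Hypothesis lnk : linked e x1 x2 W.
Hypotheses (x1W : x1 \in W) (x2W : x2 \in W) (n12 : x1 != x2).
Hypotheses (deg1 : degree e x1 = 2) (deg2 : degree e x2 = 2).
Hypothesis x12 : e x1 x2 = false.
Hypothesis common : forall a b, e x1 a -> e x2 a -> e x1 b -> e x2 b -> a = b.
Hypothesis ngood : ~ good e x1 x2.

(** Only the third edges of [a] and [b] leave the set of [y], [z], [a] and [b], and by [linked] they
    have distinct ends outside it. If one of these ends is a root the special case above applies,
    and otherwise [good_delete]. *)
Lemma twins_false y z a b : uniq [:: x1; x2; y; z] -> {subset [:: x1; x2; y; z] <= W} ->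
  (forall v, v \in [:: x1; x2; y; z] -> degree e v = 2) ->
  (forall v, v \in W -> v \notin [:: x1; x2; y; z] -> degree e v = 3) ->
  (forall c, avoids x1 x2 c -> iscyc e c -> y \notin reach e c x1 x2) ->
  a != b -> e y a -> e y b -> e z a -> e z b -> a != x1 -> a != x2 -> b != x1 -> b != x2 ->
  False.
Proof.
move=> un inW d2 d3 sty ab ya yb za zb a1 a2 b1 b2.
have [[_ x1y x1z x2y x2z] yz] := distinct un.
have [yin zin] : y \in [:: x1; x2; y; z] /\ z \in [:: x1; x2; y; z] by rewrite !inE !eqxx !orbT.
have nbrs v p q : degree e v = 2 -> p != q -> e v p -> e v q -> forall w, e v w -> w \in [:: p; q].
  move=> dv pq vp vq w vw; apply: contraT => wn.
  have : size [:: w; p; q] <= degree e v.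
    by apply: degree_uniq; rewrite /= ?vw ?vp ?vq // wn !inE pq.
  by rewrite dv.
have Ny := nbrs y a b (d2 y yin) ab ya yb.
have Nz := nbrs z a b (d2 z zin) ab za zb.
have cub v : e y v -> e z v -> v != x1 -> v != x2 -> exists d, [/\ e v d, d \notin [:: y; z],
    degree e v = 3 & forall w, e v w -> w \in [:: y; z; d]].
  move=> yv zv v1 v2; have vW : v \in W by apply: supp; rewrite e_sym; apply: yv.
  have v3 : degree e v = 3.
    apply: d3 => //; rewrite !inE !negb_or v1 v2 !(eq_sym v).
    by rewrite (edge_neq e_irr yv) (edge_neq e_irr zv).
  have [|d [vd dy dz]] := @third_neighbour _ e y z v; first by rewrite v3.
  exists d; split=> //; first by rewrite !inE negb_or dy dz.
  move=> w vw; apply: contraT => wn; have : size [:: w; y; z; d] <= degree e v.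
    apply: degree_uniq; rewrite /= ?vw ?vd ?(e_sym v y) ?(e_sym v z) ?yv ?zv // wn.
    by rewrite !inE negb_or yz !(eq_sym _ d) dy dz.
  by rewrite v3.
have [d1 [ad1 d1n a3 Na]] := cub a ya za a1 a2.
have [e2 [bd2 d2n b3 Nb]] := cub b yb zb b1 b2.
pose G := [set y; z; a; b].
have inG v : (v \in G) = (v \in [:: y; z; a; b]) by rewrite !inE -!orbA.
have aW : a \in W by apply: supp; rewrite e_sym; apply: ya.
have bW : b \in W by apply: supp; rewrite e_sym; apply: yb.
have GW : G \subset W.
  by apply/subsetP=> v; rewrite inG !inE => /or4P[] /eqP-> //; apply: inW.
have G0 : G != set0 by apply/set0Pn; exists y; rewrite inG mem_head.
have x1G : x1 \notin G by rewrite inG !inE !negb_or x1y x1z !(eq_sym x1) a1 b1.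
have x2G : x2 \notin G by rewrite inG !inE !negb_or x2y x2z !(eq_sym x2) a2 b2.
have out u v : u \in G -> v \notin G -> e u v -> (u = a /\ v = d1) \/ (u = b /\ v = e2).
  rewrite !inG => uG vG uv; move: (vG); rewrite !inE !negb_or => /and4P[vy vz va vb].
  move: uG; rewrite !inE => /or4P[] /eqP Eu; rewrite Eu in uv *.
  - by move: (Ny v uv); rewrite !inE (negPf va) (negPf vb).
  - by move: (Nz v uv); rewrite !inE (negPf va) (negPf vb).
  - by left; move: (Na v uv); rewrite !inE (negPf vy) (negPf vz) /= => /eqP.
  - by right; move: (Nb v uv); rewrite !inE (negPf vy) (negPf vz) /= => /eqP.
have d1a : d1 != a by rewrite eq_sym; apply: edge_neq ad1.
have e2b : e2 != b by rewrite eq_sym; apply: edge_neq bd2.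
have nab : e a b = false.
  apply/negP=> eab.
  have E1 : d1 = b.
    have := Na b eab; rewrite !inE -(negbK (b == y)) eq_sym (edge_neq e_irr yb) /=.
    by rewrite eq_sym -(negbK (z == b)) (edge_neq e_irr zb) /= => /eqP.
  have E2 : e2 = a.
    have := Nb a (_ : e b a); rewrite e_sym => /(_ eab).
    rewrite !inE -(negbK (a == y)) eq_sym (edge_neq e_irr ya) /=.
    by rewrite eq_sym -(negbK (z == a)) (edge_neq e_irr za) /= => /eqP.
  have [u [v [uG vG _ uv]]] := lnk GW G0 x1G x2G x1G.
  by case: (out u v uG vG uv) => [[_ E]|[_ E]]; move: vG; rewrite E ?E1 ?E2 inG !inE eqxx ?orbT.
have d1b : d1 != b by apply: contraFneq nab => <-.
have e2a : e2 != a by apply: contraFneq nab => <-; rewrite e_sym.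
have d1G : d1 \notin G.
  by move: d1n; rewrite inG !inE !negb_or d1a d1b => /andP[-> ->].
have e2G : e2 \notin G.
  by move: d2n; rewrite inG !inE !negb_or e2a e2b => /andP[-> ->].
have d12 : d1 != e2.
  apply/eqP=> E; have [u [v [uG vG vd uv]]] := lnk GW G0 x1G x2G d1G.
  by case: (out u v uG vG uv) => [[_ E']|[_ E']]; move: vd; rewrite E' -?E eqxx.
have x1L := x1G; rewrite inG in x1L. have x2L := x2G; rewrite inG in x2L.
have d1L := d1G; rewrite inG in d1L. have e2L := e2G; rewrite inG in e2L.
have swap (v p q r s : V) : (v \in [:: p; q; r; s]) = (v \in [:: p; q; s; r]).
  by rewrite !inE; case: (v == p); case: (v == q); case: (v == r); rewrite ?orbT ?orbF.
have swap4 (v p q r s : V) : (v \in [:: p; q; r; s]) = (v \in [:: q; p; r; s]).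
  by rewrite !inE; case: (v == p); case: (v == q); rewrite ?orbT.
have d3' v : v \in W -> v \notin [:: x2; x1; y; z] -> degree e v = 3.
  by move=> vW; rewrite swap4; apply: d3.
have sty' c : avoids x2 x1 c -> iscyc e c -> y \notin reach e c x2 x1.
  by rewrite avoids_sym reach_sym; apply: sty.
have Ny' w : e y w -> w \in [:: b; a] by move=> /Ny; rewrite !inE orbC.
have Nz' w : e z w -> w \in [:: b; a] by move=> /Nz; rewrite !inE orbC.
have n21 : x2 != x1 by rewrite eq_sym.
have x21 : e x2 x1 = false by rewrite e_sym.
have [E|d1x1] := eqVneq d1 x1.
  subst d1; apply: ngood.
  by apply: (good_twins_at_root (y := y) (z := z) (a := a) (b := b) (d := e2)
    e_sym e_irr supp deg1 deg2 d3 x12 n12 sty) => //; rewrite eq_sym.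
have [E|d2x1] := eqVneq e2 x1.
  subst e2; apply: ngood.
  by apply: (good_twins_at_root (y := y) (z := z) (a := b) (b := a) (d := d1)
    e_sym e_irr supp deg1 deg2 d3 x12 n12 sty) => //; rewrite ?(swap _ _ _ b) // swap.
have [E|d1x2] := eqVneq d1 x2.
  subst d1; apply: ngood; apply: good_sym => //.
  by apply: (good_twins_at_root (y := y) (z := z) (a := a) (b := b) (d := e2)
    e_sym e_irr supp deg2 deg1 d3' x21 n21 sty') => //; rewrite eq_sym.
have [E|d2x2] := eqVneq e2 x2.
  subst e2; apply: ngood; apply: good_sym => //.
  by apply: (good_twins_at_root (y := y) (z := z) (a := b) (b := a) (d := d1)
    e_sym e_irr supp deg2 deg1 d3' x21 n21 sty') => //; rewrite ?(swap _ _ _ b) // swap.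
have aG : a \in G by rewrite inG !inE eqxx ?orbT.
have bG : b \in G by rewrite inG !inE eqxx ?orbT.
have yG : y \in G by rewrite inG mem_head.
have zG : z \in G by rewrite inG !inE eqxx ?orbT.
have rG : rooted e G y.
  split=> // S sS /set0Pn[s sS'] yS.
  have sG u : u \in S -> u != y /\ u \in [:: y; z; a; b].
    by move=> uS; split; [apply: contraNneq yS => <- | rewrite -inG; apply: (subsetP sS)].
  have [aS|aS] := boolP (a \in S); first by exists a, y; rewrite e_sym.
  have [sy] := sG s sS'; rewrite !inE (negPf sy) /= => /or3P[] /eqP E; subst s.
  - by exists z, a.
  - by rewrite sS' in aS.
  - by exists b, y; rewrite e_sym.
exact: ngood (good_delete e_sym e_irr supp lnk un inW d2 d3 x12 common sty IH GW yG zG x1G x2G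
  rG ad1 bd2 aG bG d1G e2G d12 d1x1 d1x2 d2x1 d2x2 out).
Qed.

Lemma rung_false y z c : uniq [:: x1; x2; y; z] -> {subset [:: x1; x2; y; z] <= W} ->
  (forall v, v \in [:: x1; x2; y; z] -> degree e v = 2) ->
  (forall v, v \in W -> v \notin [:: x1; x2; y; z] -> degree e v = 3) ->
  (forall c, avoids x1 x2 c -> iscyc e c -> y \notin reach e c x1 x2) ->
  (forall c, avoids x1 x2 c -> iscyc e c -> z \notin reach e c x1 x2) ->
  avoids x1 x2 c -> iscyc e c -> y \notin c -> e y z -> False.
Proof.
move=> un inW d2 d3 sty stz ac cc yc yz.
have [[_ x1y x1z x2y x2z] nyz] := distinct un.
have [yin zin] : y \in [:: x1; x2; y; z] /\ z \in [:: x1; x2; y; z] by rewrite !inE !eqxx !orbT.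
have other v p : degree e v = 2 -> e v p ->
    exists q, [/\ q != p, e v q & forall w, e v w -> w = p \/ w = q].
  move=> dv vp; have [q [r [qr vq vr vs]]] := two_exits dv.
  case: (vs p vp) => E; subst p; first by exists r; split=> //; rewrite eq_sym.
  by exists q; split=> // w /vs[]; [right|left].
have [f1 [f1z yf1 Ny]] := other y z (d2 y yin) yz.
have zy : e z y by rewrite e_sym.
have [f2 [f2y zf2 Nz]] := other z y (d2 z zin) zy.
(* Of the two neighbours of [z] one is [y], which is off [c]; a vertex of [c] needs two neighbours
   on it. *)
have zc : z \notin c.
  apply/negP=> zc; have ny v : v \in c -> v != y by move=> vc; apply: contraNneq yc => <-.
  have E1 : next c z = f2.
    by case: (Nz _ (cyc_next cc zc)) => // E; have := ny (next c z); rewrite mem_next E eqxx => /(_ zc).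
  have E2 : prev c z = f2.
    by case: (Nz _ (cyc_prev e_sym cc zc)) => // E; have := ny (prev c z); rewrite mem_prev E eqxx => /(_ zc).
  by have := next_neq_prev cc zc; rewrite E1 E2 eqxx.
have noroot v x : v \notin c -> (forall c, avoids x1 x2 c -> iscyc e c -> v \notin reach e c x1 x2) ->
    x \in reach e c x1 x2 -> e v x -> False.
  move=> vc st xR vx; have := st c ac cc; apply/negP; rewrite negbK.
  by apply: reach_closed xR vc _; rewrite // e_sym.
(* A root adjacent to [y] or [z] would make that vertex reachable, so deletion leaves the roots'
   degrees alone. *)
have f1x1 : f1 != x1 by apply/eqP=> E; subst f1; exact: (noroot y x1 yc sty (reach1 _ _ _ _)).
have f1x2 : f1 != x2 by apply/eqP=> E; subst f1; exact: (noroot y x2 yc sty (reach2 _ _ _ _)).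
have f2x1 : f2 != x1 by apply/eqP=> E; subst f2; exact: (noroot z x1 zc stz (reach1 _ _ _ _)).
have f2x2 : f2 != x2 by apply/eqP=> E; subst f2; exact: (noroot z x2 zc stz (reach2 _ _ _ _)).
pose G := [set y; z].
have yG : y \in G by rewrite set21.
have zG : z \in G by rewrite set22.
have GW : G \subset W by apply/subsetP=> v; rewrite in_set2 => /orP[] /eqP->; apply: inW.
have x1G : x1 \notin G by rewrite in_set2 negb_or x1y x1z.
have x2G : x2 \notin G by rewrite in_set2 negb_or x2y x2z.
have f1G : f1 \notin G by rewrite in_set2 negb_or f1z andbT eq_sym (edge_neq e_irr yf1).
have f2G : f2 \notin G by rewrite in_set2 negb_or f2y eq_sym (edge_neq e_irr zf2).
have G0 : G != set0 by apply/set0Pn; exists y.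
have out u v : u \in G -> v \notin G -> e u v -> (u = y /\ v = f1) \/ (u = z /\ v = f2).
  rewrite !in_set2 negb_or => /orP[] /eqP-> /andP[vy vz].
    by case/Ny=> E; [rewrite E eqxx in vz | left].
  by case/Nz=> E; [rewrite E eqxx in vy | right].
have f12 : f1 != f2.
  apply/eqP=> E; have [u [v [uG vG vd uv]]] := lnk GW G0 x1G x2G f1G.
  by case: (out u v uG vG uv) => [[_ E']|[_ E']]; move: vd; rewrite E' -?E eqxx.
have rG : rooted e G y.
  split=> // S sS /set0Pn[s sS'] yS; exists s, y; split=> //.
  have := subsetP sS _ sS'; rewrite in_set2 => /orP[] /eqP E; subst s => //.
  by rewrite sS' in yS.
exact: ngood (good_delete e_sym e_irr supp lnk un inW d2 d3 x12 common sty IH GW yG zG x1G x2G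
  rG yf1 zf2 yG zG f1G f2G f12 f1x1 f1x2 f2x1 f2x2 out).
Qed.

Lemma no_cycle_off y z c : uniq [:: x1; x2; y; z] -> {subset [:: x1; x2; y; z] <= W} ->
  (forall v, v \in [:: x1; x2; y; z] -> degree e v = 2) ->
  (forall v, v \in W -> v \notin [:: x1; x2; y; z] -> degree e v = 3) ->
  (forall c, avoids x1 x2 c -> iscyc e c -> y \notin reach e c x1 x2) ->
  (forall c, avoids x1 x2 c -> iscyc e c -> z \notin reach e c x1 x2) ->
  avoids x1 x2 c -> iscyc e c -> y \notin c -> False.
Proof.
move=> un inW d2 d3 sty stz ac0 cc0 yc0.
have [c' [ac cc yc mx]] := max_cycle lnk ac0 cc0 yc0.
have nx v : v \in c' -> v != x1 /\ v != x2.
  by move=> vc; split; apply: contraTneq vc => ->; case/andP: ac.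
have [yz|[a [b [ab [ya yb] [za zb] /andP[/nx[a1 a2] /nx[b1 b2]] _]]]] :=
  rung_or_twins e_sym e_irr supp lnk un inW d2 d3 sty stz ac cc yc mx.
  exact: (rung_false un inW d2 d3 sty stz ac cc yc yz).
exact: (twins_false un inW d2 d3 sty ab ya yb za zb).
Qed.

Variables y z : V.
Hypothesis un : uniq [:: x1; x2; y; z].
Hypothesis inW : {subset [:: x1; x2; y; z] <= W}.
Hypothesis d2 : forall v, v \in [:: x1; x2; y; z] -> degree e v = 2.
Hypothesis d3 : forall v, v \in W -> v \notin [:: x1; x2; y; z] -> degree e v = 3.

(** By parity [W] has 4, 6 or 8 vertices. With 4 vertices, [y] and [z] are two common neighbours of
    the roots; the other cases are read off from the searches. *)
Lemma small_false :
  #|W| <= 8 -> (e y x1 || e y x2 -> #|W| <= 6) -> (e z x1 || e z x2 -> #|W| <= 6) -> False.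
Proof.
move=> W8 Wy Wz; have ev := card_even e_sym e_irr supp un inW d2 d3.
pose S := [set v in [:: x1; x2; y; z]].
have cS : #|S| = 4 by rewrite cardsE; apply/card_uniqP.
have SW : S \subset W by apply/subsetP=> v; rewrite in_set => /inW.
have cR : #|W| = #|W :\: S| + 4 by rewrite -(cardsID S W) (setIidPr SW) cS addnC.
have [p1 [q1 [pq1 xp xq Nx]]] := two_exits deg1.
have [R0|[R2|R4]] : #|W :\: S| = 0 \/ #|W :\: S| = 2 \/ #|W :\: S| = 4.
  by move: W8 ev cR; clear; lia.
- have WS v : v \in W -> v \in [:: x1; x2; y; z].
    move=> vW; have := cards0_eq R0 => /setP/(_ v); rewrite in_setD vW andbT in_set0 in_set.
    by move=> /negbT; rewrite negbK.
  have inYZ x v : x \in [:: x1; x2] -> e x v -> v \in [:: y; z].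
    move=> xin xv; have vW : v \in W by apply: supp; rewrite e_sym; apply: xv.
    have := WS v vW; rewrite !inE => /or4P[] /eqP E; subst v; rewrite ?eqxx ?orbT //.
      by move: xin; rewrite !inE => /orP[] /eqP E; rewrite E ?e_irr // e_sym x12 in xv.
    by move: xin; rewrite !inE => /orP[] /eqP E; rewrite E ?e_irr // x12 in xv.
  have [p2 [q2 [pq2 yp yq _]]] := two_exits deg2.
  have i1 : x1 \in [:: x1; x2] by rewrite !inE eqxx.
  have i2 : x2 \in [:: x1; x2] by rewrite !inE eqxx orbT.
  have := inYZ _ _ i1 xp; have := inYZ _ _ i1 xq; have := inYZ _ _ i2 yp; have := inYZ _ _ i2 yq.
  have ne : p1 <> q1 by apply/eqP.
  have ne2 : p2 <> q2 by apply/eqP.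
  rewrite !inE => /orP[] /eqP E1 /orP[] /eqP E2 /orP[] /eqP E3 /orP[] /eqP E4; subst => //;
    by apply: ne; apply: common.
- have /cards2P[p [q [pq E]]] : #|W :\: S| == 2 by rewrite R2.
  have Wv v : (v \in W) = (v \in [:: x1; x2; y; z; p; q]).
    rewrite -[W](setID W S) (setIidPr SW) E !inE -!orbA.
    by [].
  have rest v : v \in [:: p; q] -> v \in W /\ v \notin [:: x1; x2; y; z].
    by move=> vin; have : v \in W :\: S; [rewrite E !inE in vin * | rewrite in_setD in_set => /andP[]].
  have uall : uniq [:: x1; x2; y; z; p; q].
    rewrite -[[:: _, _ & _]]/([:: x1; x2; y; z] ++ [:: p; q]) cat_uniq un /= mem_seq1 pq andbT.
    by rewrite orbF negb_or (rest p _).2 ?(rest q _).2 // !inE eqxx ?orbT.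
  apply/ngood/(good6 e_sym e_irr supp lnk common x12 uall Wv).
  case=> [|[|[|[|[|[|i]]]]]] //= _.
  + by apply: d2; rewrite !inE eqxx ?orbT.
  + by apply: d2; rewrite !inE eqxx ?orbT.
  + by apply: d3; [apply: (rest p _).1 | apply: (rest p _).2]; rewrite !inE eqxx ?orbT.
  + by apply: d3; [apply: (rest q _).1 | apply: (rest q _).2]; rewrite !inE eqxx ?orbT.
have n6 : ~ #|W| <= 6 by move: R4 cR; clear; lia.
have [ny1 ny2] : e y x1 = false /\ e y x2 = false.
  by split; apply/negP=> h; apply/n6/Wy; rewrite h ?orbT.
have [nz1 nz2] : e z x1 = false /\ e z x2 = false.
  by split; apply/negP=> h; apply/n6/Wz; rewrite h ?orbT.
have nb v : e x1 v -> v \in W :\: S.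
  move=> xv; have vW : v \in W by apply: supp; rewrite e_sym; apply: xv.
  rewrite in_setD vW in_set andbT !inE !negb_or; apply/and4P; split.
  - by rewrite eq_sym; apply: edge_neq xv.
  - by apply: contraTneq xv => ->; rewrite x12.
  - by apply: contraTneq xv => ->; rewrite e_sym ny1.
  - by apply: contraTneq xv => ->; rewrite e_sym nz1.
have pR := nb p1 xp; have qR := nb q1 xq.
have c2 : #|(W :\: S) :\ p1 :\ q1| == 2.
  have := R4; rewrite (cardsD1 p1) pR (cardsD1 q1) in_setD1 qR eq_sym pq1 /=.
  by move=> /eqP; rewrite !add1n !eqSS.
have /cards2P[r [t [rt E]]] := c2.
have ER : W :\: S = [set p1; q1; r; t].
  rewrite -(setD1K pR) -(setD1K (_ : q1 \in (W :\: S) :\ p1)) ?E.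
    by rewrite !setUA.
  by rewrite in_setD1 qR eq_sym pq1.
have [rin tin] : r \in (W :\: S) :\ p1 :\ q1 /\ t \in (W :\: S) :\ p1 :\ q1.
  by rewrite E set21 set22.
rewrite !in_setD1 in rin tin.
case/and3P: rin => rq rp rR; case/and3P: tin => tq tp tR.
have Wv v : (v \in W) = (v \in [:: x1; x2; y; z; p1; q1; r; t]).
  rewrite -[W](setID W S) (setIidPr SW) ER !inE -!orbA.
  by [].
have rest v : v \in W :\: S -> v \in W /\ v \notin [:: x1; x2; y; z].
  by rewrite in_setD in_set => /andP[].
have uall : uniq [:: x1; x2; y; z; p1; q1; r; t].
  rewrite -[[:: _, _ & _]]/([:: x1; x2; y; z] ++ [:: p1; q1; r; t]) cat_uniq un andTb.
  apply/andP; split.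
    apply/hasPn=> v; rewrite mem_seq4.
    case/or4P=> /eqP->; [exact: (rest p1 pR).2|exact: (rest q1 qR).2|exact: (rest r rR).2|].
    exact: (rest t tR).2.
  by rewrite /= !inE !negb_or pq1 rt !(eq_sym p1) !(eq_sym q1) rp rq tp tq.
apply/ngood/(good8 e_sym e_irr supp lnk common x12 uall Wv); rewrite // ?(e_sym x1) ?(e_sym x2) //;
  try by rewrite e_sym.
case=> [|[|[|[|[|[|[|[|i]]]]]]]] //= _;
  try (by apply: d2; rewrite !inE eqxx ?orbT); apply: d3.
- exact: (rest p1 pR).1.
- exact: (rest p1 pR).2.
- exact: (rest q1 qR).1.
- exact: (rest q1 qR).2.
- exact: (rest r rR).1.
- exact: (rest r rR).2.
- exact: (rest t tR).1.
- exact: (rest t tR).2.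
Qed.

End Roots.
End Main.

(** In a counterexample every cycle that avoids the roots passes through both [y] and [z]. Removing
    the roots and either one of them leaves a forest, and [card_acyclic], applied in both ways,
    bounds the graph. *)
Lemma good_two_exceptions (V : finType) k : two_exceptions_below V k.
Proof.
elim: k => [|k IHk] e W x1 x2 y z; first by rewrite ltn0.
rewrite ltnS => Wk e_sym e_irr supp lnk un inW d2 d3 x12 common; apply: NNPP => ng.
have IH : two_exceptions_below V #|W|.
  by move=> e' W' y1 y2 y3 y4 hW; apply: IHk; apply: leq_trans Wk.
have perm v : (v \in [:: x1; x2; z; y]) = (v \in [:: x1; x2; y; z]).
  by rewrite !inE; case: (v == x1); case: (v == x2); rewrite //= orbC.
have un' : uniq [:: x1; x2; z; y].
  move: un; rewrite /= !inE !negb_or !andbT => /and3P[/and3P[-> -> ->] /andP[-> ->]].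
  by rewrite eq_sym.
have inW' : {subset [:: x1; x2; z; y] <= W} by move=> v; rewrite perm; apply: inW.
have d2' v : v \in [:: x1; x2; z; y] -> degree e v = 2 by rewrite perm; apply: d2.
have d3' v : v \in W -> v \notin [:: x1; x2; z; y] -> degree e v = 3.
  by rewrite perm; apply: d3.
have [[n12 x1y x1z x2y x2z] yz] := distinct un.
have x1W : x1 \in W by apply: inW; rewrite !inE eqxx.
have x2W : x2 \in W by apply: inW; rewrite !inE eqxx orbT.
have [deg1 deg2] : degree e x1 = 2 /\ degree e x2 = 2.
  by split; apply: d2; rewrite !inE eqxx ?orbT.
have degW v : v \in W -> v != x1 -> v != x2 -> degree e v <= 3.
  move=> vW _ _; have [h|h] := boolP (v \in [:: x1; x2; y; z]); last by rewrite d3.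
  by rewrite d2.
have sty c : avoids x1 x2 c -> iscyc e c -> y \notin reach e c x1 x2.
  move=> ac cc; apply/negP=> yR; apply: ng.
  apply: (good_of_cycle (z := z) e_sym e_irr supp (@good_one_exception V _) lnk) yR => //.
  by move=> v vW v1 v2 vy vz; apply: d3; rewrite // !inE !negb_or v1 v2 vy vz.
have stz c : avoids x1 x2 c -> iscyc e c -> z \notin reach e c x1 x2.
  move=> ac cc; apply/negP=> zR; apply: ng.
  apply: (good_of_cycle (z := y) e_sym e_irr supp (@good_one_exception V _) lnk) zR => //.
  by move=> v vW v1 v2 vz vy; apply: d3; rewrite // !inE !negb_or v1 v2 vy vz.
have offy c : avoids x1 x2 c -> iscyc e c -> y \notin c -> False.
  exact: (no_cycle_off e_sym e_irr supp IH lnk n12 deg1 deg2 x12 common ng un inW d2 d3 sty stz).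
have offz c : avoids x1 x2 c -> iscyc e c -> z \notin c -> False.
  exact: (no_cycle_off e_sym e_irr supp IH lnk n12 deg1 deg2 x12 common ng un' inW' d2' d3' stz sty).
have acyc v c : (forall c, avoids x1 x2 c -> iscyc e c -> v \notin c -> False) -> iscyc e c ->
    {subset c <= W :\: [set x1; x2; v]} -> False.
  move=> off cc cU; have n u : u \in [set x1; x2; v] -> u \notin c.
    by move=> uS; apply/negP=> /cU; rewrite in_setD uS.
  by apply: (off c) => //; rewrite /avoids ?n // !inE eqxx ?orbT.
have [W8 Wy] := card_acyclic e_sym e_irr supp un inW d2 d3 (fun c => @acyc y c offy).
have [_ Wz] := card_acyclic e_sym e_irr supp un' inW' d2' d3' (fun c => @acyc z c offz).
exact: (small_false e_sym e_irr supp lnk deg1 deg2 x12 common ng un inW d2 d3 W8 Wy Wz).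
Qed.

Theorem theorem4p4 (V : finType) (e : rel V) (x1 x2 y z : V)
    (hG : simple_graph e)
    (h2conn : k_connected e 2)
    (hdistinct : uniq [:: x1; x2; y; z])
    (hdeg2 : forall v : V, v \in [:: x1; x2; y; z] -> degree e v = 2)
    (hdeg3 : forall v : V, v \notin [:: x1; x2; y; z] -> degree e v = 3)
    (hnadj : ~~ e x1 x2)
    (hnopp : ~ opposite_in_4cycle e x1 x2) :
  exists p1 p2 : seq V,
    [/\ path_between e x1 x2 p1, path_between e x1 x2 p2
      & size p1 = size p2 + 1 \/ size p1 = size p2 + 2].
Proof.
have [e_sym e_irr] := hG; have [_ conn] := h2conn.
have [[n12 _ _ _ _] _] := distinct hdistinct.
have lnk : linked e x1 x2 [set: V].
  move=> S w _ /set0Pn[s sS] x1S x2S wS.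
  (* One of the roots differs from [w]; a path from it to [S] avoiding [w] must cross into [S]. *)
  have [x [xS xw]] : exists x, x \notin S /\ x != w.
    by have [E|x1w] := eqVneq x1 w; [exists x2; rewrite -E eq_sym | exists x1].
  have /conn /(_ x s) con : #|[set w]| < 2 by rewrite cards1.
  have sw : s != w by apply: contraNneq wS => <-.
  rewrite !in_set1 in con; have [a [b [_ aS bS /and3P[aw _ ab]]]] := connect_cross (con xw sw) xS sS.
  by exists b, a; rewrite e_sym; split=> //; rewrite -in_set1.
have common a b : e x1 a -> e x2 a -> e x1 b -> e x2 b -> a = b.
  move=> h1 h2 h3 h4; apply/eqP; apply: contraT => ab; case: hnopp; exists a, b.
  rewrite /ucycle /cycle /= h1 (e_sym a) h2 h4 (e_sym b) h3 /=.
  rewrite !inE !negb_or n12 (edge_neq e_irr h1) (edge_neq e_irr h3) ab (edge_neq e_irr h4).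
  by rewrite eq_sym (edge_neq e_irr h2).
have [l [[p2 b2 s2] h]] : good e x1 x2.
  apply: (@good_two_exceptions V #|V|.+1 e [set: V] x1 x2 y z) => //.
  - by rewrite cardsT.
  - by move=> v _; rewrite in_setT.
  - by move=> v _; apply: hdeg3.
  - exact: negPf.
case: h => [[p1 b1 s1]|[p1 b1 s1]]; exists p1, p2; split=> //; rewrite s1 s2.
  by left; rewrite addn1.
by right; rewrite addn2.
Qed.
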